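(* Let $\omega\in\mathbb{R}$ and $0<T_1<T_2$. There exists $\gamma>0$ such that for any $u_0\in H^6$ with $\|u_0\|_{H^6}<\gamma$, there is a unique solution $u\in C([0,T_2];H^6)$ of the initial value problem $$\partial_t u=\partial_x^5u-2u\,\partial_xu+\omega\,\partial_xu,\qquad u(\cdot,0)=u_0.$$ Moreover, there exist $c>0$ and $\tilde\gamma\in(0,\gamma)$ such that for any $T\in[T_1,T_2]$ and any $u_0\in H^6_0$ with $\|u_0\|_{H^6}<\tilde\gamma$, $$\|S_D(T)u_0\|_{H^8}\le c\,\|u_0\|_{H^6}^2.$$
   Context: All functions are real-valued and $2\pi$-periodic in $x$; $H^s$ is the usual spatially periodic Sobolev space and $H^s_0$ its subspace of mean-zero functions. With $A=\partial_x^5+\omega\partial_x$, $S_L(t)=e^{At}$ and, for the solution $u$ with $u(\cdot,0)=u_0$, $S_D(t)u_0=\int_0^te^{A(t-\tau)}\bigl(-2u\,\partial_xu\bigr)(\cdot,\tau)\,d\tau=u(\cdot,t)-S_L(t)u_0$ is the Duhamel integral. *)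

(* Defs.v *)
From HB Require Import structures.
From mathcomp Require Import all_boot all_order all_algebra.
From mathcomp Require Import all_classical all_reals all_analysis.

Set Implicit Arguments.
Unset Strict Implicit.
Unset Printing Implicit Defensive.

Import Order.TTheory GRing.Theory Num.Theory.
Import numFieldNormedType.Exports.

Local Open Scope classical_set_scope.
Local Open Scope ring_scope.

Section Periodic_Sobolev.
Variable R : realType.
Implicit Types (f : R -> R) (u : R -> R -> R) (k : int) (s : nat).
Implicit Types (omega t T x : R).

Local Notation mu := (@lebesgue_measure R).

(* For real f, the Fourier coefficient (1/2pi) \int_0^{2pi} f(x) e^{-ikx} dx
   is fcos f k - i fsin f k. *)
Definition fcos f k : R :=
  (2 * pi)^-1 * \int[mu]_(x in `[0, 2 * pi]) (f x * cos (k%:~R * x)).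

Definition fsin f k : R :=
  (2 * pi)^-1 * \int[mu]_(x in `[0, 2 * pi]) (f x * sin (k%:~R * x)).

(* The squared H^s norm \sum_{k in Z} (1 + k^2)^s |\hat f(k)|^2, possibly
   infinite. *)
Definition sobolev_sqnorm s f : \bar R :=
  \esum_(k in [set: int])
    ((1 + (k%:~R : R) ^+ 2) ^+ s * (fcos f k ^+ 2 + fsin f k ^+ 2))%:E.

(* Elements are functions, not classes modulo a.e. equality: every notion
   below that is applied to an arbitrary element of H^s is insensitive to the
   choice of the representative. *)
Definition sobolev s : set (R -> R) :=
  [set f : R -> R |
    [/\ forall x, f (x + 2 * pi) = f x,
        measurable_fun [set: R] f,
        mu.-integrable `[0, 2 * pi] (fun x => (f x ^+ 2)%:E) &
        (sobolev_sqnorm s f < +oo)%E]].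

(* Only meaningful on sobolev s, since fine +oo = 0. *)
Definition sobolev_norm s f : R := Num.sqrt (fine (sobolev_sqnorm s f)).

Definition sobolev0 s : set (R -> R) :=
  [set f : R -> R | sobolev s f /\ \int[mu]_(x in `[0, 2 * pi]) f x = 0].

(* u is a solution in C([0, T]; H^6), with u t x standing for u(x, t). Each u t
   is the continuous representative of its class; by the Sobolev embedding
   H^6 -> C^5 it then has five classical derivatives in x, and the equation
   holds pointwise. Since u0 is an arbitrary representative of its class, the
   initial condition is an equality almost everywhere. *)
Definition is_solution omega T (u0 : R -> R) u : Prop :=
  [/\ forall t, t \in `[0, T] -> sobolev 6 (u t) /\ continuous (u t),
      forall t, t \in `[0, T] ->
        sobolev_norm 6 (fun x => u t' x - u t x)
          @[t' --> within `[0, T] (nbhs t)] --> (0 : R),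
      forall t x, t \in `]0, T[ ->
        is_derive t (1 : R) (fun t' => u t' x)
          (derive1n 5 (u t) x - 2 * u t x * derive1 (u t) x
             + omega * derive1 (u t) x) &
      {ae mu, forall x, u 0 x = u0 x}].

(* S_L(t) = e^{At} with A = d_x^5 + omega d_x. The symbol of A at the frequency
   k is i (k^5 + omega k), so that, with th = k^5 + omega k,
     e^{At} f (x) = \sum_k \hat f(k) e^{i (k x + th t)}.
   The terms below are the real parts of these; the imaginary parts are odd in
   k. The sum is the limit of the sums over |k| <= n. *)
Definition SL_term omega t f x k : R :=
  let phase := k%:~R * x + (k%:~R ^+ 5 + omega * k%:~R) * t in
  fcos f k * cos phase + fsin f k * sin phase.

Definition SL omega t f x : R :=
  limn (fun n => \sum_(j < n.*2.+1) SL_term omega t f x (j%:Z - n%:Z)).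

(* The Duhamel integral S_D(t) u0, as a function of the solution u with
   u(., 0) = u0. The integrand is a continuous curve in H^5, whose values are
   continuous functions, and the integral is taken pointwise in x. *)
Definition SD omega u t x : R :=
  \int[mu]_(tau in `[0, t])
    SL omega (t - tau) (fun y => - 2 * u tau y * derive1 (u tau) y) x.

End Periodic_Sobolev.

(* Main.v *)
Require Import Defs.
From HB Require Import structures.
From mathcomp Require Import all_boot all_order all_algebra.
From mathcomp Require Import all_classical all_reals all_analysis.
From mathcomp Require Import measurable_realfun complex zify ring lra.

Set Implicit Arguments.
Unset Strict Implicit.
Unset Printing Implicit Defensive.

Import Order.TTheory GRing.Theory Num.Theory.
Import numFieldNormedType.Exports.

Local Open Scope classical_set_scope.
Local Open Scope ring_scope.

(* In the rotating frame v_k(t) = e^{-i (k^5 + om k) t} u_k(t), where u_k are the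
   Fourier coefficients of the solution and om = omega - 2 m absorbs the conserved
   mean m, the equation becomes
     v_k' = - i k \sum_{l <> 0, k} e^{- i phi(k, l) t} v_l v_{k-l} =: N_t(v, v)_k,
   with phi(k, l) = k^5 - l^5 - (k-l)^5
                  = (5/2) k l (k-l) (k^2 + l^2 + (k-l)^2).
   The large phase allows integration by parts in time: dividing by phi turns N into
   a bilinear operator B which gains three derivatives, and
     v(t) - v(0) = B_t(v, v) - B_0(v, v)
                   - \int_0^t (B_s(N, v) + B_s(v, N)) ds.
   For small v the right-hand side maps H^6-type bounds to H^8-type bounds with a
   small factor, hence v - v(0) is quadratic in v with values in H^8. Small solutions
   are limits of an iteration carrying v together with its defect v' - N(v, v), and
   two of them with the same data coincide. A solution in C([0, T]; H^6) with small
   data stays small, by continuity in time. Finally the Duhamel integral has the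
   coefficients e^{i theta_k t} (v_k(t) - v_k(0)). *)

(** * Symmetric sums over the integers *)

(** The nonlinearity loses one derivative, so Picard iteration on v' = N(v, v) does not close in
    weight 6. [Nop] maps weight 6 to weight 5 and [Bop] maps weights 5 and 6 to weight 8, so the
    normal form is contracting. But its fixed points are not visibly solutions: differentiating the
    fixed point equation only gives y = B(y, v) + B(v, y) for the defect y. Carrying the defect,
    which is halved in weight 5 at each step, settles this. Contraction, uniqueness and the
    continuity method use the sup-type bounds [bd], where limits are elementary; the square-summable
    bounds [hs] serve the Sobolev norms. Continuity with values in H^6 is recovered because v(t) -
    v(0) is bounded in weight 8: the coefficients at all times then have a common majorant in
    weighted l^2. In the other direction a solution satisfies the equation only pointwise; its
    coefficients are differentiated in time by a mean value estimate uniform in x. Realness of the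
    constructed solution follows from uniqueness. *)

(** The summation order in [SL], so that [SL] is an [ssum] by conversion; odd terms cancel at each
    stage. *)
Definition psum (V : zmodType) (f : int -> V) (n : nat) : V :=
  \sum_(j < n.*2.+1) f (j%:Z - n%:Z).

Section psum_theory.
Variable V : zmodType.
Implicit Types (f g : int -> V) (n : nat).

Lemma psumE f n : psum f n = \sum_(0 <= j < n.*2.+1) f (j%:Z - n%:Z).
Proof. by rewrite big_mkord. Qed.

Lemma psum0 f : psum f 0 = f 0.
Proof. by rewrite /psum big_ord1 subr0. Qed.

Lemma psumS f n : psum f n.+1 = f (- n.+1%:Z) + psum f n + f n.+1%:Z.
Proof.
rewrite /psum doubleS big_ord_recl sub0r -addrA; congr (_ + _).
rewrite big_ord_recr /=; congr (_ + _); last first.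
  by rewrite /bump /=; congr (f _); rewrite -muln2; lia.
by apply: eq_bigr => i _; congr (f _); rewrite /bump /=; lia.
Qed.

Lemma psum_eq0 n : psum (fun _ : int => 0 : V) n = 0.
Proof. by rewrite /psum big1. Qed.

Lemma psumD f g n : psum (fun k => f k + g k) n = psum f n + psum g n.
Proof. exact: big_split. Qed.

Lemma psumN f n : psum (fun k => - f k) n = - psum f n.
Proof. exact: sumrN. Qed.

Lemma psumB f g n : psum (fun k => f k - g k) n = psum f n - psum g n.
Proof. by rewrite psumD psumN. Qed.

Lemma eq_psum f g n : (forall k, f k = g k) -> psum f n = psum g n.
Proof. by move=> fg; apply: eq_bigr => i _. Qed.

End psum_theory.

Section real_sums.
Variable R : realType.
Implicit Types (f g d : int -> R) (n : nat) (M : R).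

Lemma psumZ c f n : psum (fun k => c * f k) n = c * psum f n.
Proof. by rewrite /psum mulr_sumr. Qed.

Lemma le_psum f g n : (forall k, f k <= g k) -> psum f n <= psum g n.
Proof. by move=> fg; apply: ler_sum => i _. Qed.

Lemma psum_ge0 f n : (forall k, 0 <= f k) -> 0 <= psum f n.
Proof. by move=> f0; apply: sumr_ge0 => i _. Qed.

Lemma norm_psum f n : `|psum f n| <= psum (fun k => `|f k|) n.
Proof. exact: ler_norm_sum. Qed.

Lemma psum_nd f : (forall k, 0 <= f k) -> nondecreasing_seq (psum f).
Proof.
move=> f0; apply/nondecreasing_seqP => n; rewrite psumS.
by have := f0 (- n.+1%:Z); have := f0 n.+1%:Z; lra.
Qed.

Lemma psum_shift_le f n (c : int) : (forall k, 0 <= f k) ->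
  psum (fun k => f (k - c)) n <= psum f (n + `|c|%N).
Proof.
move=> f0; rewrite !psumE; pose N := (n + `|c|)%N.
(* Offset of the shifted window inside the window of radius n + |c|; the two pieces left over are
   nonnegative. *)
pose lo := absz (`|c|%:Z - c).
have loE : lo%:Z = `|c|%:Z - c by rewrite /lo; lia.
have -> : \sum_(0 <= j < n.*2.+1) f (j%:Z - n%:Z - c) =
    \sum_(lo <= j < lo + n.*2.+1) f (j%:Z - N%:Z).
  rewrite -{1}[lo]add0n big_addn addKn; apply: eq_bigr => i _.
  by congr (f _); rewrite PoszD loE /N; lia.
rewrite [leRHS](@big_cat_nat _ _ _ lo) //=; last by rewrite -muln2; lia.
rewrite [X in _ + X](@big_cat_nat _ _ _ (lo + n.*2.+1)%N) //=; last 2 first.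
- exact: leq_addr.
- by rewrite -!muln2; lia.
have h a b : 0 <= \sum_(a <= j < b) f (j%:Z - N%:Z) by apply: sumr_ge0.
by rewrite addrCA lerDl addr_ge0.
Qed.

Definition ssum f : R := limn (psum f).

(** Absolute summability with an explicit bound; without it the limit in [ssum] may be a default
    value. *)
Definition asum f M : Prop := forall n, psum (fun k => `|f k|) n <= M.

Lemma asum_ge0 f M : asum f M -> 0 <= M.
Proof. by move=> /(_ 0%N); apply: le_trans; exact: psum_ge0. Qed.

Lemma asum_nneg f M : (forall k, 0 <= f k) -> (forall n, psum f n <= M) ->
  asum f M.
Proof.
by move=> f0 fM n; rewrite (@eq_psum _ _ f)// => k; rewrite ger0_norm.
Qed.

Lemma asum_domn f g M : (forall k, `|f k| <= `|g k|) -> asum g M -> asum f M.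
Proof. by move=> fg gM n; apply: le_trans (gM n); exact: le_psum. Qed.

Lemma asum_dom f d M : (forall k, `|f k| <= d k) -> asum d M -> asum f M.
Proof.
by move=> fd; apply: asum_domn => k; exact: le_trans (ler_norm _).
Qed.

Lemma asum_eq f g M : (forall k, f k = g k) -> asum f M -> asum g M.
Proof. by move=> fg; have -> : f = g by apply: funext. Qed.

Lemma asumD f g M N : asum f M -> asum g N -> asum (fun k => f k + g k) (M + N).
Proof.
move=> fM gN n; apply: le_trans (lerD (fM n) (gN n)).
by rewrite -psumD; apply: le_psum => k; exact: ler_normD.
Qed.

Lemma asumZ c f M : asum f M -> asum (fun k => c * f k) (`|c| * M).
Proof.
move=> fM n; rewrite (@eq_psum _ _ (fun k => `|c| * `|f k|)).
  by rewrite psumZ ler_wpM2l.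
by move=> k; rewrite normrM.
Qed.

Lemma asumN f M : asum f M -> asum (fun k => - f k) M.
Proof. by apply: asum_domn => k; rewrite normrN. Qed.

Lemma asum_shift f M c : asum f M -> asum (fun k => f (k - c)) M.
Proof.
move=> fM n; apply: le_trans (fM (n + `|c|)%N).
exact: (@psum_shift_le (fun k => `|f k|)).
Qed.

Lemma asum_opp f M : asum f M -> asum (fun k => f (- k)) M.
Proof.
move=> fM n; apply: le_trans (fM n); rewrite le_eqVlt; apply/orP; left.
apply/eqP; elim: n => [|n IH]; first by rewrite !psum0 oppr0.
by rewrite !psumS IH opprK; ring.
Qed.

Lemma asum_refl f M c : asum f M -> asum (fun k => f (c - k)) M.
Proof.
move=> /asum_opp /(@asum_shift _ _ c); apply: asum_eq => k.
by rewrite opprB.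
Qed.

Lemma asum_term f M k : asum f M -> `|f k| <= M.
Proof.
move=> /(@asum_shift _ _ (- k))/(_ 0%N); rewrite psum0.
by rewrite opprK add0r.
Qed.

(** f is the difference of the nonnegative [|f| + f] and [|f|], whose partial sums are monotone and
    bounded. *)
Lemma ssum_cvg f M : asum f M -> psum f @ \oo --> ssum f.
Proof.
move=> fM.
have pos (g : int -> R) N : (forall k, 0 <= g k) -> (forall n, psum g n <= N) ->
    cvgn (psum g).
  move=> g0 gN; apply: nondecreasing_is_cvgn; first exact: psum_nd.
  by exists N => _ [n _ <-].
have c1 : cvgn (psum (fun k => `|f k|)) by exact: pos fM.
have c2 : cvgn (psum (fun k => `|f k| + f k)).
  apply: (pos _ (M + M)) => [k|n]; first by rewrite addrC -lerBlDr sub0r lerNl ler_normr lexx orbT.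
  rewrite psumD lerD// (le_trans _ (fM n))// (le_trans _ (norm_psum _ _))//.
  exact: ler_norm.
suff : cvgn (psum f) by [].
have -> : psum f =
    (fun n => psum (fun k => `|f k| + f k) n - psum (fun k => `|f k|) n).
  by apply: funext => n; rewrite -psumB; apply: eq_psum => k; lra.
exact: is_cvgB.
Qed.

Lemma le_ssum f g M N : asum f M -> asum g N -> (forall k, f k <= g k) ->
  ssum f <= ssum g.
Proof.
move=> fM gN fg; apply: ler_lim; [exact: ssum_cvg fM|exact: ssum_cvg gN|].
by apply: nearW => n; exact: le_psum.
Qed.

Lemma eq_ssum f g : (forall k, f k = g k) -> ssum f = ssum g.
Proof. by move=> fg; have -> : f = g by apply: funext. Qed.

Lemma norm_ssum_le f M : asum f M -> `|ssum f| <= M.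
Proof.
move=> fM; have cn := cvg_norm (ssum_cvg fM).
rewrite -(cvg_lim _ (cn _))//; apply: limr_le; first by apply/cvg_ex; eexists; exact: cn.
by apply: nearW => n; exact: le_trans (norm_psum _ _) (fM n).
Qed.

Lemma ssum_cvg_eq f l : psum f @ \oo --> l -> ssum f = l.
Proof. by move=> /cvg_lim; apply. Qed.

Lemma ssumD f g M N : asum f M -> asum g N ->
  ssum (fun k => f k + g k) = ssum f + ssum g.
Proof.
move=> fM gN; apply: ssum_cvg_eq.
have -> : psum (fun k => f k + g k) = (fun n => psum f n + psum g n).
  by apply: funext => n; rewrite psumD.
by apply: cvgD; [exact: ssum_cvg fM|exact: ssum_cvg gN].
Qed.

Lemma ssumZ c f M : asum f M -> ssum (fun k => c * f k) = c * ssum f.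
Proof.
move=> fM; apply: ssum_cvg_eq.
have -> : psum (fun k => c * f k) = (fun n => c * psum f n).
  by apply: funext => n; rewrite psumZ.
by apply: cvgM; [exact: cvg_cst|exact: ssum_cvg fM].
Qed.

Lemma ssumN f M : asum f M -> ssum (fun k => - f k) = - ssum f.
Proof.
by move=> fM; rewrite -mulN1r -(ssumZ _ fM); apply: eq_ssum => k; rewrite mulN1r.
Qed.

Lemma ssumB f g M N : asum f M -> asum g N ->
  ssum (fun k => f k - g k) = ssum f - ssum g.
Proof. by move=> fM gN; rewrite (ssumD fM (asumN gN)) (ssumN gN). Qed.

Lemma ssum_eq0 : ssum (fun=> 0) = 0.
Proof.
apply: ssum_cvg_eq; rewrite (_ : psum _ = cst 0); first exact: cvg_cst.
by apply: funext => n; rewrite psum_eq0.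
Qed.

Lemma ssum_ge0 f M : asum f M -> (forall k, 0 <= f k) -> 0 <= ssum f.
Proof.
move=> fM f0; rewrite -ssum_eq0; apply: le_ssum fM f0.
by apply: (@asum_nneg _ 0) => // n; rewrite psum_eq0.
Qed.

Lemma psum_le_ssum f M n : asum f M -> (forall k, 0 <= f k) ->
  psum f n <= ssum f.
Proof.
move=> fM f0; apply: nondecreasing_cvgn_le; first exact: psum_nd.
exact: ssum_cvg fM.
Qed.

(** The part of f between two radii is bounded by that of d, and the larger radius goes to infinity.
    The bound is uniform over all f dominated by d. *)
Lemma ssum_tail f d M n : asum d M -> (forall k, `|f k| <= d k) ->
  `|ssum f - psum f n| <= ssum d - psum d n.
Proof.
move=> dM fd; have fM := asum_dom fd dM.
have h m : (n <= m)%N -> `|psum f m - psum f n| <= psum d m - psum d n.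
  elim: m => [|m IH]; first by rewrite leqn0 => /eqP ->; rewrite !subrr normr0.
  rewrite leq_eqVlt => /predU1P[->|]; first by rewrite !subrr normr0.
  rewrite ltnS => /IH nm; rewrite !psumS.
  have := fd (- m.+1%:Z); have := fd m.+1%:Z.
  move: nm; rewrite !ler_norml => /andP[? ?] /andP[? ?] /andP[? ?].
  by apply/andP; split; lra.
have cf : (fun m => `|psum f m - psum f n|) @ \oo --> `|ssum f - psum f n|.
  by apply: cvg_norm; apply: cvgB; [exact: ssum_cvg fM|exact: cvg_cst].
have cd : (fun m => psum d m - psum d n) @ \oo --> ssum d - psum d n.
  by apply: cvgB; [exact: ssum_cvg dM|exact: cvg_cst].
rewrite -(cvg_lim _ cf)// -(cvg_lim _ cd)//; apply: ler_lim.
- by apply/cvg_ex; eexists; exact: cf.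
- by apply/cvg_ex; eexists; exact: cd.
by near=> m; apply: h; near: m; exact: nbhs_infty_ge.
Unshelve. all: by end_near. Qed.

Lemma tail_cvg0 d M : asum d M -> (fun n => ssum d - psum d n) @ \oo --> 0.
Proof.
move=> dM; rewrite -[X in _ --> X](subrr (ssum d)).
by apply: cvgB; [exact: cvg_cst|exact: ssum_cvg dM].
Qed.

(** Fubini with one finite sum; the bounds in [asum] concern partial sums, so this is the exchange
    behind [young]. *)
Lemma ssum_psum (F : int -> int -> R) (M : int -> R) n :
  (forall k, asum (F k) (M k)) ->
  asum (fun l => psum (F ^~ l) n) (psum M n) /\
  ssum (fun l => psum (F ^~ l) n) = psum (fun k => ssum (F k)) n.
Proof.
move=> FM; elim: n => [|n [IHa IHs]].
  split; first by move=> m; under eq_psum do rewrite psum0; rewrite psum0; exact: FM.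
  by rewrite psum0; apply: eq_ssum => l; rewrite psum0.
have h l : psum (F ^~ l) n.+1 =
    F (- n.+1%:Z) l + psum (F ^~ l) n + F n.+1%:Z l by rewrite psumS.
split.
  rewrite psumS; apply: (@asum_eq (fun l =>
    F (- n.+1%:Z) l + psum (F ^~ l) n + F n.+1%:Z l)) => [l|]; first by rewrite h.
  by apply: asumD; [apply: asumD|].
rewrite (eq_ssum h) psumS (ssumD (asumD (FM _) IHa) (FM _)).
by rewrite (ssumD (FM _) IHa) IHs.
Qed.

Lemma psum_delta (c : int) (a : R) n : (`|c| <= n)%N ->
  psum (fun k => if k == c then a else 0) n = a.
Proof.
move=> cn; rewrite /psum.
have lt : (absz (c + n%:Z)%R < n.*2.+1)%N by rewrite -muln2; lia.
rewrite (bigD1 (Ordinal lt))//= ifT; last by apply/eqP; lia.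
rewrite big1 ?addr0// => i /eqP ni; rewrite ifF//; apply/negbTE/eqP => e.
by apply: ni; apply/val_inj => /=; lia.
Qed.

Lemma asum_delta c a : asum (fun k => if k == c then a else 0) `|a|.
Proof.
move=> n; rewrite -(@psum_delta c `|a| (n + `|c|)%N) ?leq_addl//.
apply: le_trans (psum_nd _ (leq_addr `|c| n)) => [|k]; last by case: ifP.
by apply: le_psum => k; case: ifP => //; rewrite normr0.
Qed.

Lemma ssum_delta c a : ssum (fun k => if k == c then a else 0) = a.
Proof.
apply: ssum_cvg_eq; apply: cvg_near_cst; near=> n; apply/psum_delta.
by near: n; exact: nbhs_infty_ge.
Unshelve. all: by end_near. Qed.

(** Equivalent to the Sobolev weight (1 + k^2)^(1/2), but free of roots and subadditive. *)
Definition J (k : int) : R := (1 + `|k|%N)%:R.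

Lemma J_ge1 k : 1 <= J k.
Proof. by rewrite /J ler1n. Qed.

Lemma J_gt0 k : 0 < J k.
Proof. exact: lt_le_trans (J_ge1 k). Qed.

Lemma J_neq0 k : J k != 0.
Proof. by rewrite gt_eqF ?J_gt0. Qed.

Lemma JN k : J (- k) = J k.
Proof. by rewrite /J abszN. Qed.

Lemma J_tri k l : J k <= J l + J (k - l).
Proof. by rewrite /J -natrD ler_nat; lia. Qed.

Lemma JE k : J k = 1 + `|k%:~R|.
Proof. by rewrite /J natrD -intr_norm -abszE. Qed.

(* G is increasing, bounded, and its increments dominate 1/J^2. *)
Lemma asum_J2 : asum (fun k => (J k ^+ 2)^-1) 4.
Proof.
pose G (k : int) : R := match k with
  | Posz m => 4 - 2 / m.+1%:R | Negz m => 2 / m.+2%:R end.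
have G_step k : (J k ^+ 2)^-1 <= G (k + 1) - G k.
  case: k => m.
    have -> : Posz m + 1 = Posz m.+1 by lia.
    rewrite /J /G /= add1n.
    have m0 : 0 < m.+1%:R :> R by rewrite ltr0n.
    rewrite -[m.+2]addn1 natrD; set x := m.+1%:R in m0 *.
    have x1 : 1 <= x by rewrite /x ler1n.
    have -> : 4 - 2 / (x + 1) - (4 - 2 / x) = 2 / (x * (x + 1)).
      by field; rewrite !gt_eqF//; lra.
    rewrite -div1r ler_pdivrMr ?exprn_gt0// mulrAC ler_pdivlMr; last by nra.
    by nra.
  have [p q] : J (Negz m) = m.+2%:R /\ G (Negz m + 1) - G (Negz m) = 2 / m.+1%:R - 2 / m.+2%:R.
    split; first by rewrite /J NegzE abszN.
    case: m => [|m] /=.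
      by rewrite subnn divr1; lra.
    by rewrite subn1.
  rewrite p q -[m.+2]addn1 natrD; set x := m.+1%:R.
  have x1 : 1 <= x by rewrite /x ler1n.
  have -> : 2 / x - 2 / (x + 1) = 2 / (x * (x + 1)).
    by field; rewrite !gt_eqF//; lra.
  rewrite -div1r ler_pdivrMr ?exprn_gt0//; last by lra.
  by rewrite mulrAC ler_pdivlMr; nra.
have Gb k : 0 <= G k <= 4.
  case: k => m /=.
    have : 2 / m.+1%:R <= 2 :> R by rewrite ler_pdivrMr ?ltr0n// ler_peMr// ler1n.
    have : 0 <= 2 / m.+1%:R :> R by [].
    by set z := 2 / _ => ? ?; apply/andP; split; lra.
  have : 2 / m.+2%:R <= 2 :> R by rewrite ler_pdivrMr ?ltr0n// ler_peMr// ler1n.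
  by set z := 2 / _ => ?; apply/andP; split; [exact: divr_ge0|lra].
apply: asum_nneg => [k|n]; first by rewrite invr_ge0 exprn_ge0// ltW ?J_gt0.
have h N : \sum_(0 <= j < N) (J (j%:Z - n%:Z) ^+ 2)^-1 <= G (N%:Z - n%:Z) - G (- n%:Z).
  elim: N => [|N IH]; first by rewrite big_geq// sub0r subrr.
  rewrite big_nat_recr//=; have := G_step (N%:Z - n%:Z).
  have -> : N%:Z - n%:Z + 1 = N.+1%:Z - n%:Z by lia.
  by move=> ?; lra.
rewrite psumE; apply: le_trans (h _) _.
have /andP[? ?] := Gb (n.*2.+1%:Z - n%:Z); have /andP[? ?] := Gb (- n%:Z).
by lra.
Qed.

(* The sum of c k * (a k * K - x)^2, with x the sum of a c, is nonnegative. *)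
Lemma ssum_CS (a c : int -> R) K Q : 0 < K -> (forall k, 0 <= c k) ->
  asum c K -> asum (fun k => a k ^+ 2 * c k) Q ->
  asum (fun k => a k * c k) (K + Q) /\ ssum (fun k => a k * c k) ^+ 2 <= K * ssum (fun k => a k ^+ 2 * c k).
Proof.
move=> K0 c0 cK aQ.
have acS : asum (fun k => a k * c k) (K + Q).
  apply: asum_dom (asumD cK aQ) => k; rewrite normrM (ger0_norm (c0 k)).
  rewrite -{2}[c k]mul1r -mulrDl ler_wpM2r// -(real_normK (num_real (a k))).
  by set x := `|a k|; nra.
split => //; set x := ssum (fun k => a k * c k).
have : 0 <= ssum (fun k => K ^+ 2 * (a k ^+ 2 * c k) - (2 * K * x) * (a k * c k) + x ^+ 2 * c k).
  apply: (@ssum_ge0 _ (`|K ^+ 2| * Q + `|2 * K * x| * (K + Q) + `|x ^+ 2| * K)).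
    by do 2?apply: asumD; [exact: asumZ|apply: asumN; exact: asumZ|exact: asumZ].
  move=> k; have -> : K ^+ 2 * (a k ^+ 2 * c k) - (2 * K * x) * (a k * c k) + x ^+ 2 * c k = (K * a k - x) ^+ 2 * c k by ring.
  by rewrite mulr_ge0// sqr_ge0.
rewrite (ssumD (asumD (asumZ _ aQ) (asumN (asumZ _ acS))) (asumZ _ cK)).
rewrite (ssumB (asumZ _ aQ) (asumZ _ acS)) (ssumZ _ aQ) (ssumZ _ acS) (ssumZ _ cK) -/x.
have P : ssum c <= K by rewrite (le_trans (ler_norm _))// norm_ssum_le.
set q := ssum (fun k => a k ^+ 2 * c k) => h.
have : 0 <= K * (K * q - x ^+ 2) by have := sqr_ge0 x; nra.
by rewrite pmulr_rge0// subr_ge0.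
Qed.

(** Young's inequality for l^2 and l^1: Cauchy-Schwarz against the weight c bounds the squared
    convolution by K times the convolution of a^2 with c, and summing over k first costs another
    K. *)
Lemma young (a c : int -> R) A K : 0 < K -> (forall k, 0 <= c k) -> asum c K ->
  asum (fun k => a k ^+ 2) A ->
  asum (fun k => ssum (fun l => a l * c (k - l)) ^+ 2) (K ^+ 2 * A) /\
  asum (fun k => ssum (fun l => a (k - l) * c l) ^+ 2) (K ^+ 2 * A).
Proof.
move=> K0 c0 cK aA.
have cM k : c k <= K by rewrite (le_trans (ler_norm _))// asum_term.
have dom (b e : int -> R) : (forall k, 0 <= b k) -> (forall k, 0 <= e k <= K) ->
    asum b A -> asum (fun k => b k * e k) (K * A).
  move=> b0 eK bA; rewrite -(ger0_norm (ltW K0)); apply: asum_dom (asumZ K bA) => k.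
  have /andP[e0 eK'] := eK k.
  by rewrite ger0_norm ?mulr_ge0// mulrC ler_wpM2r.
split; apply: asum_nneg => [k|n]; rewrite ?sqr_ge0//.
- have A1 k : asum (fun l => a l ^+ 2 * c (k - l)) (K * A).
    by apply: dom => // l; rewrite ?sqr_ge0// c0 cM.
  apply: (@le_trans _ _ (psum (fun k => K * ssum (fun l => a l ^+ 2 * c (k - l))) n)).
    by apply: le_psum => k; apply: (proj2 (ssum_CS K0 _ _ (A1 k))) => //; exact: asum_refl.
  rewrite psumZ -(proj2 (@ssum_psum (fun k l => a l ^+ 2 * c (k - l)) (fun=> K * A) n A1)).
  rewrite expr2 -mulrA ler_pM2l//.
  apply: le_trans (ler_norm _) _; apply: norm_ssum_le.
  apply: (@asum_eq (fun l => a l ^+ 2 * psum (fun k => c (k - l)) n)).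
    by move=> l; rewrite -psumZ.
  apply: dom => // l; rewrite ?sqr_ge0//; rewrite psum_ge0//=.
  by apply: le_trans (asum_shift l cK n); apply: le_psum => k; exact: ler_norm.
- have A1 k : asum (fun l => a (k - l) ^+ 2 * c l) (K * A).
    apply: dom => // l; rewrite ?sqr_ge0// ?c0 ?cM//.
    exact: (asum_refl _ aA).
  apply: (@le_trans _ _ (psum (fun k => K * ssum (fun l => a (k - l) ^+ 2 * c l)) n)).
    by apply: le_psum => k; apply: (proj2 (@ssum_CS (fun l => a (k - l)) _ _ _ K0 _ _ (A1 k))).
  rewrite psumZ -(proj2 (@ssum_psum (fun k l => a (k - l) ^+ 2 * c l) (fun=> K * A) n A1)).
  rewrite expr2 -mulrA ler_pM2l//.
  apply: le_trans (ler_norm _) _; apply: norm_ssum_le.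
  rewrite mulrC -(ger0_norm (asum_ge0 aA)).
  apply: asum_dom (asumZ A cK) => l.
  rewrite (@eq_psum _ _ (fun k => c l * a (k - l) ^+ 2)); last by move=> k; rewrite mulrC.
  rewrite psumZ mulrC ger0_norm ?mulr_ge0 ?psum_ge0 //; last by move=> k; rewrite sqr_ge0.
  rewrite ler_wpM2r//; apply: le_trans (asum_shift l aA n).
  by apply: le_psum => k; exact: ler_norm.
Qed.

End real_sums.

(** * C^1 curves on a segment *)

Section C1_curves.
Variable R : realType.
Implicit Types (a b c t e : R) (f g : R -> R).

Local Notation mu := (@lebesgue_measure R).

Definition con a b f : Prop := {within `[a, b], continuous f}.

Lemma conP a b f : con a b f <-> forall t, t \in `[a, b] ->
  f s @[s --> within `[a, b] (nbhs t)] --> f t.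
Proof. by split => [/subspace_continuousP|h]; [|apply/subspace_continuousP]. Qed.

Lemma con_unif a b f :
  (forall e, 0 < e -> exists2 g, con a b g & forall t, t \in `[a, b] -> `|f t - g t| <= e) ->
  con a b f.
Proof.
move=> fg; apply/conP => t tab; apply/cvgrPdist_le => e e0.
have e3 : 0 < e / 3 by rewrite divr_gt0.
have [g /conP gc gf] := fg _ e3.
have /cvgrPdist_le /(_ _ e3) := gc t tab.
apply: filter_app; near=> s => gts.
have sab : s \in `[a, b] by near: s; exact: withinT.
have := gf _ tab; have := gf _ sab; move: gts.
rewrite !ler_norml => /andP[? ?] /andP[? ?] /andP[? ?].
by apply/andP; split; lra.
Unshelve. all: by end_near. Qed.

Lemma con_sub a b c d f : con a b f -> `[c, d] `<=` `[a, b] -> con c d f.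
Proof. by move=> cf h; exact: continuous_subspaceW cf. Qed.

Lemma con_cont a b f : continuous f -> con a b f.
Proof. exact: continuous_subspaceT. Qed.

Lemma con_eq a b f g : con a b f -> (forall t, t \in `[a, b] -> f t = g t) -> con a b g.
Proof.
move=> cf fg; apply: con_unif => e e0; exists f => // t tab.
by rewrite fg// subrr normr0 ltW.
Qed.

Lemma con_cst a b c : con a b (fun=> c).
Proof. by apply: con_cont => x; exact: cvg_cst. Qed.

Lemma conD a b f g : con a b f -> con a b g -> con a b (fun t => f t + g t).
Proof. by move=> cf cg x; apply: cvgD; [exact: cf|exact: cg]. Qed.

Lemma conN a b f : con a b f -> con a b (fun t => - f t).
Proof. by move=> cf x; apply: cvgN; exact: cf. Qed.

Lemma conB a b f g : con a b f -> con a b g -> con a b (fun t => f t - g t).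
Proof. by move=> cf cg; apply: conD => //; exact: conN. Qed.

Lemma conM a b f g : con a b f -> con a b g -> con a b (fun t => f t * g t).
Proof. by move=> cf cg x; apply: cvgM; [exact: cf|exact: cg]. Qed.

Lemma con_norm a b f : con a b f -> con a b (fun t => `|f t|).
Proof. by move=> cf x; apply: cvg_norm; exact: cf. Qed.

Lemma con_integrable a b f : con a b f -> mu.-integrable `[a, b] (EFin \o f).
Proof.
by move=> cf; apply: continuous_compact_integrable => //; exact: segment_compact.
Qed.

Lemma le_abs_int a b f (M : R) : a <= b -> con a b f ->
  (forall t, t \in `[a, b] -> `|f t| <= M) ->
  `|\int[mu]_(t in `[a, b]) f t| <= M * (b - a).
Proof.
move=> ab cf fM; apply: le_trans (le_normr_Rintegral _ (con_integrable cf)) _ => //.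
have -> : M * (b - a) = \int[mu]_(t in `[a, b]) M.
  rewrite Rintegral_cst//= lebesgue_measure_itv/= lte_fin; move: ab.
  by rewrite le_eqVlt => /predU1P[->|->]; rewrite ?ltxx ?subrr// -EFinB.
apply: le_Rintegral => //; first exact: (con_integrable (con_norm cf)).
by have := @con_integrable a b (cst M); apply; exact: con_cst.
Qed.

(** Differentiability is asked only inside, as in [is_solution]; continuity up to the endpoints
    still makes f a primitive of g on the whole segment ([C1_ftc]). *)
Definition C1 a b f g : Prop :=
  [/\ con a b f, con a b g & forall t, t \in `]a, b[ -> is_derive t (1 : R) f (g t)].

Lemma C1_sub a b c d f g : C1 a b f g -> a <= c -> d <= b -> C1 c d f g.
Proof.
move=> [cf cg df] ac db; split.
- by apply: (con_sub cf) => x /=; rewrite !in_itv/= => /andP[? ?]; apply/andP; split; lra.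
- by apply: (con_sub cg) => x /=; rewrite !in_itv/= => /andP[? ?]; apply/andP; split; lra.
- move=> t; rewrite in_itv/= => /andP[? ?]; apply: df; rewrite in_itv/=.
  by apply/andP; split; lra.
Qed.

Lemma C1_ftc a b f g t : C1 a b f g -> t \in `[a, b] ->
  \int[mu]_(s in `[a, t]) g s = f t - f a.
Proof.
move=> C; rewrite in_itv/= => /andP[]; rewrite le_eqVlt => /predU1P[<- _|at_ tb].
  by rewrite set_itv1 Rintegral_set1 subrr.
have [cf cg df] := C1_sub C (lexx a) tb.
rewrite /Rintegral (@continuous_FTC2 _ g f)//.
  have /(continuous_within_itvP _ at_)[_ ? ?] := cf.
  by split=> // x xat; have := df _ xat.
by move=> x xat; rewrite derive1E; apply: derive_val; exact: df.
Qed.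

Lemma C1_int a b c g : a < b -> con a b g ->
  C1 a b (fun t => c + \int[mu]_(s in `[a, t]) g s) g.
Proof.
move=> ab cg; have ig := con_integrable cg; split => //.
  apply: conD; first exact: con_cst.
  exact: (parameterized_integral_continuous (ltW ab) ig).
move=> t tab; move: (tab); rewrite in_itv/= => /andP[at_ tb].
have gt : {for t, continuous g} by exact: (within_continuous_continuous ab cg).
have [d1 d2] := continuous_FTC1_closed tb ig at_ gt.
rewrite -[g t]add0r -d2 derive1E.
by apply: is_deriveD; exact: DeriveDef.
Qed.

Lemma eq_C1 a b f g f' g' : C1 a b f g -> (forall t, t \in `[a, b] -> f t = f' t) ->
  (forall t, t \in `[a, b] -> g t = g' t) -> C1 a b f' g'.
Proof.
move=> [cf cg df] ff gg; split; [exact: con_eq ff|exact: con_eq gg|].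
move=> t tab; rewrite -gg; last exact: subset_itv_oo_cc.
apply: (near_eq_is_derive _ (df _ tab)) => //.
near=> s; apply: ff; apply: subset_itv_oo_cc; near: s.
exact: near_in_itvoo.
Unshelve. all: by end_near. Qed.

Lemma C1_integral a b f g : a < b -> con a b g ->
  (forall t, t \in `[a, b] -> f t - f a = \int[mu]_(s in `[a, t]) g s) -> C1 a b f g.
Proof.
move=> ab cg fg; apply: (eq_C1 (C1_int (f a) ab cg)) => // t tab.
by rewrite -fg// addrC subrK.
Qed.

(** What passes to the uniform limit is the integral identity between f and g; the derivative is
    then read off from it. *)
Lemma C1_unif a b f g : a < b ->
  (forall e, 0 < e -> exists f' g', C1 a b f' g' /\ forall t, t \in `[a, b] ->
    `|f t - f' t| <= e /\ `|g t - g' t| <= e) ->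
  C1 a b f g.
Proof.
move=> ab h; have cg : con a b g.
  apply: con_unif => e e0; have [f' [g' [[_ ? _] fg]]] := h _ e0.
  by exists g' => // t /fg[].
apply: C1_integral => // t tab; apply/eqP; rewrite -subr_eq0 -normr_le0.
apply/ler_addgt0Pl => e e0; rewrite addr0.
(* Two values of f and one integral over a part of [a, b] cost at most (2 + (b - a)) e' = e. *)
pose e' := e / (2 + (b - a)).
have ba : 0 < 2 + (b - a) by lra.
have e'0 : 0 < e' by rewrite divr_gt0.
have [f' [g' [C fg]]] := h _ e'0.
have aab : a \in `[a, b] by rewrite in_itv/= lexx ltW.
have [fa _] := fg _ aab; have [ft _] := fg _ tab.
move: (tab); rewrite in_itv/= => /andP[at_ tb].
have sub : `[a, t] `<=` `[a, b] by exact: subset_itvl.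
have := C1_ftc C tab; have [_ cg' _] := C.
have {}cg := con_sub cg sub; have {}cg' := con_sub cg' sub.
have : `|\int[mu]_(s in `[a, t]) (g s - g' s)| <= e' * (t - a).
  apply: le_abs_int => //; first exact: conB.
  by move=> s sat; have [] := fg s (sub _ sat).
rewrite RintegralB//; [|exact: con_integrable..].
move=> /[swap] ->; set I := (X in `|X - _|) => h1; rewrite -/I.
have h3 : e' * (t - a) <= e' * (b - a) by apply: ler_wpM2l; [exact: ltW|lra].
have : e = 2 * e' + e' * (b - a) by rewrite /e'; field; rewrite gt_eqF.
move: h1 fa ft; rewrite !ler_norml => /andP[? ?] /andP[? ?] /andP[? ?] ?.
by apply/andP; split; lra.
Qed.

Lemma C1_cst a b c : C1 a b (fun=> c) (fun=> 0).
Proof. by split; [exact: con_cst..|move=> t _; exact: is_derive_cst]. Qed.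

Lemma C1D a b f g f' g' : C1 a b f g -> C1 a b f' g' ->
  C1 a b (fun t => f t + f' t) (fun t => g t + g' t).
Proof.
by move=> [cf cg df] [cf' cg' df']; split; [exact: conD..|];
  move=> t tab; apply: is_deriveD; [exact: df|exact: df'].
Qed.

Lemma C1N a b f g : C1 a b f g -> C1 a b (fun t => - f t) (fun t => - g t).
Proof.
by move=> [cf cg df]; split; [exact: conN..|]; move=> t tab; apply: is_deriveN; exact: df.
Qed.

Lemma C1B a b f g f' g' : C1 a b f g -> C1 a b f' g' ->
  C1 a b (fun t => f t - f' t) (fun t => g t - g' t).
Proof. by move=> C C'; apply: C1D => //; exact: C1N. Qed.

Lemma C1M a b f g f' g' : C1 a b f g -> C1 a b f' g' ->
  C1 a b (fun t => f t * f' t) (fun t => g t * f' t + f t * g' t).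
Proof.
move=> [cf cg df] [cf' cg' df']; split; [exact: conM|apply: conD; exact: conM|].
move=> t tab; have -> : g t * f' t + f t * g' t = f t *: g' t + f' t *: g t.
  by rewrite addrC /GRing.scale/= [f' t * _]mulrC.
by apply: is_deriveM; [exact: df|exact: df'].
Qed.

Lemma C1Z a b c f g : C1 a b f g -> C1 a b (fun t => c * f t) (fun t => c * g t).
Proof.
by move=> C; apply: (eq_C1 (C1M (C1_cst a b c) C)) => // t _; rewrite mul0r add0r.
Qed.

Lemma C1_everywhere a b f g : (forall t, is_derive t (1 : R) f (g t)) ->
  continuous g -> C1 a b f g.
Proof.
move=> df cg; split; [|exact: con_cont|by move=> t _].
apply: con_cont => t; apply: differentiable_continuous.
by apply/derivable1_diffP; have := df t.
Qed.

Lemma cos_lin_derive (m c t : R) : is_derive t (1 : R) (fun s => cos (m * s + c)) (- m * sin (m * t + c)).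
Proof. by apply: is_derive_eq; rewrite /GRing.scale/=; ring. Qed.

Lemma sin_lin_derive (m c t : R) : is_derive t (1 : R) (fun s => sin (m * s + c)) (m * cos (m * t + c)).
Proof. by apply: is_derive_eq; rewrite /GRing.scale/=; ring. Qed.

Lemma lin_cont (m c : R) : continuous (fun s : R => m * s + c).
Proof.
by move=> t; apply: cvgD; [apply: cvgM; [exact: cvg_cst|exact: cvg_id]|exact: cvg_cst].
Qed.

Lemma cos_lin_cont (m c : R) : continuous (fun s : R => cos (m * s + c)).
Proof.
move=> t; apply: (@continuous_comp _ _ _ (fun s : R => m * s + c) cos); first exact: lin_cont.
exact: continuous_cos.
Qed.

Lemma sin_lin_cont (m c : R) : continuous (fun s : R => sin (m * s + c)).
Proof.
move=> t; apply: (@continuous_comp _ _ _ (fun s : R => m * s + c) sin); first exact: lin_cont.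
exact: continuous_sin.
Qed.

Lemma C1_cos a b (m c : R) : C1 a b (fun s => cos (m * s + c)) (fun t => - m * sin (m * t + c)).
Proof.
apply: C1_everywhere; first exact: cos_lin_derive.
by move=> t; apply: cvgM; [exact: cvg_cst|exact: sin_lin_cont].
Qed.

Lemma C1_sin a b (m c : R) : C1 a b (fun s => sin (m * s + c)) (fun t => m * cos (m * t + c)).
Proof.
apply: C1_everywhere; first exact: sin_lin_derive.
by move=> t; apply: cvgM; [exact: cvg_cst|exact: cos_lin_cont].
Qed.

Lemma C1_psum a b (f g : int -> R -> R) n : (forall k, C1 a b (f k) (g k)) ->
  C1 a b (fun t => psum (f ^~ t) n) (fun t => psum (g ^~ t) n).
Proof.
move=> C; elim: n => [|n IH].
  by apply: (eq_C1 (C 0)) => t _; rewrite psum0.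
apply: (eq_C1 (C1D (C1D (C (- n.+1%:Z)) IH) (C n.+1%:Z))) => t _; by rewrite psumS.
Qed.

Lemma con_psum a b (f : int -> R -> R) n : (forall k, con a b (f k)) ->
  con a b (fun t => psum (f ^~ t) n).
Proof.
move=> C; elim: n => [|n IH].
  by apply: (con_eq (C 0)) => t _; rewrite psum0.
apply: (con_eq (conD (conD (C (- n.+1%:Z)) IH) (C n.+1%:Z))) => t _; by rewrite psumS.
Qed.

(** Weierstrass test: one n serves all f dominated by d, in particular all times of a family of
    curves. *)
Lemma ssum_unif (d : int -> R) M e : asum d M -> 0 < e ->
  exists n, forall f : int -> R, (forall k, `|f k| <= d k) -> `|ssum f - psum f n| <= e.
Proof.
move=> dM e0; have /cvgrPdist_le /(_ _ e0)[n _ /(_ n (leqnn n))] := tail_cvg0 dM.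
rewrite sub0r normrN => h; exists n => f fd.
apply: le_trans (ssum_tail n dM fd) _; exact: le_trans (ler_norm _) h.
Qed.

Lemma con_ssum a b (f : int -> R -> R) (d : int -> R) M : asum d M ->
  (forall k, con a b (f k)) -> (forall k t, t \in `[a, b] -> `|f k t| <= d k) ->
  con a b (fun t => ssum (f ^~ t)).
Proof.
move=> dM C fd; apply: con_unif => e e0; have [n h] := ssum_unif dM e0.
exists (fun t => psum (f ^~ t) n); first exact: con_psum.
by move=> t tab; apply: h => k; exact: fd.
Qed.

Lemma C1_ssum a b (f g : int -> R -> R) (d : int -> R) M : a < b -> asum d M ->
  (forall k, C1 a b (f k) (g k)) ->
  (forall k t, t \in `[a, b] -> `|f k t| <= d k) ->
  (forall k t, t \in `[a, b] -> `|g k t| <= d k) ->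
  C1 a b (fun t => ssum (f ^~ t)) (fun t => ssum (g ^~ t)).
Proof.
move=> ab dM C fd gd; apply: C1_unif => // e e0; have [n h] := ssum_unif dM e0.
exists (fun t => psum (f ^~ t) n), (fun t => psum (g ^~ t) n).
split; first exact: C1_psum.
by move=> t tab; split; apply: h => k; [exact: fd|exact: gd].
Qed.

End C1_curves.

(** * Complex series and curves *)

Section complex_series.
Variable R : realType.
Local Notation C := R[i].
Implicit Types (z w : C) (f g : int -> C).

Lemma cReD z w : complex.Re (z + w) = complex.Re z + complex.Re w.
Proof. by case: z w => [a b] [c d]. Qed.
Lemma cImD z w : complex.Im (z + w) = complex.Im z + complex.Im w.
Proof. by case: z w => [a b] [c d]. Qed.
Lemma cReN z : complex.Re (- z) = - complex.Re z.
Proof. by case: z. Qed.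
Lemma cImN z : complex.Im (- z) = - complex.Im z.
Proof. by case: z. Qed.
Lemma cReM z w : complex.Re (z * w) =
  complex.Re z * complex.Re w - complex.Im z * complex.Im w.
Proof. by case: z w => [a b] [c d]. Qed.
Lemma cImM z w : complex.Im (z * w) =
  complex.Re z * complex.Im w + complex.Im z * complex.Re w.
Proof. by case: z w => [a b] [c d]. Qed.
Definition cE := (cReD, cImD, cReN, cImN, cReM, cImM).

Lemma eq_c z w : complex.Re z = complex.Re w -> complex.Im z = complex.Im w -> z = w.
Proof. by case: z w => [a b] [c d] /= -> ->. Qed.

Definition ii : C := Complex 0 1.
Definition rc (x : R) : C := Complex x 0.

Lemma rcM (x y : R) : rc (x * y) = rc x * rc y.
Proof. by apply: eq_c; rewrite !cE /=; ring. Qed.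
Lemma rcD (x y : R) : rc (x + y) = rc x + rc y.
Proof. by apply: eq_c; rewrite !cE /=; ring. Qed.
Lemma rcN (x : R) : rc (- x) = - rc x.
Proof. by apply: eq_c; rewrite !cE /=; ring. Qed.
Lemma iiM : ii * ii = -1.
Proof. by apply: eq_c; rewrite !cE /=; ring. Qed.

(* Equivalent to the modulus, without its square root. *)
Definition n1 z : R := `|complex.Re z| + `|complex.Im z|.

Lemma n1_ge0 z : 0 <= n1 z. Proof. by rewrite addr_ge0. Qed.
Lemma n1_0 : n1 0 = 0. Proof. by rewrite /n1 /= normr0 addr0. Qed.
Lemma n1N z : n1 (- z) = n1 z.
Proof. by rewrite /n1 !cE !normrN. Qed.
Lemma n1D z w : n1 (z + w) <= n1 z + n1 w.
Proof. by rewrite /n1 !cE addrACA lerD// ler_normD. Qed.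
Lemma n1B z w : n1 (z - w) <= n1 z + n1 w.
Proof. by rewrite -(n1N w) n1D. Qed.
Lemma n1M z w : n1 (z * w) <= n1 z * n1 w.
Proof.
rewrite /n1 !cE; set a := complex.Re z; set b := complex.Im z.
set c := complex.Re w; set d := complex.Im w.
have := ler_normB (a * c) (b * d); have := ler_normD (a * d) (b * c).
by rewrite !normrM; move=> ? ?; lra.
Qed.
Lemma n1_rc (x : R) z : n1 (rc x * z) = `|x| * n1 z.
Proof. by rewrite /n1 !cE /= !mul0r subr0 addr0 !normrM mulrDr. Qed.
Lemma n1_i z : n1 (ii * z) = n1 z.
Proof. by rewrite /n1 !cE /= !mul0r !mul1r sub0r add0r normrN addrC. Qed.
Lemma n1_le0 z : n1 z <= 0 -> z = 0.
Proof.
rewrite /n1 => h; apply: eq_c; apply/eqP; rewrite -normr_le0.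
  by apply: le_trans h; rewrite lerDl.
by apply: le_trans h; rewrite lerDr.
Qed.
Lemma norm_Re z : `|complex.Re z| <= n1 z. Proof. by rewrite lerDl. Qed.
Lemma norm_Im z : `|complex.Im z| <= n1 z. Proof. by rewrite lerDr. Qed.
Lemma n1_distC z w : n1 (z - w) = n1 (w - z).
Proof. by rewrite -n1N opprB. Qed.

Definition cis (x : R) : C := Complex (cos x) (sin x).
Lemma cisD x y : cis (x + y) = cis x * cis y.
Proof. by apply: eq_c; rewrite !cE /= ?cosD ?sinD//; ring. Qed.
Lemma cis0 : cis 0 = 1.
Proof. by rewrite /cis cos0 sin0. Qed.
Lemma cisNK x : cis (- x) * cis x = 1.
Proof. by rewrite -cisD addNr cis0. Qed.
(** [n1] is not rotation invariant; the value sqrt 2 is rounded up to 2, a factor paid at every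
    change of frame. *)
Lemma n1_cis x : n1 (cis x) <= 2.
Proof.
rewrite /n1 /= (_ : 2 = 1 + 1)// lerD// ler_norml.
  by rewrite cos_geN1 cos_le1.
by rewrite sin_geN1 sin_le1.
Qed.

Definition csum f : C := Complex (ssum (fun k => complex.Re (f k))) (ssum (fun k => complex.Im (f k))).
Definition casum f (M : R) : Prop := asum (fun k => n1 (f k)) M.

Lemma casum_Re f M : casum f M -> asum (fun k => complex.Re (f k)) M.
Proof. by apply: asum_domn => k; rewrite (ger0_norm (n1_ge0 _)) norm_Re. Qed.
Lemma casum_Im f M : casum f M -> asum (fun k => complex.Im (f k)) M.
Proof. by apply: asum_domn => k; rewrite (ger0_norm (n1_ge0 _)) norm_Im. Qed.

Lemma casum_dom f (d : int -> R) M : (forall k, n1 (f k) <= d k) -> asum d M -> casum f M.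
Proof. by move=> fd; apply: asum_dom => k; rewrite ger0_norm ?n1_ge0. Qed.

Lemma eq_csum f g : (forall k, f k = g k) -> csum f = csum g.
Proof. by move=> fg; have -> : f = g by apply: funext. Qed.

Lemma csumD f g M N : casum f M -> casum g N ->
  csum (fun k => f k + g k) = csum f + csum g.
Proof.
move=> fM gN; apply: eq_c; rewrite !cE /=.
  rewrite -(ssumD (casum_Re fM) (casum_Re gN)); apply: eq_ssum => k; exact: cReD.
rewrite -(ssumD (casum_Im fM) (casum_Im gN)); apply: eq_ssum => k; exact: cImD.
Qed.

Lemma csumMl z f M : casum f M -> csum (fun k => z * f k) = z * csum f.
Proof.
move=> fM; have re := casum_Re fM; have im := casum_Im fM.
apply: eq_c; rewrite !cE /=.
  rewrite -(ssumZ _ re) -(ssumZ _ im) -(ssumB (asumZ _ re) (asumZ _ im)).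
  by apply: eq_ssum => k; rewrite cReM.
rewrite -(ssumZ _ re) -(ssumZ _ im) -(ssumD (asumZ _ im) (asumZ _ re)).
by apply: eq_ssum => k; rewrite cImM.
Qed.

Lemma casumD f g M N : casum f M -> casum g N -> casum (fun k => f k + g k) (M + N).
Proof.
move=> fM gN; apply: casum_dom (asumD fM gN) => k; exact: n1D.
Qed.

Lemma casumN f M : casum f M -> casum (fun k => - f k) M.
Proof. by apply: asum_eq => k; rewrite n1N. Qed.

Lemma csumB f g M N : casum f M -> casum g N ->
  csum (fun k => f k - g k) = csum f - csum g.
Proof.
move=> fM gN; rewrite (csumD fM (casumN gN)) -[- csum g]mulN1r -(csumMl _ gN).
by congr (_ + _); apply: eq_csum => k; rewrite mulN1r.
Qed.

Lemma n1_csum f M : casum f M -> n1 (csum f) <= ssum (fun k => n1 (f k)).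
Proof.
move=> fM; have re := casum_Re fM; have im := casum_Im fM.
have abs (h : int -> R) N : asum h N -> asum (fun k => `|h k|) N.
  by apply: asum_domn => k; rewrite normr_id.
have nl (h : int -> R) N : asum h N -> `|ssum h| <= ssum (fun k => `|h k|).
  move=> hN; apply: norm_ssum_le => n.
  by apply: psum_le_ssum => //; exact: abs hN.
rewrite (ssumD (abs _ _ re) (abs _ _ im)) lerD//=; [exact: nl re|exact: nl im].
Qed.

Lemma n1_csum_le f M : casum f M -> n1 (csum f) <= M.
Proof.
move=> fM; apply: le_trans (n1_csum fM) _.
by apply: le_trans (ler_norm _) _; exact: norm_ssum_le.
Qed.

Lemma csum_delta c z : csum (fun k => if k == c then z else 0) = z.
Proof.
apply: eq_c => /=; rewrite -[RHS](@ssum_delta _ c); apply: eq_ssum => k; by case: ifP.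
Qed.

Lemma casum_delta c z : casum (fun k => if k == c then z else 0) (n1 z).
Proof.
rewrite -[n1 z]ger0_norm ?n1_ge0//; apply: asum_eq (asum_delta c (n1 z)) => k.
by case: ifP => // _; rewrite n1_0.
Qed.

Definition cC1 (a b : R) (f g : R -> C) : Prop :=
  C1 a b (fun t => complex.Re (f t)) (fun t => complex.Re (g t)) /\
  C1 a b (fun t => complex.Im (f t)) (fun t => complex.Im (g t)).

Definition ccon (a b : R) (f : R -> C) : Prop :=
  con a b (fun t => complex.Re (f t)) /\ con a b (fun t => complex.Im (f t)).

Section curves.
Variables (a b : R).
Implicit Types F G : R -> C.

Lemma cC1_con F G : cC1 a b F G -> ccon a b F /\ ccon a b G.
Proof. by move=> [[? ? ?] [? ? ?]]. Qed.

Lemma eq_cC1 F G F' G' : cC1 a b F G -> (forall t, t \in `[a, b] -> F t = F' t) ->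
  (forall t, t \in `[a, b] -> G t = G' t) -> cC1 a b F' G'.
Proof.
move=> [h1 h2] FF GG; split; [apply: (eq_C1 h1)|apply: (eq_C1 h2)] => t tab;
  by rewrite ?FF ?GG.
Qed.

Lemma eq_ccon F G : ccon a b F -> (forall t, t \in `[a, b] -> F t = G t) -> ccon a b G.
Proof.
by move=> [h1 h2] FG; split; [apply: (con_eq h1)|apply: (con_eq h2)] => t /FG ->.
Qed.

Lemma cconD F G : ccon a b F -> ccon a b G -> ccon a b (fun t => F t + G t).
Proof.
move=> [h1 h2] [k1 k2]; split.
  by apply: (con_eq (conD h1 k1)) => t _; rewrite cReD.
by apply: (con_eq (conD h2 k2)) => t _; rewrite cImD.
Qed.

Lemma cconM F G : ccon a b F -> ccon a b G -> ccon a b (fun t => F t * G t).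
Proof.
move=> [h1 h2] [k1 k2]; split.
  by apply: (con_eq (conB (conM h1 k1) (conM h2 k2))) => t _; rewrite cReM.
by apply: (con_eq (conD (conM h1 k2) (conM h2 k1))) => t _; rewrite cImM.
Qed.

Lemma ccon_cst z : ccon a b (fun=> z).
Proof. by split; exact: con_cst. Qed.

Lemma cconN F : ccon a b F -> ccon a b (fun t => - F t).
Proof.
move=> h; apply: (eq_ccon (cconM (ccon_cst (-1)) h)) => t _; exact: mulN1r.
Qed.

Lemma cconB F G : ccon a b F -> ccon a b G -> ccon a b (fun t => F t - G t).
Proof. by move=> h k; apply: cconD => //; exact: cconN. Qed.

Lemma cC1_cst z : cC1 a b (fun=> z) (fun=> 0).
Proof. by split; exact: C1_cst. Qed.

Lemma cC1M F G F' G' : cC1 a b F G -> cC1 a b F' G' ->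
  cC1 a b (fun t => F t * F' t) (fun t => G t * F' t + F t * G' t).
Proof.
move=> [h1 h2] [k1 k2]; split.
  by apply: (eq_C1 (C1B (C1M h1 k1) (C1M h2 k2))) => t _; rewrite !cE//; ring.
by apply: (eq_C1 (C1D (C1M h1 k2) (C1M h2 k1))) => t _; rewrite !cE//; ring.
Qed.

Lemma cC1Z z F G : cC1 a b F G -> cC1 a b (fun t => z * F t) (fun t => z * G t).
Proof.
by move=> h; apply: (eq_cC1 (cC1M (cC1_cst z) h)) => t _; rewrite ?mul0r ?add0r.
Qed.

Lemma cC1_cis (m c : R) : cC1 a b (fun t => cis (m * t + c)) (fun t => ii * rc m * cis (m * t + c)).
Proof.
split.
  by apply: (eq_C1 (C1_cos a b m c)) => t _ //; rewrite !cE /=; ring.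
by apply: (eq_C1 (C1_sin a b m c)) => t _ //; rewrite !cE /=; ring.
Qed.

Lemma cC1_csum (f g : int -> R -> C) (d : int -> R) M : a < b -> asum d M ->
  (forall k, cC1 a b (f k) (g k)) ->
  (forall k t, t \in `[a, b] -> n1 (f k t) <= d k) ->
  (forall k t, t \in `[a, b] -> n1 (g k t) <= d k) ->
  cC1 a b (fun t => csum (f ^~ t)) (fun t => csum (g ^~ t)).
Proof.
move=> ab dM C fd gd; split.
  apply: (@C1_ssum _ a b (fun k t => complex.Re (f k t)) _ d M) => // k.
  - by have [] := C k.
  - by move=> t /(fd k); apply: le_trans; exact: norm_Re.
  - by move=> t /(gd k); apply: le_trans; exact: norm_Re.
apply: (@C1_ssum _ a b (fun k t => complex.Im (f k t)) _ d M) => // k.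
- by have [] := C k.
- by move=> t /(fd k); apply: le_trans; exact: norm_Im.
- by move=> t /(gd k); apply: le_trans; exact: norm_Im.
Qed.

Lemma ccon_csum (f : int -> R -> C) (d : int -> R) M : asum d M ->
  (forall k, ccon a b (f k)) -> (forall k t, t \in `[a, b] -> n1 (f k t) <= d k) ->
  ccon a b (fun t => csum (f ^~ t)).
Proof.
move=> dM C fd; split.
  apply: (@con_ssum _ a b (fun k t => complex.Re (f k t)) d M) => // k.
  - by have [] := C k.
  - by move=> t /(fd k); apply: le_trans; exact: norm_Re.
apply: (@con_ssum _ a b (fun k t => complex.Im (f k t)) d M) => // k.
- by have [] := C k.
- by move=> t /(fd k); apply: le_trans; exact: norm_Im.
Qed.

Lemma cC1_unif F G : a < b ->
  (forall e : R, 0 < e -> exists F' G', cC1 a b F' G' /\ forall t, t \in `[a, b] ->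
    n1 (F t - F' t) <= e /\ n1 (G t - G' t) <= e) ->
  cC1 a b F G.
Proof.
move=> ab h; split; apply: C1_unif => // e /h[F' [G' [[C C'] d]]].
  exists (fun t => complex.Re (F' t)), (fun t => complex.Re (G' t)); split=> // t /d[] d1 d2.
  by rewrite -!cReN -!cReD; split; [apply: le_trans d1|apply: le_trans d2]; exact: norm_Re.
exists (fun t => complex.Im (F' t)), (fun t => complex.Im (G' t)); split=> // t /d[] d1 d2.
by rewrite -!cImN -!cImD; split; [apply: le_trans d1|apply: le_trans d2]; exact: norm_Im.
Qed.

Definition cint F t : C :=
  Complex (\int[@lebesgue_measure R]_(s in `[a, t]) complex.Re (F s))
          (\int[@lebesgue_measure R]_(s in `[a, t]) complex.Im (F s)).

Lemma cC1_ftc F G t : cC1 a b F G -> t \in `[a, b] -> cint G t = F t - F a.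
Proof.
move=> [C D] tab; apply: eq_c; rewrite !cE /=.
  by rewrite (C1_ftc C tab).
by rewrite (C1_ftc D tab).
Qed.

Lemma cC1_int z G : a < b -> ccon a b G -> cC1 a b (fun t => z + cint G t) G.
Proof.
move=> ab [c1 c2]; split.
  by apply: (eq_C1 (C1_int (complex.Re z) ab c1)) => t _ //; rewrite cReD.
by apply: (eq_C1 (C1_int (complex.Im z) ab c2)) => t _ //; rewrite cImD.
Qed.

(* The factor 2 comes from n1 not being the modulus. *)
Lemma n1_cint_le G (M : R) t : ccon a b G -> t \in `[a, b] ->
  (forall s, s \in `[a, b] -> n1 (G s) <= M) -> n1 (cint G t) <= 2 * M * (b - a).
Proof.
move=> [c1 c2] + GM; rewrite in_itv/= => /andP[at_ tb].
have sub : `[a, t] `<=` `[a, b] by exact: subset_itvl.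
have M0 : 0 <= M.
  by apply: le_trans (n1_ge0 (G a)) (GM a _); rewrite in_itv/= lexx (le_trans at_).
have h (g : R -> R) : con a b g -> (forall s, s \in `[a, b] -> `|g s| <= M) ->
    `|\int[@lebesgue_measure R]_(s in `[a, t]) g s| <= M * (b - a).
  move=> cg gM; apply: (le_trans (le_abs_int at_ (con_sub cg sub) (fun s st => gM s (sub s st)))).
  by apply: ler_wpM2l => //; lra.
have := h _ c1 (fun s st => le_trans (norm_Re _) (GM s st)).
have := h _ c2 (fun s st => le_trans (norm_Im _) (GM s st)).
rewrite /n1 /=; set x := `|_|; set y := `|_|; move=> ? ?; lra.
Qed.

Lemma cintB F G t : ccon a b F -> ccon a b G -> t \in `[a, b] ->
  cint (fun s => F s - G s) t = cint F t - cint G t.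
Proof.
move=> [c1 c2] [d1 d2]; rewrite in_itv/= => /andP[at_ tb].
have sub : `[a, t] `<=` `[a, b] by exact: subset_itvl.
apply: eq_c; rewrite !cE /=.
  under eq_Rintegral do rewrite cReD cReN.
  by rewrite RintegralB//; apply: con_integrable; [exact: con_sub c1 _|exact: con_sub d1 _].
under eq_Rintegral do rewrite cImD cImN.
by rewrite RintegralB//; apply: con_integrable; [exact: con_sub c2 _|exact: con_sub d2 _].
Qed.

Lemma eq_cint F G t : (forall s, s \in `[a, t] -> F s = G s) -> cint F t = cint G t.
Proof.
move=> FG; apply: eq_c => /=; apply: eq_Rintegral => s; rewrite inE/= => sat;
  by rewrite FG.
Qed.

End curves.
End complex_series.
Arguments ii {R}.

(** * The bilinear operators of the normal form *)

Section bilinear_operators.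
Variable R : realType.
Local Notation C := R[i].
Implicit Types (a b : int -> C) (k l : int) (t al be D : R) (m : int -> int -> R).

(* Both measure the sequence with the weights (1 + |k|)^s: bd in l^oo, hs in l^2,
   so that hs s is the H^s norm up to a constant. *)
Definition bd (s : nat) (al : R) a : Prop := forall k, n1 (a k) <= al / J R k ^+ s.

Definition hs (s : nat) (al : R) a : Prop :=
  asum (fun k => (J R k ^+ s * n1 (a k)) ^+ 2) (al ^+ 2).

Lemma JX_gt0 k s : 0 < J R k ^+ s.
Proof. by rewrite exprn_gt0// J_gt0. Qed.

Lemma JX_ge1 k s : 1 <= J R k ^+ s.
Proof. by rewrite exprn_ege1// J_ge1. Qed.

Lemma JV_ge0 k s : 0 <= (J R k ^+ s)^-1.
Proof. by rewrite invr_ge0 ltW// JX_gt0. Qed.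

Lemma JV_le k s s' : (s' <= s)%N -> (J R k ^+ s)^-1 <= (J R k ^+ s')^-1.
Proof.
by move=> ss; rewrite lef_pV2 ?posrE ?JX_gt0//; apply: ler_weXn2l => //; exact: J_ge1.
Qed.

Lemma bd_ge0 s al a : bd s al a -> 0 <= al.
Proof.
by move=> /(_ 0) /(le_trans (n1_ge0 _)); rewrite pmulr_lge0// invr_gt0 JX_gt0.
Qed.

Lemma bd_le s s' al al' a : (s' <= s)%N -> al <= al' -> bd s al a -> bd s' al' a.
Proof.
move=> ss aa h k; apply: le_trans (h k) _; apply: ler_pM => //.
- exact: bd_ge0 h.
- exact: JV_ge0.
- exact: JV_le.
Qed.

Lemma hs_le s al al' a : 0 <= al -> al <= al' -> hs s al a -> hs s al' a.
Proof.
move=> al0 aa h n; apply: le_trans (h n) _; apply: lerXn2r => //; rewrite nnegrE//.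
exact: le_trans aa.
Qed.

Lemma bdD s al be a b : bd s al a -> bd s be b -> bd s (al + be) (fun k => a k + b k).
Proof.
by move=> h h' k; apply: le_trans (n1D _ _) _; rewrite mulrDl lerD.
Qed.

Lemma bdN s al a : bd s al a -> bd s al (fun k => - a k).
Proof. by move=> h k; rewrite n1N. Qed.

Lemma bdB s al be a b : bd s al a -> bd s be b -> bd s (al + be) (fun k => a k - b k).
Proof. by move=> h h'; apply: bdD => //; exact: bdN. Qed.

Lemma hs_bd s al a : 0 <= al -> hs s al a -> bd s al a.
Proof.
move=> al0 h k; rewrite ler_pdivlMr ?JX_gt0// mulrC.
have p0 : 0 <= J R k ^+ s * n1 (a k) by rewrite mulr_ge0 ?n1_ge0// ltW// JX_gt0.
rewrite -(@ler_pXn2r _ 2) ?nnegrE//.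
by have := asum_term k h; rewrite ger0_norm// exprn_ge0.
Qed.

(* Phase difference when the modes l and k - l interact into k. *)
Definition phi k l : R :=
  k%:~R ^+ 5 - l%:~R ^+ 5 - (k - l)%:~R ^+ 5.

(** Removes the interactions with the mode 0, where [phi] vanishes. They carry the mean and reappear
    as a frequency shift in [conv_Nop]. *)
Definition nonres k l : R := if (l == 0) || (l == k) then 0 else 1.

Definition mN k l : R := k%:~R * nonres k l.

(* Division by zero makes mB vanish for l = 0 and l = k. *)
Definition mB k l : R :=
  2 / (5 * l%:~R * (k - l)%:~R * (k%:~R ^+ 2 + l%:~R ^+ 2 + (k - l)%:~R ^+ 2)).

(** The factor k of the derivative cancels against the factor k of [phi], so [mB] is not singular at
    k = 0. At l = 0 and l = k both sides vanish. *)
Lemma phi_mB k l : phi k l * mB k l = mN k l.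
Proof.
rewrite /mN /nonres /mB; case: eqP => [->|/eqP l0] /=.
  by rewrite !mulr0 !mul0r invr0 !mulr0.
case: eqP => [->|/eqP lk] /=.
  by rewrite subrr !mulr0 mul0r invr0 !mulr0.
rewrite mulr1 /phi; have := lk; rewrite eq_sym -subr_eq0 -(intr_eq0 R) => kl0.
have {}l0 : l%:~R != 0 :> R by rewrite intr_eq0.
have kE : k%:~R = l%:~R + (k - l)%:~R :> R by rewrite -intrD addrC subrK.
move: kE kl0; set y : R := (k - l)%:~R => -> kl0.
move: l0; set x : R := l%:~R => x0.
have q0 : (x + y) ^+ 2 + x ^+ 2 + y ^+ 2 != 0.
  rewrite gt_eqF//.
  have : 0 < x ^+ 2 by rewrite exprn_even_gt0.
  by have := sqr_ge0 y; have := sqr_ge0 (x + y); move=> ? ? ?; lra.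
have d0 : 5 * x * y * ((x + y) ^+ 2 + x ^+ 2 + y ^+ 2) != 0.
  by rewrite !mulf_neq0// pnatr_eq0.
by rewrite mulrA; apply: (mulIf d0); rewrite mulfVK//; ring.
Qed.

Lemma norm_nonres k l : 0 <= nonres k l <= 1.
Proof. by rewrite /nonres; case: ifP; rewrite ?lexx ?ler01. Qed.

Lemma mN_le k l : `|mN k l| <= J R k.
Proof.
rewrite /mN normrM JE; have /andP[n0 nle1] := norm_nonres k l.
rewrite (ger0_norm n0); have := normr_ge0 (k%:~R : R); nra.
Qed.

Lemma J_half l : l != 0 -> J R l / 2 <= `|l%:~R|.
Proof.
move=> l0; rewrite JE; have : 1 <= `|l%:~R : R|.
  by rewrite -intr_norm -[1]/(1%:~R) ler_int; lia.
by move=> ?; lra.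
Qed.

(** Off the excluded modes |l| and |k - l| are at least half of their weights, and the quadratic
    form is at least [J k ^+ 2 / 2]. The gain is one weight on each input and two on the output. *)
Lemma mB_le k l : `|mB k l| <= 4 / (J R l * J R (k - l) * J R k ^+ 2).
Proof.
have Jp := J_gt0 R.
have rhs0 : 0 <= 4 / (J R l * J R (k - l) * J R k ^+ 2).
  by rewrite divr_ge0// mulr_ge0 ?exprn_ge0 ?mulr_ge0// ltW.
rewrite /mB; case: (eqVneq l 0) rhs0 => [->|l0] rhs0.
  by rewrite mulr0z mulr0 !mul0r invr0 mulr0 normr0.
case: (eqVneq l k) rhs0 => [->|lk] rhs0.
  by rewrite subrr mulr0z mulr0 mul0r invr0 mulr0 normr0 -[in leRHS](subrr k).
have kl0 : k - l != 0 by rewrite subr_eq0 eq_sym.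
have h1 := J_half l0; have h2 := J_half kl0.
have one (j : int) : j != 0 -> 1 <= (j%:~R : R) ^+ 2.
  move=> j0; rewrite -(real_normK (num_real _)) -intr_norm.
  by apply: exprn_ege1; rewrite -[1]/(1%:~R) ler_int; lia.
have h3 : J R k ^+ 2 / 2 <= (k%:~R : R) ^+ 2 + l%:~R ^+ 2 + (k - l)%:~R ^+ 2.
  have := one _ l0; have := one _ kl0.
  rewrite JE -(real_normK (num_real (k%:~R : R))); set x := `|_|; set y := _ ^+ 2; set z := _ ^+ 2.
  by have := sqr_ge0 (x - 1); move=> ? ? ?; nra.
set q := _ + _ ^+ 2 in h3 *.
have q0 : 0 < q by apply: lt_le_trans h3; rewrite divr_gt0 ?exprn_gt0 ?Jp.
rewrite normrM normfV !normrM (ger0_norm (ltW q0)) !normr_nat.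
move: h1 h2; set x := `|l%:~R|; set y := `|_|; move: (Jp l) (Jp (k - l)) (Jp k).
set u := J R l; set v := J R (k - l); set w := J R k => u0 v0 w0 h1 h2.
have x0 : 0 < x by apply: lt_le_trans h1; rewrite divr_gt0.
have y0 : 0 < y by apply: lt_le_trans h2; rewrite divr_gt0.
rewrite ler_pdivrMr ?mulr_gt0// mulrAC ler_pdivlMr ?mulr_gt0 ?exprn_gt0//.
(* The three halves give the constant (2 / 5) * 8 = 16 / 5, which is at most 4. *)
have : (u / 2) * (v / 2) * (w ^+ 2 / 2) <= x * y * q.
  have hu : 0 <= u / 2 by rewrite divr_ge0 ?ltW.
  have hv : 0 <= v / 2 by rewrite divr_ge0 ?ltW.
  by apply: ler_pM => //; [exact: mulr_ge0|rewrite divr_ge0 ?exprn_ge0 ?ltW|exact: ler_pM].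
set W := w ^+ 2; set p := x * y * q => h.
have -> : 4 * (5 * x * y * q) = 20 * p by rewrite /p; ring.
have p0 : 0 < p by rewrite !mulr_gt0.
have -> : 2 * (u * v * W) = 16 * (u / 2 * (v / 2) * (W / 2)) by field.
lra.
Qed.

Definition gterm m t a b k l : C :=
  rc (m k l) * cis (- phi k l * t) * (a l * b (k - l)).

Definition gop m t a b : int -> C := fun k => csum (gterm m t a b k).

(* For v k = e^{-i theta_k t} u k the equation with mean zero reads v' = N_t(v, v);
   the time derivative of B_t(v, v) at frozen v is N_t(v, v). *)
Definition Nop t a b : int -> C := fun k => - ii * gop mN t a b k.
Definition Bop t a b : int -> C := gop mB t a b.

Lemma n1_gterm m t a b k l :
  n1 (gterm m t a b k l) <= 2 * (`|m k l| * n1 (a l) * n1 (b (k - l))).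
Proof.
rewrite /gterm -mulrA n1_rc; have h := n1_cis (- phi k l * t).
have h' := n1M (a l) (b (k - l)).
apply: (@le_trans _ _ (`|m k l| * (2 * (n1 (a l) * n1 (b (k - l)))))); last by rewrite !mulrA [2 * _]mulrC.
rewrite ler_wpM2l//; apply: le_trans (n1M _ _) _.
by apply: ler_pM; rewrite ?n1_ge0.
Qed.

Lemma casum_dom2 (f : int -> C) k D :
  (forall l, n1 (f l) <= D * ((J R l ^+ 2)^-1 + (J R (k - l) ^+ 2)^-1)) ->
  casum f (`|D| * 8).
Proof.
move=> fD; apply: (casum_dom fD); have -> : 8 = 4 + 4 :> R by rewrite -natrD.
apply: asumZ; apply: asumD; first exact: asum_J2.
exact: (asum_refl k (asum_J2 R)).
Qed.

Lemma mB_le4 k l : `|mB k l| <= 4.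
Proof.
apply: le_trans (mB_le k l) _; rewrite ler_pdivrMr ?mulr_gt0 ?JX_gt0 ?J_gt0//.
by rewrite ler_peMr// !mulr_ege1 ?J_ge1// JX_ge1.
Qed.

(** A crude growth condition shared by both multipliers: it makes [gop] converge absolutely on
    weight 2, which is enough for bilinearity and for continuity and differentiation in time. *)
Definition mle m := forall k l, `|m k l| <= 4 * J R k.

Lemma mN_mle : mle mN.
Proof. by move=> k l; apply: le_trans (mN_le k l) _; rewrite ler_peMl ?ler1n// ltW ?J_gt0. Qed.

Lemma mB_mle : mle mB.
Proof. by move=> k l; apply: le_trans (mB_le4 k l) _; rewrite ler_peMr// J_ge1. Qed.

(** A majorant free of t, as termwise differentiation in time requires. *)
Definition gdom (al be : R) k l : R := 8 * J R k * al * be / J R l ^+ 2.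

Lemma asum_gdom al be k : asum (gdom al be k) (`|8 * J R k * al * be| * 4).
Proof. by apply: asumZ; exact: asum_J2. Qed.

Lemma gterm_dom m t a b al be k l : mle m -> bd 2 al a -> bd 2 be b ->
  n1 (gterm m t a b k l) <= gdom al be k l.
Proof.
move=> mok ha hb; apply: le_trans (n1_gterm _ _ _ _ _ _) _.
have := mok k l; have := ha l; have := hb (k - l).
have al0 := bd_ge0 ha; have be0 := bd_ge0 hb.
have h1 : be / J R (k - l) ^+ 2 <= be.
  by rewrite ler_pdivrMr ?JX_gt0// ler_peMr// JX_ge1.
move=> /le_trans /(_ h1) hb' ha' mk.
have -> : gdom al be k l = 2 * (4 * J R k * (al / J R l ^+ 2) * be) by rewrite /gdom; ring.
rewrite ler_pM2l//; apply: ler_pM; rewrite ?mulr_ge0 ?n1_ge0//.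
by apply: ler_pM; rewrite ?n1_ge0.
Qed.

Lemma casum_gterm m t a b al be k : mle m -> bd 2 al a -> bd 2 be b ->
  casum (gterm m t a b k) (`|8 * J R k * al * be| * 4).
Proof.
move=> mok ha hb; apply: (casum_dom _ (asum_gdom al be k)) => l.
exact: gterm_dom.
Qed.

Lemma gopBl m t a a' b al al' be k : mle m -> bd 2 al a -> bd 2 al' a' -> bd 2 be b ->
  gop m t (fun j => a j - a' j) b k = gop m t a b k - gop m t a' b k.
Proof.
move=> mok ha ha' hb; rewrite /gop -(csumB (casum_gterm t k mok ha hb) (casum_gterm t k mok ha' hb)).
by apply: eq_csum => l; rewrite /gterm; ring.
Qed.

Lemma gopBr m t a b b' al be be' k : mle m -> bd 2 al a -> bd 2 be b -> bd 2 be' b' ->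
  gop m t a (fun j => b j - b' j) k = gop m t a b k - gop m t a b' k.
Proof.
move=> mok ha hb hb'; rewrite /gop -(csumB (casum_gterm t k mok ha hb) (casum_gterm t k mok ha hb')).
by apply: eq_csum => l; rewrite /gterm; ring.
Qed.

Lemma six_le (x y z : R) : 1 <= x -> 1 <= y -> 1 <= z -> z <= x + y ->
  z ^+ 6 <= 64 * (x ^+ 6 + y ^+ 6).
Proof.
move=> x1 y1 z1 zxy.
have main (p q : R) : 1 <= p -> p <= q -> (p + q) ^+ 6 <= 64 * (p ^+ 6 + q ^+ 6).
  move=> p1 pq; apply: (@le_trans _ _ ((2 * q) ^+ 6)).
    by apply: lerXn2r; rewrite ?nnegrE; lra.
  have -> : (2 * q) ^+ 6 = 64 * q ^+ 6 by rewrite exprMn; congr (_ * _); rewrite -natrX.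
  by rewrite ler_pM2l// lerDr exprn_ge0//; lra.
apply: (@le_trans _ _ ((x + y) ^+ 6)); first by apply: lerXn2r; rewrite ?nnegrE; lra.
have [xy|/ltW yx] := leP x y; first exact: main.
by rewrite addrC [X in 64 * X]addrC; exact: main.
Qed.

(** By [J_tri] one of l and k - l is at least of the order of k, and its sixth power pays for that
    of k; the other factor keeps more than the two powers that a sum needs. *)
Lemma weight_le k l : J R k ^+ 6 / (J R l ^+ 6 * J R (k - l) ^+ 6) <=
  64 * ((J R l ^+ 2)^-1 + (J R (k - l) ^+ 2)^-1).
Proof.
have := six_le (J_ge1 R l) (J_ge1 R (k - l)) (J_ge1 R k) (J_tri R k l).
set x := J R l; set y := J R (k - l); set z := J R k => h.
have x0 : 0 < x := J_gt0 R l; have y0 : 0 < y := J_gt0 R (k - l).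
apply: (@le_trans _ _ (64 * (x ^+ 6 + y ^+ 6) / (x ^+ 6 * y ^+ 6))).
  by rewrite ler_wpM2r// invr_ge0 mulr_ge0// exprn_ge0// ltW.
rewrite -mulrA ler_pM2l//.
have -> : (x ^+ 6 + y ^+ 6) / (x ^+ 6 * y ^+ 6) = (x ^+ 6)^-1 + (y ^+ 6)^-1.
  by field; rewrite !gt_eqF.
by rewrite lerD// JV_le.
Qed.

(** 1024 = 2 * 64 * 8: the rotation, [weight_le], and two sums of the inverse square of [J], each at
    most 4. *)
Lemma gop_bd m t a b al be k D : mle m -> bd 2 al a -> bd 2 be b -> 0 <= D ->
  (forall l, `|m k l| * n1 (a l) * n1 (b (k - l)) <=
     D * (J R k ^+ 6 / (J R l ^+ 6 * J R (k - l) ^+ 6))) ->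
  n1 (gop m t a b k) <= 1024 * D.
Proof.
move=> mok ha hb D0 h; have -> : 1024 * D = `|128 * D| * 8.
  by rewrite ger0_norm ?mulr_ge0//; ring.
apply: n1_csum_le; apply: (@casum_dom2 _ k) => l.
apply: le_trans (n1_gterm _ _ _ _ _ _) _.
have -> : 128 * D = 2 * (D * 64) by ring.
rewrite -!mulrA ler_pM2l// !mulrA; apply: le_trans (h l) _.
by rewrite -[leRHS]mulrA; apply: ler_wpM2l => //; exact: weight_le.
Qed.

(* Locked, so that conversion never unfolds the unary numeral. *)
Definition Kop : R := locked 4096.

Lemma Kop_ge : 4096 <= Kop.
Proof. by rewrite /Kop -lock. Qed.

Lemma Kop_ge1 : 1 <= Kop.
Proof. by apply: le_trans Kop_ge; rewrite ler1n. Qed.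

Lemma Kop_ge0 : 0 <= Kop.
Proof. exact: le_trans ler01 Kop_ge1. Qed.

Lemma le_1024_4096 : 1024 <= 4096 :> R.
Proof. by rewrite ler_nat. Qed.

Lemma le_Kop (c al be : R) : c <= 4096 -> 0 <= al -> 0 <= be ->
  c * (al * be) <= Kop * (al * be).
Proof.
move=> c4 al0 be0; apply: ler_wpM2r; first exact: mulr_ge0.
exact: le_trans c4 Kop_ge.
Qed.

Lemma Nop_bd t a b al be : bd 6 al a -> bd 6 be b -> bd 5 (Kop * (al * be)) (Nop t a b).
Proof.
move=> ha hb; apply: (@bd_le 5 5 (1024 * (al * be)) _ _ (leqnn 5) (le_Kop le_1024_4096 (bd_ge0 ha) (bd_ge0 hb))).
move=> k; have al0 := bd_ge0 ha; have be0 := bd_ge0 hb.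
rewrite /Nop mulNr n1N n1_i -mulrA.
apply: (@gop_bd _ _ _ _ al be) => //; first exact: mN_mle.
- exact: bd_le ha.
- exact: bd_le hb.
- by rewrite mulr_ge0 ?mulr_ge0// JV_ge0.
move=> l; have -> : al * be / J R k ^+ 5 * (J R k ^+ 6 / (J R l ^+ 6 * J R (k - l) ^+ 6)) =
    J R k * (al / J R l ^+ 6) * (be / J R (k - l) ^+ 6).
  by move: (J_neq0 R k) (J_neq0 R l) (J_neq0 R (k - l)); set x := J R k; set y := J R l; set z := J R (k - l) => ? ? ?; field; do ?[apply/andP; split].
by apply: ler_pM; rewrite ?mulr_ge0 ?n1_ge0//; apply: ler_pM; rewrite ?n1_ge0 ?mN_le.
Qed.

(** The factors [J l] and [J (k - l)] gained in [mB_le] lift both inputs from weight 5 to 6, where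
    convolution is stable, and [J k ^+ 2] lifts the output from 6 to 8. Weight 5 is what [Nop]
    delivers. The constant is 4 * 1024. *)
Lemma Bop_bd t a b al be i j : (5 <= i)%N -> (5 <= j)%N -> bd i al a -> bd j be b ->
  bd 8 (Kop * (al * be)) (Bop t a b).
Proof.
move=> i5 j5 ha hb; apply: (@bd_le 8 8 (4096 * (al * be)) _ _ (leqnn 8) (le_Kop (lexx _) (bd_ge0 ha) (bd_ge0 hb))).
move=> k; have al0 := bd_ge0 ha; have be0 := bd_ge0 hb.
have {}ha := bd_le i5 (lexx _) ha; have {}hb := bd_le j5 (lexx _) hb.
have -> : 4096 * (al * be) / J R k ^+ 8 = 1024 * (4 * (al * be) / J R k ^+ 8) by ring.
apply: (@gop_bd _ _ _ _ al be) => //; first exact: mB_mle.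
- exact: bd_le ha.
- exact: bd_le hb.
- by rewrite mulr_ge0 ?mulr_ge0// JV_ge0.
move=> l; have -> : 4 * (al * be) / J R k ^+ 8 * (J R k ^+ 6 / (J R l ^+ 6 * J R (k - l) ^+ 6)) =
    4 / (J R l * J R (k - l) * J R k ^+ 2) * (al / J R l ^+ 5) * (be / J R (k - l) ^+ 5).
  by move: (J_neq0 R k) (J_neq0 R l) (J_neq0 R (k - l)); set x := J R k; set y := J R l; set z := J R (k - l) => ? ? ?; field; do ?[apply/andP; split].
by apply: ler_pM; rewrite ?mulr_ge0 ?n1_ge0//; apply: ler_pM; rewrite ?n1_ge0 ?mB_le.
Qed.

(** The last hypothesis is a product rule: the output weight falls on one factor, kept in l^2, while
    the other is bounded by the inverse square of [J], hence in l^1. Young's inequality handles each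
    piece. *)
Lemma gop_hs m t a b (w : int -> R) D al be s s' : mle m -> (2 <= s)%N -> (2 <= s')%N ->
  0 <= D -> 0 <= al -> 0 <= be -> hs s al a -> hs s' be b -> (forall k, 0 <= w k) ->
  (forall k l, w k * (`|m k l| * n1 (a l) * n1 (b (k - l))) <=
     D * (J R l ^+ s * n1 (a l) * n1 (b (k - l)) + n1 (a l) * (J R (k - l) ^+ s' * n1 (b (k - l))))) ->
  asum (fun k => (w k * n1 (gop m t a b k)) ^+ 2) ((16 * D * (al * be)) ^+ 2).
Proof.
move=> mok s2 s2' D0 al0 be0 ha hb w0 h.
have Ba := bd_le s2 (lexx _) (hs_bd al0 ha); have Bb := bd_le s2' (lexx _) (hs_bd be0 hb).
pose A l := J R l ^+ s * n1 (a l); pose B l := J R l ^+ s' * n1 (b l).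
pose c l := (J R l ^+ 2)^-1.
have cS : asum c 4 := asum_J2 R.
have c0 l : 0 <= c l by exact: JV_ge0.
have A0 l : 0 <= A l by rewrite mulr_ge0 ?n1_ge0// ltW// JX_gt0.
have B0 l : 0 <= B l by rewrite mulr_ge0 ?n1_ge0// ltW// JX_gt0.
have four : (0 : R) < 4 by [].
have [YA _] := young four c0 cS ha; have [_ YB] := young four c0 cS hb.
have SA k : asum (fun l => A l * c (k - l)) (4 + al ^+ 2 * 1).
  apply: (proj1 (ssum_CS four _ (asum_refl k cS) _)) => //.
  rewrite mulr1; apply: asum_domn ha => l; rewrite normrM ler_piMr//.
  by rewrite ger0_norm// invf_le1 ?JX_gt0// JX_ge1.
have SB k : asum (fun l => B (k - l) * c l) (4 + be ^+ 2).
  apply: (proj1 (ssum_CS four _ cS _)) => //.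
  apply: asum_domn (asum_refl k hb) => l; rewrite normrM ler_piMr//.
  by rewrite ger0_norm// invf_le1 ?JX_gt0// JX_ge1.
pose X k := ssum (fun l => A l * c (k - l)); pose Y k := ssum (fun l => B (k - l) * c l).
have X0 k : 0 <= X k by apply: (ssum_ge0 (SA k)) => l; rewrite mulr_ge0.
have Y0 k : 0 <= Y k by apply: (ssum_ge0 (SB k)) => l; rewrite mulr_ge0.
have key k : w k * n1 (gop m t a b k) <= 2 * D * (be * X k + al * Y k).
  have cs := casum_gterm t k mok Ba Bb.
  apply: (@le_trans _ _ (w k * ssum (fun l => n1 (gterm m t a b k l)))).
    by apply: ler_wpM2l => //; exact: n1_csum cs.
  have cs' : asum (fun l => n1 (gterm m t a b k l)) (`|8 * J R k * al * be| * 4) by exact: cs.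
  rewrite -(ssumZ _ cs') -(ssumZ _ (SA k)) -(ssumZ _ (SB k)).
  rewrite -(ssumD (asumZ _ (SA k)) (asumZ _ (SB k))) -(ssumZ _ (asumD (asumZ _ (SA k)) (asumZ _ (SB k)))).
  apply: (le_ssum (asumZ _ cs') (asumZ _ (asumD (asumZ _ (SA k)) (asumZ _ (SB k))))) => l.
  apply: (@le_trans _ _ (w k * (2 * (`|m k l| * n1 (a l) * n1 (b (k - l)))))).
    by apply: ler_wpM2l => //; exact: n1_gterm.
  rewrite mulrCA -[leRHS]mulrA ler_pM2l//.
  apply: le_trans (h k l) _; apply: ler_wpM2l => //.
  rewrite -/(A l) -/(B (k - l)); apply: lerD.
    by rewrite mulrCA; apply: ler_wpM2l => //; exact: Bb.
  have -> : al * (B (k - l) * c l) = al * c l * B (k - l) by ring.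
  by apply: ler_wpM2r => //; exact: Ba.
apply: asum_nneg => [k|n]; first exact: sqr_ge0.
(* The square of a sum is at most twice the sum of squares; by [young] with K = 4 each half then
   contributes one half of (16 D al be)^2. *)
apply: (@le_trans _ _ (psum (fun k => (8 * D ^+ 2 * be ^+ 2) * (X k ^+ 2) + (8 * D ^+ 2 * al ^+ 2) * (Y k ^+ 2)) n)).
  apply: le_psum => k; apply: (@le_trans _ _ ((2 * D * (be * X k + al * Y k)) ^+ 2)).
    rewrite ler_pXn2r ?nnegrE//; first by rewrite mulr_ge0 ?n1_ge0.
    by rewrite !mulr_ge0// addr_ge0// mulr_ge0.
  have := sqr_ge0 (D * (be * X k - al * Y k)); nra.
rewrite psumD !psumZ.
have HX : psum (fun k => X k ^+ 2) n <= 16 * al ^+ 2.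
  apply: le_trans (ler_norm _) _; apply: le_trans (norm_psum _ _) _.
  by have := YA n; rewrite (_ : 4 ^+ 2 = 16)//; rewrite -natrX.
have HY : psum (fun k => Y k ^+ 2) n <= 16 * be ^+ 2.
  apply: le_trans (ler_norm _) _; apply: le_trans (norm_psum _ _) _.
  by have := YB n; rewrite (_ : 4 ^+ 2 = 16)//; rewrite -natrX.
have -> : (16 * D * (al * be)) ^+ 2 = 8 * D ^+ 2 * be ^+ 2 * (16 * al ^+ 2) + 8 * D ^+ 2 * al ^+ 2 * (16 * be ^+ 2) by ring.
by apply: lerD; apply: ler_wpM2l => //; rewrite !mulr_ge0// sqr_ge0.
Qed.

Lemma Nop_hs t a b al be : 0 <= al -> 0 <= be -> hs 6 al a -> hs 6 be b ->
  hs 5 (Kop * (al * be)) (Nop t a b).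
Proof.
move=> al0 be0 ha hb; apply: (@hs_le 5 (1024 * (al * be)) _ _ _ (le_Kop le_1024_4096 al0 be0)).
  exact: (mulr_ge0 (ler0n _ _) (mulr_ge0 al0 be0)).
have -> : 1024 * (al * be) = 16 * 64 * (al * be) by ring.
apply: (@asum_eq _ (fun k => (J R k ^+ 5 * n1 (gop mN t a b k)) ^+ 2)).
  by move=> k; rewrite /Nop mulNr n1N n1_i.
apply: (@gop_hs mN t a b (fun k => J R k ^+ 5) 64 al be 6 6) => // [|k|k l]; first exact: mN_mle.
  by rewrite ltW// JX_gt0.
have := six_le (J_ge1 R l) (J_ge1 R (k - l)) (J_ge1 R k) (J_tri R k l).
have := mN_le k l; set x := J R l ^+ 6; set y := J R (k - l) ^+ 6.
set p := n1 _; set q := n1 _ => h1 h2.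
have p0 : 0 <= p by exact: n1_ge0.
have q0 : 0 <= q by exact: n1_ge0.
apply: (@le_trans _ _ (J R k ^+ 6 * (p * q))).
  rewrite -[`|_| * _ * _]mulrA [leLHS]mulrA; apply: ler_wpM2r; first exact: mulr_ge0.
  by rewrite [leRHS]exprSr; apply: ler_wpM2l => //; rewrite ltW// JX_gt0.
have -> : 64 * (x * p * q + p * (y * q)) = 64 * (x + y) * (p * q) by ring.
by apply: ler_wpM2r => //; exact: mulr_ge0.
Qed.

(** With x = [J l] and y = [J (k - l)], after [six_le] the weight is (x^6 + y^6) / (x y), at most
    x^5 + y^5: regularity 5 of the inputs is enough. The constant is 16 * (4 * 64). *)
Lemma Bop_hs t a b al be i j : 0 <= al -> 0 <= be -> (5 <= i <= 6)%N -> (5 <= j <= 6)%N ->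
  hs i al a -> hs j be b -> hs 8 (Kop * (al * be)) (Bop t a b).
Proof.
move=> al0 be0 /andP[i5 i6] /andP[j5 j6] ha hb; apply: (@hs_le 8 (4096 * (al * be)) _ _ _ (le_Kop (lexx _) al0 be0)).
  exact: (mulr_ge0 (ler0n _ _) (mulr_ge0 al0 be0)).
have -> : 4096 * (al * be) = 16 * 256 * (al * be) by ring.
rewrite /hs /Bop; apply: (@gop_hs mB t a b (fun k => J R k ^+ 8) 256 al be i j) => //; [exact: mB_mle|exact: leq_trans i5|exact: leq_trans j5| |].
  by move=> k; rewrite ltW// JX_gt0.
move=> k l.
have := six_le (J_ge1 R l) (J_ge1 R (k - l)) (J_ge1 R k) (J_tri R k l).
have := mB_le k l; have := J_gt0 R l; have := J_gt0 R (k - l); have := J_gt0 R k.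
have hx : J R l ^+ 5 <= J R l ^+ i by apply: ler_weXn2l => //; exact: J_ge1.
have hy : J R (k - l) ^+ 5 <= J R (k - l) ^+ j by apply: ler_weXn2l => //; exact: J_ge1.
have x1 := J_ge1 R l; have y1 := J_ge1 R (k - l).
move: hx hy x1 y1; set X := J R l ^+ i; set Y := J R (k - l) ^+ j.
set x := J R l; set y := J R (k - l); set z := J R k.
set p := n1 _; set q := n1 _ => hx hy x1 y1 z0 y0 x0 h1 h2.
have p0 : 0 <= p by exact: n1_ge0.
have q0 : 0 <= q by exact: n1_ge0.
apply: (@le_trans _ _ (4 * (z ^+ 6 / (x * y)) * (p * q))).
  rewrite -[`|_| * _ * _]mulrA [leLHS]mulrA; apply: ler_wpM2r; first exact: mulr_ge0.
  have -> : 4 * (z ^+ 6 / (x * y)) = z ^+ 8 * (4 / (x * y * z ^+ 2)).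
    by field; rewrite !gt_eqF.
  by apply: ler_wpM2l => //; rewrite exprn_ge0// ltW.
have -> : 256 * (X * p * q + p * (Y * q)) = 4 * (64 * (X + Y)) * (p * q) by ring.
apply: ler_wpM2r => //; first exact: mulr_ge0.
rewrite ler_pM2l//; apply: (@le_trans _ _ (64 * (x ^+ 6 + y ^+ 6) / (x * y))).
  by apply: ler_wpM2r => //; rewrite invr_ge0 mulr_ge0 // ltW.
rewrite -mulrA ler_pM2l//.
have -> : (x ^+ 6 + y ^+ 6) / (x * y) = x ^+ 5 / y + y ^+ 5 / x by field; rewrite !gt_eqF.
have le1 (u v : R) : 1 <= v -> 0 <= u -> u / v <= u.
  by move=> v1 u0; rewrite ler_pdivrMr; [rewrite ler_peMr|lra].
apply: lerD.
  by apply: le_trans hx; apply: le1 => //; rewrite exprn_ge0// ltW.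
by apply: le_trans hy; apply: le1 => //; rewrite exprn_ge0// ltW.
Qed.

End bilinear_operators.

(** * Normal form and solutions in Fourier space *)

Section normal_form.
Variable R : realType.
Local Notation C := R[i].
Variable T : R.
Hypothesis T0 : 0 < T.
Implicit Types (v w y z : R -> int -> C) (a b : int -> C) (k l : int) (t r d e : R).

(** The cubic term left by the integration by parts: B(v', v) + B(v, v') with v' replaced by N(v,
    v). *)
Definition Qop t a : int -> C :=
  fun k => Bop t (Nop t a a) a k + Bop t a (Nop t a a) k.

Let in0 : 0 \in `[0, T].
Proof. by rewrite in_itv/= lexx ltW. Qed.

Definition coef_con v := forall k, ccon 0 T (v ^~ k).
Definition coef_C1 v z := forall k, cC1 0 T (v ^~ k) (z ^~ k).
Definition ubd s r v := forall t, t \in `[0, T] -> bd s r (v t).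

Lemma ubd_le s s' r r' v : (s' <= s)%N -> r <= r' -> ubd s r v -> ubd s' r' v.
Proof. by move=> ss rr h t /h; exact: bd_le. Qed.

Lemma gdom_ge0 r d k l : 0 <= r -> 0 <= d -> 0 <= gdom r d k l.
Proof.
by move=> r0 d0; rewrite /gdom mulr_ge0 ?JV_ge0// !mulr_ge0// ltW// J_gt0.
Qed.

Lemma ccon_gterm m v w k l : coef_con v -> coef_con w ->
  ccon 0 T (fun t => gterm m t (v t) (w t) k l).
Proof.
move=> cv cw; apply: cconM; last exact: cconM.
apply: cconM; first exact: ccon_cst.
have [[_ _] _] := cC1_con (cC1_cis 0 T (- phi R k l) 0).
have [h _] := cC1_con (cC1_cis 0 T (- phi R k l) 0).
by apply: (eq_ccon h) => t _; rewrite addr0.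
Qed.

Lemma ccon_gop m v w r d k : mle m -> coef_con v -> coef_con w -> ubd 2 r v -> ubd 2 d w ->
  ccon 0 T (fun t => gop m t (v t) (w t) k).
Proof.
move=> mok cv cw bv bw; apply: (ccon_csum (asum_gdom r d k)) => [l|l t tT].
  exact: ccon_gterm.
exact: (gterm_dom t k l mok (bv t tT) (bw t tT)).
Qed.

Lemma ccon_Nop v w r d k : coef_con v -> coef_con w -> ubd 2 r v -> ubd 2 d w ->
  ccon 0 T (fun t => Nop t (v t) (w t) k).
Proof.
move=> cv cw bv bw; apply: cconM; first exact: ccon_cst.
by apply: ccon_gop bv bw => //; exact: mN_mle.
Qed.

Lemma ccon_Bop v w r d k : coef_con v -> coef_con w -> ubd 2 r v -> ubd 2 d w ->
  ccon 0 T (fun t => Bop t (v t) (w t) k).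
Proof. by move=> cv cw bv bw; apply: ccon_gop bv bw => //; exact: mB_mle. Qed.

Lemma C1_gterm v z k l : coef_C1 v z ->
  cC1 0 T (fun t => gterm (mB R) t (v t) (v t) k l)
    (fun t => - ii * gterm (mN R) t (v t) (v t) k l +
       (gterm (mB R) t (z t) (v t) k l + gterm (mB R) t (v t) (z t) k l)).
Proof.
move=> C; have h := cC1_cis 0 T (- phi R k l) 0.
apply: (eq_cC1 (cC1M (cC1Z (rc (mB R k l)) h) (cC1M (C l) (C (k - l))))) => t _ /=.
  by rewrite addr0.
rewrite addr0 /gterm -phi_mB rcM rcN; ring.
Qed.

Lemma C1_Bop v z r d k : coef_C1 v z -> ubd 6 r v -> ubd 5 d z ->
  cC1 0 T (fun t => Bop t (v t) (v t) k)
    (fun t => Nop t (v t) (v t) k + (Bop t (z t) (v t) k + Bop t (v t) (z t) k)).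
Proof.
move=> C bv bz.
have {}bv := ubd_le (isT : 2 <= 6)%N (lexx r) bv.
have {}bz := ubd_le (isT : 2 <= 5)%N (lexx d) bz.
have r0 := bd_ge0 (bv _ in0); have d0 := bd_ge0 (bz _ in0).
pose D l := gdom r r k l + (gdom d r k l + gdom r d k l).
have DS : asum D _ := asumD (asum_gdom r r k) (asumD (asum_gdom d r k) (asum_gdom r d k)).
apply: (@eq_cC1 _ 0 T (fun t => csum (gterm (mB R) t (v t) (v t) k))
  (fun t => csum (fun l => - ii * gterm (mN R) t (v t) (v t) k l +
       (gterm (mB R) t (z t) (v t) k l + gterm (mB R) t (v t) (z t) k l)))) => //; last first.
  move=> t tT.
  have c1 := casum_gterm t k (@mN_mle R) (bv t tT) (bv t tT).
  have c2 := casum_gterm t k (@mB_mle R) (bz t tT) (bv t tT).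
  have c3 := casum_gterm t k (@mB_mle R) (bv t tT) (bz t tT).
  have c1' : casum (fun l => - ii * gterm (mN R) t (v t) (v t) k l) (`|8 * J R k * r * r| * 4).
    by apply: (asum_eq _ c1) => l; rewrite mulNr n1N n1_i.
  by rewrite (csumD c1' (casumD c2 c3)) (csumD c2 c3) (csumMl _ c1).
apply: (cC1_csum T0 DS) => [l|l t tT|l t tT]; first exact: C1_gterm.
- apply: le_trans (gterm_dom t k l (@mB_mle R) (bv t tT) (bv t tT)) _.
  by rewrite lerDl addr_ge0 ?gdom_ge0.
- apply: le_trans (n1D _ _) _; rewrite mulNr n1N n1_i; apply: lerD.
    exact: (gterm_dom t k l (@mN_mle R) (bv t tT) (bv t tT)).
  apply: le_trans (n1D _ _) _; apply: lerD.
    exact: (gterm_dom t k l (@mB_mle R) (bz t tT) (bv t tT)).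
  exact: (gterm_dom t k l (@mB_mle R) (bv t tT) (bz t tT)).
Qed.

Lemma coef_C1_con v z : coef_C1 v z -> coef_con v /\ coef_con z.
Proof. by move=> C; split => k; have [] := cC1_con (C k). Qed.

Lemma coef_con_N v r : coef_con v -> ubd 6 r v -> coef_con (fun t => Nop t (v t) (v t)).
Proof.
move=> cv bv k; have {}bv := ubd_le (isT : 2 <= 6)%N (lexx r) bv.
exact: (ccon_Nop k cv cv bv bv).
Qed.

Lemma ubd_N v r : ubd 6 r v -> ubd 5 (Kop R * (r * r)) (fun t => Nop t (v t) (v t)).
Proof. by move=> bv t tT; apply: Nop_bd; exact: bv. Qed.

Lemma coef_con_Q v r : coef_con v -> ubd 6 r v -> coef_con (fun t => Qop t (v t)).
Proof.
move=> cv bv k; have cN := coef_con_N cv bv.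
have bN := ubd_le (isT : 2 <= 5)%N (lexx _) (ubd_N bv).
have {}bv := ubd_le (isT : 2 <= 6)%N (lexx r) bv.
by apply: cconD; [exact: ccon_Bop bN bv|exact: ccon_Bop bv bN].
Qed.

(* The integral of the quadratic term is traded for boundary terms and a cubic
   integral, which costs no derivative. *)
Lemma normal_form v z r d t k : coef_C1 v z -> ubd 6 r v -> ubd 5 d z -> t \in `[0, T] ->
  let y s j := z s j - Nop s (v s) (v s) j in
  cint 0 (fun s => Nop s (v s) (v s) k + (Bop s (y s) (v s) k + Bop s (v s) (y s) k)) t =
  Bop t (v t) (v t) k - Bop 0 (v 0) (v 0) k - cint 0 (fun s => Qop s (v s) k) t.
Proof.
move=> C bv bz tT y; have [cv cz] := coef_C1_con C.
have cB := C1_Bop k C bv bz.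
have cQ := coef_con_Q cv bv k.
rewrite -(cC1_ftc cB tT) -(cintB (proj2 (cC1_con cB)) cQ tT).
apply: eq_cint => s s0t; have sT : s \in `[0, T].
  by move: s0t tT; rewrite !in_itv/= => /andP[-> st] /andP[_]; exact: le_trans.
have b1 := bd_le (isT : 2 <= 5)%N (lexx _) (bz s sT).
have b2 := bd_le (isT : 2 <= 5)%N (lexx _) (ubd_N bv sT).
have b3 := bd_le (isT : 2 <= 6)%N (lexx _) (bv s sT).
rewrite /Bop (gopBl s k (@mB_mle R) b1 b2 b3) (gopBr s k (@mB_mle R) b3 b1 b2).
by rewrite /Qop /Bop; ring.
Qed.

Lemma Qop_bd t a r : bd 6 r a -> bd 8 (2 * Kop R ^+ 2 * r ^+ 3) (Qop t a).
Proof.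
move=> ba; have bN := Nop_bd t ba ba.
have -> : 2 * Kop R ^+ 2 * r ^+ 3 = Kop R * (Kop R * (r * r) * r) + Kop R * (r * (Kop R * (r * r))) by ring.
by apply: bdD; [exact: Bop_bd bN ba|exact: Bop_bd ba bN].
Qed.

(** The first bound controls the boundary terms of the normal form, the second its cubic integral
    over [0, T], where r <= 1 absorbs a spare factor r. The margin 1/128 yields the ratio 1/8 in
    [NFmap_diff]. *)
Definition small r := [/\ 0 <= r, Kop R * r <= 1 / 128 & Kop R ^+ 2 * (T * r) <= 1 / 128].

Lemma small_ge0 r : small r -> 0 <= r. Proof. by case. Qed.

Lemma small_le1 r : small r -> r <= 1.
Proof.
move=> [r0 h _]; have : r <= Kop R * r by rewrite ler_peMl// Kop_ge1.
by move=> ?; lra.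
Qed.

Lemma small_cubic r : small r -> Kop R ^+ 2 * (T * r) * r <= 1 / 128.
Proof.
move=> sr; have [r0 _ h] := sr; apply: le_trans h; rewrite ler_piMr ?small_le1//.
by apply: mulr_ge0; [exact: sqr_ge0|apply: mulr_ge0 => //; exact: ltW].
Qed.

Lemma cint_bd8 (f : R -> int -> C) D t : coef_con f -> ubd 8 D f -> t \in `[0, T] ->
  bd 8 (2 * D * T) (fun k => cint 0 (f ^~ k) t).
Proof.
move=> cf bf tT k.
have -> : 2 * D * T / J R k ^+ 8 = 2 * (D / J R k ^+ 8) * (T - 0) by rewrite subr0; ring.
by apply: (n1_cint_le (cf k) tT) => s sT; exact: bf.
Qed.

Definition NFmap v t k : C :=
  Bop t (v t) (v t) k - Bop 0 (v 0) (v 0) k - cint 0 (fun s => Qop s (v s) k) t.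

Lemma NFmap_bd v r t : small r -> coef_con v -> ubd 6 r v -> t \in `[0, T] ->
  bd 8 (r / 8) (NFmap v t).
Proof.
move=> sr cv bv tT; have [r0 k1 _] := sr; have k2 := small_cubic sr.
have h : bd 8 (Kop R * (r * r) + Kop R * (r * r) + 2 * (2 * Kop R ^+ 2 * r ^+ 3) * T) (NFmap v t).
  apply: bdB; first by apply: bdB; apply: Bop_bd (bv _ _) (bv _ _).
  apply: cint_bd8 => //; first exact: coef_con_Q bv.
  by move=> s sT; apply: Qop_bd; exact: bv.
apply: bd_le h => //.
have := ler_wpM2r r0 k1; have := ler_wpM2r r0 k2.
have -> : Kop R * (r * r) + Kop R * (r * r) + 2 * (2 * Kop R ^+ 2 * r ^+ 3) * T =
  2 * (Kop R * r * r) + 4 * (Kop R ^+ 2 * (T * r) * r * r) by ring.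
by set X := _ * r * r; set Y := Kop R * r * r; lra.
Qed.

Lemma Bop_diff t a b r d i j : (5 <= i)%N -> (5 <= j)%N -> forall a' b' r' d',
  bd i r a -> bd i r' (fun k => a k - a' k) -> bd i r a' -> bd j d b -> bd j d b' ->
  bd j d' (fun k => b k - b' k) ->
  bd 8 (Kop R * (r' * d) + Kop R * (r * d')) (fun k => Bop t a b k - Bop t a' b' k).
Proof.
move=> i5 j5 a' b' r' d' ha haa ha' hb hb' hbb.
have i2 : (2 <= i)%N by exact: leq_trans i5.
have j2 : (2 <= j)%N by exact: leq_trans j5.
have h : bd 8 (Kop R * (r' * d) + Kop R * (r * d'))
    (fun k => Bop t (fun k => a k - a' k) b k + Bop t a' (fun k => b k - b' k) k).
  by apply: bdD; [exact: Bop_bd haa hb|exact: Bop_bd ha' hbb].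
move=> k; have := h k.
have w1 := bd_le i2 (lexx _) ha; have w2 := bd_le i2 (lexx _) ha'.
have w3 := bd_le j2 (lexx _) hb; have w4 := bd_le j2 (lexx _) hb'.
rewrite /Bop (gopBl t k (@mB_mle R) w1 w2 w3) (gopBr t k (@mB_mle R) w2 w3 w4).
by rewrite subrKA.
Qed.

Lemma Nop_diff t a b r d : bd 6 r a -> bd 6 r b -> bd 6 d (fun k => a k - b k) ->
  bd 5 (2 * Kop R * (r * d)) (fun k => Nop t a a k - Nop t b b k).
Proof.
move=> ha hb hab.
have h : bd 5 (Kop R * (d * r) + Kop R * (r * d))
    (fun k => Nop t (fun k => a k - b k) a k + Nop t b (fun k => a k - b k) k).
  by apply: bdD; apply: Nop_bd.
move=> k; have := h k.
have w1 := bd_le (isT : 2 <= 6)%N (lexx _) ha; have w2 := bd_le (isT : 2 <= 6)%N (lexx _) hb.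
rewrite /Nop (gopBl t k (@mN_mle R) w1 w2 w1) (gopBr t k (@mN_mle R) w2 w1 w2).
have -> : Kop R * (d * r) + Kop R * (r * d) = 2 * Kop R * (r * d) by ring.
by rewrite -mulrDr subrKA mulrBr.
Qed.

Lemma Qop_diff t a b r d : bd 6 r a -> bd 6 r b -> bd 6 d (fun k => a k - b k) ->
  bd 8 (6 * Kop R ^+ 2 * (r * r * d)) (fun k => Qop t a k - Qop t b k).
Proof.
move=> ha hb hab; have Na := Nop_bd t ha ha; have Nb := Nop_bd t hb hb.
have Nab := Nop_diff t ha hb hab.
have h1 := Bop_diff t (isT : 5 <= 5)%N (isT : 5 <= 6)%N Na Nab Nb ha hb hab.
have h2 := Bop_diff t (isT : 5 <= 6)%N (isT : 5 <= 5)%N ha hab hb Na Nb Nab.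
have := bdD h1 h2.
have -> : Kop R * (2 * Kop R * (r * d) * r) + Kop R * (Kop R * (r * r) * d) +
  (Kop R * (d * (Kop R * (r * r))) + Kop R * (r * (2 * Kop R * (r * d)))) =
  6 * Kop R ^+ 2 * (r * r * d) by ring.
move=> h k; apply: le_trans (h k); rewrite /Qop.
by rewrite le_eqVlt; apply/orP; left; apply/eqP; congr n1; ring.
Qed.

(** Equal initial values cancel the boundary terms at 0. The boundary terms at t contribute 2/128
    and the cubic integral 12/128, in total less than 1/8. *)
Lemma NFmap_diff v w r d t : small r -> 0 <= d -> coef_con v -> coef_con w ->
  ubd 6 r v -> ubd 6 r w -> (forall k, v 0 k = w 0 k) ->
  ubd 6 d (fun s k => v s k - w s k) -> t \in `[0, T] ->
  bd 8 (d / 8) (fun k => NFmap v t k - NFmap w t k).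
Proof.
move=> sr d0 cv cw bv bw v0 bvw tT.
have [r0 k1 _] := sr; have k2 := small_cubic sr.
have {}v0 : v 0 = w 0 by apply: funext.
have cQv := coef_con_Q cv bv; have cQw := coef_con_Q cw bw.
have h1 := Bop_diff t (isT : 5 <= 6)%N (isT : 5 <= 6)%N (bv t tT) (bvw t tT) (bw t tT) (bv t tT) (bw t tT) (bvw t tT).
have h2 : bd 8 (2 * (6 * Kop R ^+ 2 * (r * r * d)) * T)
    (fun k => cint 0 (fun s => Qop s (v s) k - Qop s (w s) k) t).
  apply: (@cint_bd8 (fun s k => Qop s (v s) k - Qop s (w s) k)) => //.
    by move=> k; apply: cconB; [exact: cQv|exact: cQw].
  by move=> s sT; apply: Qop_diff; [exact: bv|exact: bw|exact: bvw].
have h := bdB h1 h2.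
apply: (@bd_le _ 8 8 (Kop R * (d * r) + Kop R * (r * d) + 2 * (6 * Kop R ^+ 2 * (r * r * d)) * T)) => //.
  have := ler_wpM2r d0 k1; have := ler_wpM2r d0 k2.
  have -> : Kop R * (d * r) + Kop R * (r * d) + 2 * (6 * Kop R ^+ 2 * (r * r * d)) * T =
    2 * (Kop R * r * d) + 12 * (Kop R ^+ 2 * (T * r) * r * d) by ring.
  by set X := _ * r * d; set Y := Kop R * r * d; lra.
move=> k; apply: le_trans (h k); rewrite (cintB (cQv k) (cQw k) tT) /NFmap v0.
have E (x x' c1 c2 c3 : C) : x - c1 - c2 - (x' - c1 - c3) = x - x' - (c2 - c3) by ring.
by rewrite E.
Qed.

Definition NFsol v := coef_C1 v (fun t => Nop t (v t) (v t)).

(** This is [normal_form] with zero defect. *)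
Lemma NFsol_eq v r t k : NFsol v -> ubd 6 r v -> t \in `[0, T] ->
  v t k - v 0 k = NFmap v t k.
Proof.
move=> C bv tT; have [cv cN] := coef_C1_con C.
have bN := ubd_N bv.
have := normal_form k C bv bN tT; rewrite /= -/(NFmap v t k) => <-.
rewrite -(cC1_ftc (C k) tT); apply: eq_cint => s s0t; have sT : s \in `[0, T].
  by move: s0t tT; rewrite !in_itv/= => /andP[-> st] /andP[_]; exact: le_trans.
have b2 := bd_le (isT : 2 <= 5)%N (lexx _) (bN s sT).
have b3 := bd_le (isT : 2 <= 6)%N (lexx _) (bv s sT).
by rewrite /Bop (gopBl s k (@mB_mle R) b2 b2 b3) (gopBr s k (@mB_mle R) b3 b2 b2) !subrr !addr0.
Qed.

Lemma half_pow (c : R) n : c / 2 ^+ n.+1 = c / 2 ^+ n / 2.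
Proof. by rewrite exprS invfM mulrCA mulrC. Qed.

Lemma small_pow (c e : R) : 0 <= c -> 0 < e -> exists n, c / 2 ^+ n <= e.
Proof.
move=> c0 e0; have [n cn] : exists n : nat, c / e <= n%:R.
  by exists (Num.bound (c / e)); apply/ltW; have := archi_boundP (divr_ge0 c0 (ltW e0)).
exists n; rewrite ler_pdivrMr ?exprn_gt0// mulrC -ler_pdivrMr//; apply: le_trans cn _.
by rewrite -natrX ler_nat ltnW// ltn_expl.
Qed.

(** Starting from the trivial bound 2 r, [NFmap_diff] at least halves the difference each time, so
    it is 0. *)
Lemma NFsol_unique v w r : small r -> NFsol v -> NFsol w -> ubd 6 r v -> ubd 6 r w ->
  (forall k, v 0 k = w 0 k) -> forall t k, t \in `[0, T] -> v t k = w t k.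
Proof.
move=> sr Cv Cw bv bw vw0; have [cv _] := coef_C1_con Cv; have [cw _] := coef_C1_con Cw.
have r0 := small_ge0 sr.
have main n : ubd 6 (2 * r / 2 ^+ n) (fun s k => v s k - w s k).
  elim: n => [|n IH].
    by move=> t tT; rewrite expr0 divr1 mulr2n mulrDl mul1r; apply: bdB; [exact: bv|exact: bw].
  move=> t tT.
  have d0 : 0 <= 2 * r / 2 ^+ n by rewrite divr_ge0 ?mulr_ge0 ?exprn_ge0.
  have := NFmap_diff sr d0 cv cw bv bw vw0 IH tT.
  move=> /(@bd_le _ 8 6 _ (2 * r / 2 ^+ n.+1)) h; have {}h : bd 6 (2 * r / 2 ^+ n.+1) (fun k => NFmap v t k - NFmap w t k).
    by apply: h => //; rewrite half_pow; move: d0; set q := _ / _; lra.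
  move=> k; have := h k; rewrite -(NFsol_eq k Cv bv tT) -(NFsol_eq k Cw bw tT) vw0.
  by rewrite opprB addrA subrK.
move=> t k tT; apply/eqP; rewrite -subr_eq0; apply/eqP/n1_le0.
apply/ler_addgt0Pl => e e0; rewrite addr0.
have [n h] := small_pow (mulr_ge0 (ler0n _ 2) r0) e0.
apply: le_trans (main n t tT k) _; apply: le_trans h.
by rewrite ler_piMr// ?divr_ge0 ?mulr_ge0 ?exprn_ge0// invf_le1 ?JX_gt0// JX_ge1.
Qed.

Section existence.
Variables (v0 : int -> C) (r : R).
Hypotheses (sr : small r) (bv0 : bd 6 (r / 2) v0).

Let r0 : 0 <= r. Proof. by case: sr. Qed.

(** With [s.2] the defect of [s.1], this is the integrand converted by [normal_form]: its primitive
    is v0 + [NFmap] of the old curve ([nextv_NF]), and as a primitive the new curve has a known time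
    derivative. *)
Definition nextz (s : (R -> int -> C) * (R -> int -> C)) t k : C :=
  Nop t (s.1 t) (s.1 t) k + (Bop t (s.2 t) (s.1 t) k + Bop t (s.1 t) (s.2 t) k).

Definition nextv s t k : C := v0 k + cint 0 (nextz s ^~ k) t.

Definition next s : (R -> int -> C) * (R -> int -> C) :=
  (nextv s, fun t k => nextz s t k - Nop t (nextv s t) (nextv s t) k).

(* The second component is the defect v' - N(v, v) of the first. *)
Definition iterate n := iter n next
  ((fun=> v0), (fun t k => - Nop t v0 v0 k)).

(** The defect is measured in weight 5 because [Nop] loses one derivative; the bound r on the curves
    does not deteriorate with n. *)
Definition inv n (s : (R -> int -> C) * (R -> int -> C)) : Prop :=
  [/\ forall k, s.1 0 k = v0 k,
      coef_C1 s.1 (fun t k => Nop t (s.1 t) (s.1 t) k + s.2 t k), coef_con s.2,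
      ubd 6 r s.1 & ubd 5 (r / 2 ^+ n) s.2].

Lemma cint0 (f : R -> C) : cint 0 f 0 = 0.
Proof. by rewrite /cint set_itv1 !Rintegral_set1. Qed.

Lemma pow2_ge0 n : 0 <= r / 2 ^+ n.
Proof. by rewrite divr_ge0// exprn_ge0. Qed.

Lemma nextv_NF n s t k : inv n s -> t \in `[0, T] -> nextv s t k = v0 k + NFmap s.1 t k.
Proof.
move=> [i1 i2 i3 i4 i5] tT; rewrite /nextv; congr (_ + _).
have bN := ubd_N i4.
have bz : ubd 5 (Kop R * (r * r) + r / 2 ^+ n) (fun t k => Nop t (s.1 t) (s.1 t) k + s.2 t k).
  by move=> u uT; apply: bdD; [exact: bN|exact: i5].
rewrite /NFmap -(normal_form k i2 i4 bz tT) /=; apply: eq_cint => u _.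
have -> : (fun j => Nop u (s.1 u) (s.1 u) j + s.2 u j - Nop u (s.1 u) (s.1 u) j) = s.2 u.
  by apply: funext => j; rewrite addrC addKr.
by [].
Qed.

Lemma nextz_con n s : inv n s -> coef_con (nextz s).
Proof.
move=> [i1 i2 i3 i4 i5] k; have [c1 _] := coef_C1_con i2.
have b6 := ubd_le (isT : 2 <= 6)%N (lexx _) i4; have b5 := ubd_le (isT : 2 <= 5)%N (lexx _) i5.
apply: cconD; first exact: (coef_con_N c1 i4).
by apply: cconD; [exact: ccon_Bop b5 b6|exact: ccon_Bop b6 b5].
Qed.

Lemma nextv_bd n s : inv n s -> ubd 6 r (nextv s).
Proof.
move=> is_ t tT; have [i1 i2 i3 i4 i5] := is_; have [c1 _] := coef_C1_con i2.
have h := bdD bv0 (bd_le (isT : 6 <= 8)%N (lexx _) (NFmap_bd sr c1 i4 tT)).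
apply: (@bd_le _ 6 6 (r / 2 + r / 8)) => //; first by have := r0; lra.
by move=> k; rewrite (nextv_NF k is_ tT); exact: h.
Qed.

(** With w the new curve, the new defect is N(v, v) - N(w, w) + B(y, v) + B(v, y). It is small
    because v and w are close and y is small: in total 4 [Kop] r <= 4/128 times the previous
    bound. *)
Lemma inv_next n s : inv n s -> ubd 6 (r / 2 ^+ n) (fun t k => nextv s t k - s.1 t k) ->
  inv n.+1 (next s).
Proof.
move=> is_ hd; have [i1 i2 i3 i4 i5] := is_; have [c1 _] := coef_C1_con i2.
have [_ k1 _] := sr.
have cz := nextz_con is_; have bn := nextv_bd is_.
have C' : coef_C1 (nextv s) (nextz s) by move=> k; exact: cC1_int.
have [cn _] := coef_C1_con C'.
have cN' := coef_con_N cn bn.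
split => //=.
- by move=> k; rewrite /nextv cint0 addr0.
- move=> k; apply: (eq_cC1 (C' k)) => // t _.
  by rewrite addrC subrK.
- by move=> k; apply: cconB; [exact: cz|exact: cN'].
- move=> t tT; have q0 := pow2_ge0 n.
  have h1 := Nop_diff t (bn t tT) (i4 t tT) (hd t tT).
  have h2 := Bop_bd t (isT : 5 <= 5)%N (isT : 5 <= 6)%N (i5 t tT) (i4 t tT).
  have h3 := Bop_bd t (isT : 5 <= 6)%N (isT : 5 <= 5)%N (i4 t tT) (i5 t tT).
  have h := bdB (bd_le (isT : 5 <= 8)%N (lexx _) (bdD h2 h3)) h1.
  apply: (@bd_le _ 5 5 (Kop R * (r / 2 ^+ n * r) + Kop R * (r * (r / 2 ^+ n)) + 2 * Kop R * (r * (r / 2 ^+ n)))) => //.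
    rewrite half_pow; set q := r / _ in q0 *.
    have := ler_wpM2r q0 k1.
    have -> : Kop R * (q * r) + Kop R * (r * q) + 2 * Kop R * (r * q) = 4 * (Kop R * r * q) by ring.
    by set X := _ * r * q; lra.
  move=> k; apply: le_trans (h k); rewrite /nextz.
  by rewrite le_eqVlt; apply/orP; left; apply/eqP; congr n1; ring.
Qed.

Lemma iterate_inv n : inv n (iterate n) /\
  ubd 6 (r / 2 ^+ n) (fun t k => (iterate n.+1).1 t k - (iterate n).1 t k).
Proof.
have [_ k1 _] := sr.
have bv0' : bd 6 r v0 by apply: (bd_le _ _ bv0) => //; have := r0; lra.
have i0 : inv 0 (iterate 0).
  have cv : coef_con (fun=> v0) by move=> k; exact: ccon_cst.
  have bv : ubd 6 r (fun=> v0) by [].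
  split => //=.
  - by move=> k; apply: (eq_cC1 (cC1_cst 0 T (v0 k))) => // t _; rewrite addrN.
  - by move=> k; apply: cconN; exact: (coef_con_N cv bv).
  - move=> t tT; apply: bdN; rewrite expr0 divr1.
    apply: bd_le (ubd_N bv tT) => //; rewrite mulrA ler_piMl ?r0//; lra.
elim: n => [|n [IH1 IH2]].
  split => // t tT k; have [i1 i2 i3 i4 i5] := i0; have [c1 _] := coef_C1_con i2.
  rewrite [(iterate 1).1 t k](nextv_NF k i0 tT) addrC addKr.
  apply: (@bd_le _ 8 6 (r / 8)) => //; last exact: (NFmap_bd sr c1 i4 tT).
  by rewrite expr0 divr1; have := r0; lra.
have I1 := inv_next IH1 IH2; split => // t tT k.
have e2 : (iterate n.+2).1 t k = v0 k + NFmap (iterate n.+1).1 t k := nextv_NF k I1 tT.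
have e1 : (iterate n.+1).1 t k = v0 k + NFmap (iterate n).1 t k := nextv_NF k IH1 tT.
have sub (x x' y y' : C) (c : R) : x = x' -> y = y' -> n1 (x' - y') <= c -> n1 (x - y) <= c by move=> -> ->.
apply: (sub _ _ _ _ _ e2 e1).
rewrite opprD addrACA subrr add0r.
have [a1 a2 a3 a4 a5] := I1; have [b1 b2 b3 b4 b5] := IH1.
have [ca _] := coef_C1_con a2; have [cb _] := coef_C1_con b2.
have e0 k' : (next (iterate n)).1 0 k' = (iterate n).1 0 k' by rewrite a1 b1.
have h := NFmap_diff sr (pow2_ge0 n) ca cb a4 b4 e0 IH2 tT.
apply: (bd_le _ _ h) => //; rewrite half_pow.
by have := pow2_ge0 n; set q := r / _; lra.
Qed.

(* If |x_{n+1} - x_n| <= M / 2^n, then x_n - 2 M / 2^n is nondecreasing with the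
   same limit as x_n. *)
Definition gsup (x : nat -> R) M : R := sup (range (fun n => x n - 2 * M / 2 ^+ n)).

Lemma gsup_dist (x : nat -> R) M n : (forall n, `|x n.+1 - x n| <= M / 2 ^+ n) ->
  `|gsup x M - x n| <= 2 * M / 2 ^+ n.
Proof.
move=> hx; have M0 : 0 <= M.
  by have := hx 0%N; rewrite expr0 divr1; apply: le_trans.
have half m : 2 * M / 2 ^+ m = 2 * (M / 2 ^+ m) by rewrite mulrA.
have halfS := half_pow M.
have nd : nondecreasing_seq (fun n => x n - 2 * M / 2 ^+ n).
  apply/nondecreasing_seqP => m; rewrite !half halfS.
  by have := hx m; rewrite ler_norml => /andP[? ?]; lra.
have ni : nonincreasing_seq (fun n => x n + 2 * M / 2 ^+ n).
  apply/nonincreasing_seqP => m; rewrite !half halfS.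
  by have := hx m; rewrite ler_norml => /andP[? ?]; lra.
have p m : 0 <= 2 * M / 2 ^+ m by rewrite divr_ge0 ?mulr_ge0 ?exprn_ge0.
have ub m : ubound (range (fun n => x n - 2 * M / 2 ^+ n)) (x m + 2 * M / 2 ^+ m).
  move=> _ [j _ <-]; have [jm|/ltnW mj] := leqP j m.
    by apply: le_trans (nd _ _ jm) _; have := p m; lra.
  by apply: le_trans (ni _ _ mj); have := p j; lra.
have ne : range (fun n => x n - 2 * M / 2 ^+ n) !=set0 by eexists; exists n.
have h1 : gsup x M <= x n + 2 * M / 2 ^+ n by apply: ge_sup => //; exact: ub.
have h2 : x n - 2 * M / 2 ^+ n <= gsup x M.
  by apply: ub_le_sup; [exists (x n + 2 * M / 2 ^+ n); exact: ub|exists n].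
by rewrite ler_norml; apply/andP; split; lra.
Qed.

Definition vlim t k : C :=
  Complex (gsup (fun n => complex.Re ((iterate n).1 t k)) (r / J R k ^+ 6))
          (gsup (fun n => complex.Im ((iterate n).1 t k)) (r / J R k ^+ 6)).

Lemma vlim_dist n : ubd 6 (4 * r / 2 ^+ n) (fun t k => vlim t k - (iterate n).1 t k).
Proof.
move=> t tT k.
have h m : n1 ((iterate m.+1).1 t k - (iterate m).1 t k) <= r / J R k ^+ 6 / 2 ^+ m.
  by rewrite mulrAC; apply: (proj2 (iterate_inv m)).
rewrite /n1 !cE /vlim /=.
have -> : 4 * r / 2 ^+ n / J R k ^+ 6 = 2 * (r / J R k ^+ 6) / 2 ^+ n + 2 * (r / J R k ^+ 6) / 2 ^+ n by ring.
apply: lerD; apply: (@gsup_dist (fun n => _ ((iterate n).1 t k))) => m; apply: le_trans (h m).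
  by apply: le_trans (norm_Re _); rewrite !cE.
by apply: le_trans (norm_Im _); rewrite !cE.
Qed.

Lemma vlim_bd : ubd 6 (5 * r) vlim.
Proof.
move=> t tT; have [[_ _ _ h _] _] := iterate_inv 0.
have := bdD (vlim_dist 0 tT) (h t tT); rewrite expr0 divr1.
have -> : 4 * r + r = 5 * r by ring.
by move=> h' k; have := h' k; rewrite subrK.
Qed.

(** Curves and derivatives converge uniformly: the derivative of an iterate is N plus a defect of
    size r / 2^n, and N is Lipschitz from weight 6 to weight 5 on bounded sets. *)
Lemma vlim_sol : small (5 * r) -> NFsol vlim.
Proof.
move=> s5 k; have [_ k1 _] := s5.
apply: cC1_unif => // e e0.
have [n hn] := small_pow (mulr_ge0 (ler0n _ 5) r0) e0.
have [[i1 i2 i3 i4 i5] _] := iterate_inv n.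
exists ((iterate n).1 ^~ k), (fun t => Nop t ((iterate n).1 t) ((iterate n).1 t) k + (iterate n).2 t k).
split; first exact: i2.
have drop s M : 0 <= M -> M / J R k ^+ s <= M.
  by move=> M0; rewrite ler_piMr// invf_le1 ?JX_gt0// JX_ge1.
have q0 := pow2_ge0 n.
move=> t tT; split.
  apply: le_trans (vlim_dist n tT k) _; apply: le_trans (drop _ _ _) _.
    by rewrite -mulrA; apply: mulr_ge0.
  by apply: le_trans hn; rewrite -!mulrA; apply: ler_wpM2r => //; rewrite ler_nat.
have b5 := bd_le (leqnn 6) (_ : r <= 5 * r) (i4 t tT).
have {}b5 : bd 6 (5 * r) ((iterate n).1 t) by apply: b5; have := r0; lra.
have h := bdB (Nop_diff t (vlim_bd tT) b5 (vlim_dist n tT)) (i5 t tT).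
apply: le_trans (le_trans (drop 5 (2 * Kop R * (5 * r * (4 * r / 2 ^+ n)) + r / 2 ^+ n) _) _).
- by have := h k; rewrite opprD addrA.
- have p : 0 <= 4 * r / 2 ^+ n by rewrite -mulrA; apply: mulr_ge0.
  apply: addr_ge0 => //; apply: mulr_ge0; first by apply: mulr_ge0 => //; exact: Kop_ge0.
  by apply: mulr_ge0 => //; exact: mulr_ge0.
apply: le_trans hn.
have -> : 2 * Kop R * (5 * r * (4 * r / 2 ^+ n)) = 8 * (Kop R * (5 * r) * (r / 2 ^+ n)) by ring.
rewrite -[5 * r / _]mulrA; set q := r / _ in q0 *.
by have := ler_wpM2r q0 k1; set X := _ * q; lra.
Qed.

Lemma vlim0 k : vlim 0 k = v0 k.
Proof.
apply/eqP; rewrite -subr_eq0; apply/eqP/n1_le0.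
apply/ler_addgt0Pl => e e0; rewrite addr0.
have [n h] := small_pow (mulr_ge0 (ler0n _ 4) r0) e0.
have [[i1 _ _ _ _] _] := iterate_inv n.
have := vlim_dist n in0 k; rewrite i1 => /le_trans; apply; apply: le_trans h.
by rewrite ler_piMr// ?divr_ge0 ?mulr_ge0 ?exprn_ge0// invf_le1 ?JX_gt0// JX_ge1.
Qed.

End existence.

(** The initial iterate is bounded by r and the limit lies within 4 r of it, hence 5 r. Data within
    r / 2 leave room for the increment r / 8 of [NFmap_bd]. *)
Lemma NFsol_exists (v0 : int -> C) r : small (5 * r) -> bd 6 (r / 2) v0 ->
  exists v, [/\ NFsol v, forall k, v 0 k = v0 k & ubd 6 (5 * r) v].
Proof.
move=> s5 bv0; have sr : small r.
  have [h1 h2 h3] := s5; have r0 : 0 <= r by lra.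
  have r5 : r <= 5 * r by lra.
  split => //; [apply: le_trans h2|apply: le_trans h3]; apply: ler_wpM2l; rewrite ?sqr_ge0 ?Kop_ge0//.
  by apply: ler_wpM2l => //; exact: ltW.
exists (vlim v0 r); split; [exact: vlim_sol|exact: vlim0|exact: vlim_bd].
Qed.

End normal_form.

(** * Square-summable bounds and the continuity method *)

Section square_sums.
Variable R : realType.
Local Notation C := R[i].
Local Notation mu := (@lebesgue_measure R).
Implicit Types (a b : int -> C) (k l : int) (t r al be D : R).

Lemma hsD s al be a b : 0 <= al -> 0 <= be -> hs s al a -> hs s be b ->
  hs s (2 * (al + be)) (fun k => a k + b k).
Proof.
move=> al0 be0 ha hb; apply: asum_nneg => [k|n]; first exact: sqr_ge0.
apply: (@le_trans _ _ (psum (fun k => 2 * (J R k ^+ s * n1 (a k)) ^+ 2 + 2 * (J R k ^+ s * n1 (b k)) ^+ 2) n)).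
  apply: le_psum => k; set x := J R k ^+ s.
  have x0 : 0 <= x by rewrite ltW// JX_gt0.
  apply: (@le_trans _ _ ((x * n1 (a k) + x * n1 (b k)) ^+ 2)).
    apply: lerXn2r; rewrite ?nnegrE; [by apply: mulr_ge0; rewrite ?n1_ge0|by rewrite -mulrDr mulr_ge0// addr_ge0 ?n1_ge0|].
    by rewrite -mulrDr; apply: ler_wpM2l => //; exact: n1D.
  by set y := x * n1 (a k); set z := x * _; have := sqr_ge0 (y - z); nra.
rewrite psumD !psumZ.
have h (c : int -> R) M : (forall k, 0 <= c k) -> asum c M -> psum c n <= M.
  by move=> c0 /(_ n); apply: le_trans; apply: le_psum => k; exact: ler_norm.
have := h _ _ (fun k => sqr_ge0 _) ha; have := h _ _ (fun k => sqr_ge0 _) hb.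
by set X := psum _ n; set Y := psum _ n => ? ?; nra.
Qed.

Lemma hsN s al a : hs s al a -> hs s al (fun k => - a k).
Proof. by apply: asum_eq => k; rewrite n1N. Qed.

Lemma hsB s al be a b : 0 <= al -> 0 <= be -> hs s al a -> hs s be b ->
  hs s (2 * (al + be)) (fun k => a k - b k).
Proof. by move=> al0 be0 ha hb; apply: hsD => //; exact: hsN. Qed.

(** Two weights buy square summability; the constant 2 is the root of the bound in [asum_J2]. *)
Lemma bd_hs s al a : bd s.+2 al a -> hs s (2 * al) a.
Proof.
move=> h; have al0 := bd_ge0 h.
rewrite /hs; have -> : (2 * al) ^+ 2 = `|al ^+ 2| * 4 by rewrite ger0_norm ?sqr_ge0//; ring.
apply: asum_dom (asumZ _ (asum_J2 R)) => k; rewrite ger0_norm ?sqr_ge0//.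
have p : J R k ^+ s * n1 (a k) <= al / J R k.
  apply: (@le_trans _ _ (J R k ^+ s * (al / J R k ^+ s.+2))).
    by apply: ler_wpM2l; [rewrite ltW// JX_gt0|exact: h].
  have -> : J R k ^+ s * (al / J R k ^+ s.+2) = al / (J R k * J R k).
    by move: (J_neq0 R k); rewrite 2!exprS; set x := J R k; move=> x0; have := expf_neq0 s x0; set y := x ^+ s => y0; field; do ?[apply/andP; split].
  apply: ler_wpM2l => //; rewrite invfM; apply: ler_piMr.
    by rewrite invr_ge0 ltW ?J_gt0.
  by rewrite invf_le1 ?J_gt0 ?J_ge1.
have -> : al ^+ 2 / J R k ^+ 2 = (al / J R k) ^+ 2 by rewrite exprMn exprVn.
apply: lerXn2r => //; rewrite nnegrE; first by rewrite mulr_ge0 ?n1_ge0// ltW// JX_gt0.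
by rewrite divr_ge0// ltW// J_gt0.
Qed.

(** Expand the nonnegative integral of (t g - x)^2, with x the integral of g. *)
Lemma int_CS (g : R -> R) t : 0 < t -> con 0 t g ->
  (\int[mu]_(s in `[0, t]) g s) ^+ 2 <= t * \int[mu]_(s in `[0, t]) (g s ^+ 2).
Proof.
move=> t0 cg; set x := \int[mu]_(s in _) g s.
have cg2 : con 0 t (fun s => g s ^+ 2) by apply: (con_eq (conM cg cg)) => s _; rewrite expr2.
have cst_int (c : R) : \int[mu]_(s in `[0, t]) c = c * t.
  by rewrite Rintegral_cst//= lebesgue_measure_itv/= lte_fin t0 -EFinB subr0.
have : 0 <= \int[mu]_(s in `[0, t]) ((t * g s - x) ^+ 2).
  by apply: Rintegral_ge0 => s _; exact: sqr_ge0.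
have E s : (t * g s - x) ^+ 2 = t ^+ 2 * g s ^+ 2 - (2 * t * x) * g s + x ^+ 2 by ring.
have i1 := con_integrable cg; have i2 := con_integrable cg2.
have c1 : con 0 t (fun s => t ^+ 2 * g s ^+ 2) by apply: conM => //; exact: con_cst.
have c2 : con 0 t (fun s => (2 * t * x) * g s) by apply: conM => //; exact: con_cst.
under eq_Rintegral do rewrite E.
rewrite RintegralD//; [|exact: (con_integrable (conB c1 c2))|by have := @con_integrable _ 0 t (cst (x ^+ 2)); apply; exact: con_cst].
rewrite RintegralB//; [|exact: con_integrable..].
rewrite RintegralZl// RintegralZl// cst_int -/x.
set I := \int[mu]_(s in _) _ => h.
have : 0 <= t * (t * I - x ^+ 2) by nra.
by rewrite pmulr_rge0// subr_ge0.
Qed.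

Lemma int_psum (F : int -> R -> R) t n : (forall k, con 0 t (F k)) ->
  psum (fun k => \int[mu]_(s in `[0, t]) F k s) n = \int[mu]_(s in `[0, t]) psum (F ^~ s) n.
Proof.
move=> cF; elim: n => [|n IH].
  by rewrite psum0; apply: eq_Rintegral => s _; rewrite psum0.
have c := @con_psum _ 0 t F n cF.
rewrite psumS IH -RintegralD//; [|exact: con_integrable..].
rewrite -RintegralD//; [|exact: (con_integrable (conD (cF _) c))|exact: con_integrable].
by apply: eq_Rintegral => s _; rewrite psumS.
Qed.

(** Cauchy-Schwarz in time takes the place of Minkowski's integral inequality. Only the finite sums
    in [asum] have to commute with the integral. *)
Lemma hs_cint s (f : R -> int -> C) D T t : 0 < T -> coef_con T f -> t \in `[0, T] ->
  (forall u, u \in `[0, T] -> hs s D (f u)) -> 0 <= D ->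
  hs s (2 * T * D) (fun k => cint 0 (f ^~ k) t).
Proof.
move=> T0 cf tT hf D0; have := tT; rewrite in_itv/= => /andP[].
rewrite le_eqVlt => /predU1P[<- _|t0 tT'].
  have -> : (fun k => cint 0 (f ^~ k) 0) = (fun=> 0 : C).
    by apply: funext => k; rewrite /cint set_itv1 !Rintegral_set1.
  apply: asum_nneg => [k|n]; first exact: sqr_ge0.
  under eq_psum do rewrite n1_0 mulr0 expr0n /=.
  by rewrite psum_eq0 sqr_ge0.
have sub : `[0, t] `<=` `[0, T] by exact: subset_itvl.
have cre k : con 0 t (fun u => complex.Re (f u k)) by apply: con_sub sub; have [] := cf k.
have cim k : con 0 t (fun u => complex.Im (f u k)) by apply: con_sub sub; have [] := cf k.
pose G k u := (J R k ^+ s * n1 (f u k)) ^+ 2.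
have cG k : con 0 t (G k).
  have c : con 0 t (fun u => J R k ^+ s * n1 (f u k)).
    apply: conM; [exact: con_cst|apply: conD; exact: con_norm].
  by apply: (con_eq (conM c c)) => u _; rewrite /G expr2.
apply: asum_nneg => [k|n]; first exact: sqr_ge0.
apply: (@le_trans _ _ (psum (fun k => (4 * t) * \int[mu]_(u in `[0, t]) G k u) n)).
  apply: le_psum => k.
  have cc (g : R -> R) : con 0 t g -> (forall u, `|g u| <= n1 (f u k)) ->
      (J R k ^+ s) ^+ 2 * (\int[mu]_(u in `[0, t]) g u) ^+ 2 <= t * \int[mu]_(u in `[0, t]) G k u.
    move=> cg gn; have cg2 : con 0 t (fun s => g s ^+ 2).
      by apply: (con_eq (conM cg cg)) => u _; rewrite expr2.
    apply: (@le_trans _ _ ((J R k ^+ s) ^+ 2 * (t * \int[mu]_(u in `[0, t]) (g u ^+ 2)))).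
      by apply: ler_wpM2l; [exact: sqr_ge0|exact: int_CS].
    rewrite mulrCA ler_pM2l// -RintegralZl//; last exact: con_integrable.
    apply: le_Rintegral => //; [|exact: con_integrable|].
      by apply: con_integrable; apply: conM => //; exact: con_cst.
    move=> u _; rewrite /G exprMn; apply: ler_wpM2l; first exact: sqr_ge0.
    by rewrite -(real_normK (num_real (g u))); apply: lerXn2r; rewrite ?nnegrE ?n1_ge0.
  have h1 := cc _ (cre k) (fun u => norm_Re _); have h2 := cc _ (cim k) (fun u => norm_Im _).
  rewrite exprMn /n1 /=; set w := (J R k ^+ s) ^+ 2 in h1 h2 *.
  set x := Rintegral _ _ _ in h1 *; set y := Rintegral _ _ _ in h2 *.
  have w0 : 0 <= w by exact: sqr_ge0.
  apply: (@le_trans _ _ (w * (2 * (x ^+ 2 + y ^+ 2)))); last first.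
    have gen (W X Y Z : R) : W * X <= Z -> W * Y <= Z -> W * (2 * (X + Y)) <= 4 * Z by lra.
    by rewrite -[leRHS]mulrA; exact: gen.
  apply: ler_wpM2l => //; rewrite -(real_normK (num_real x)) -(real_normK (num_real y)).
  by set p := `|x|; set q := `|y|; have := sqr_ge0 (p - q); nra.
rewrite psumZ int_psum//.
have -> : (2 * T * D) ^+ 2 = (4 * T) * (D ^+ 2 * T) by ring.
have h : \int[mu]_(u in `[0, t]) psum (G ^~ u) n <= D ^+ 2 * T.
  apply: (@le_trans _ _ (D ^+ 2 * (t - 0))); last by rewrite subr0; apply: ler_wpM2l => //; exact: sqr_ge0.
  apply: le_trans (ler_norm _) _; apply: le_abs_int; [exact: ltW|exact: con_psum|].
  move=> u ut; apply: le_trans (norm_psum _ _) _; exact: (hf u (sub _ ut)).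
apply: ler_pM => //; first by rewrite mulr_ge0// ltW.
- by apply: Rintegral_ge0 => u _; apply: psum_ge0 => k; exact: sqr_ge0.
- by rewrite ler_pM2l.
Qed.

(** The source of the quadratic estimate: the boundary terms are quadratic, and al <= 1 makes the
    cubic integral so. The numbers 8 and 16 collect the factors 2 of [hsD], [hsB] and [hs_cint]. *)
Lemma NFmap_hs T v al t r : 0 < T -> 0 <= al -> al <= 1 -> coef_con T v -> ubd T 6 r v ->
  (forall u, u \in `[0, T] -> hs 6 al (v u)) -> t \in `[0, T] ->
  hs 8 ((8 * Kop R + 16 * T * Kop R ^+ 2) * al ^+ 2) (NFmap v t).
Proof.
move=> T0 al0 al1 cv bv hv tT; have K0 := Kop_ge0 R.
have in0 : 0 \in `[0, T] by rewrite in_itv/= lexx ltW.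
have hB u : u \in `[0, T] -> hs 8 (Kop R * (al * al)) (Bop u (v u) (v u)).
  by move=> uT; apply: (Bop_hs _ al0 al0 _ _ (hv u uT) (hv u uT)).
have K2 : 0 <= Kop R * (al * al) by rewrite !mulr_ge0.
have hQ u : u \in `[0, T] -> hs 8 (4 * (Kop R * (Kop R * (al * al) * al))) (Qop u (v u)).
  move=> uT; have hN := Nop_hs u al0 al0 (hv u uT) (hv u uT).
  have h1 := Bop_hs u K2 al0 (isT : 5 <= 5 <= 6)%N (isT : 5 <= 6 <= 6)%N hN (hv u uT).
  have h2 := Bop_hs u al0 K2 (isT : 5 <= 6 <= 6)%N (isT : 5 <= 5 <= 6)%N (hv u uT) hN.
  have K3 : 0 <= Kop R * (Kop R * (al * al) * al) by rewrite !mulr_ge0.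
  have K3' : 0 <= Kop R * (al * (Kop R * (al * al))) by rewrite !mulr_ge0.
  have -> : 4 * (Kop R * (Kop R * (al * al) * al)) =
    2 * (Kop R * (Kop R * (al * al) * al) + Kop R * (al * (Kop R * (al * al)))) by ring.
  exact: hsD.
have K4 : 0 <= 4 * (Kop R * (Kop R * (al * al) * al)) by rewrite !mulr_ge0.
have cQ := coef_con_Q cv bv.
have hI := hs_cint T0 cQ tT hQ K4.
have h := hsB _ _ (hsB K2 K2 (hB t tT) (hB 0 in0)) hI.
apply: (hs_le _ _ (h _ _)).
- by rewrite !(mulr_ge0, addr_ge0)// ltW.
- have : Kop R ^+ 2 * T * al ^+ 2 * al <= Kop R ^+ 2 * T * al ^+ 2.
    by rewrite ler_piMr// !mulr_ge0 ?sqr_ge0// ltW.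
  set X := Kop R ^+ 2 * T * al ^+ 2; set Y := Kop R * al ^+ 2.
  have -> : 2 * (2 * (Kop R * (al * al) + Kop R * (al * al)) + 2 * T * (4 * (Kop R * (Kop R * (al * al) * al)))) =
    8 * Y + 16 * (X * al) by rewrite /X /Y; ring.
  have -> : (8 * Kop R + 16 * T * Kop R ^+ 2) * al ^+ 2 = 8 * Y + 16 * X by rewrite /X /Y; ring.
  lra.
- by rewrite !(mulr_ge0, addr_ge0).
- by rewrite !mulr_ge0// ltW.
Qed.

End square_sums.

(** * The rotating frame *)

Section phases.
Variable R : realType.
Local Notation C := R[i].
Variables (T om : R).
Hypothesis T0 : 0 < T.
Implicit Types (u v : R -> int -> C) (a b : int -> C) (k l : int) (t r s e : R).

Definition theta k : R := k%:~R ^+ 5 + om * k%:~R.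

Definition vof u t k : C := cis (- theta k * t) * u t k.

Lemma phi_theta k l : phi R k l = theta k - theta l - theta (k - l).
Proof. by rewrite /phi /theta intrB; ring. Qed.

Lemma uofK u t k : cis (theta k * t) * vof u t k = u t k.
Proof. by rewrite /vof mulrA -[theta k * t]opprK -mulNr cisNK mul1r. Qed.

(** By [phi_theta] the three phases combine. The linear part of [theta] drops out of [phi], so the
    normal form does not see the frequency shift due to the mean. *)
Lemma gterm_vof m u t k l :
  gterm m t (vof u t) (vof u t) k l = cis (- theta k * t) * gterm m 0 (u t) (u t) k l.
Proof.
have -> : - theta k * t = - phi R k l * t + (- theta l * t + - theta (k - l) * t).
  by rewrite phi_theta; ring.
rewrite /gterm /vof mulr0 cis0 !cisD; ring.
Qed.

Lemma Nop_vof u t al k : bd 2 al (u t) ->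
  Nop t (vof u t) (vof u t) k = cis (- theta k * t) * Nop 0 (u t) (u t) k.
Proof.
move=> hb; rewrite /Nop /gop mulrCA -(csumMl _ (casum_gterm 0 k (@mN_mle R) hb hb)).
by congr (_ * _); apply: eq_csum => l; rewrite gterm_vof.
Qed.

Lemma vof_bd u t (s : nat) al : bd s al (u t) -> bd s (2 * al) (vof u t).
Proof.
move=> h k; apply: le_trans (n1M _ _) _; rewrite -mulrA.
by apply: ler_pM; rewrite ?n1_ge0 ?n1_cis.
Qed.

Lemma uof_bd u t (s : nat) al : bd s al (vof u t) -> bd s (2 * al) (u t).
Proof.
move=> h k; rewrite -uofK; apply: le_trans (n1M _ _) _; rewrite -mulrA.
by apply: ler_pM; rewrite ?n1_ge0 ?n1_cis.
Qed.

Definition coef_sol u := coef_C1 T u (fun t k => ii * rc (theta k) * u t k + Nop 0 (u t) (u t) k).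

Lemma coef_sol_NF u r : coef_sol u -> ubd T 2 r u -> NFsol T (vof u).
Proof.
move=> C bu k; have h := cC1_cis 0 T (- theta k) 0.
apply: (eq_cC1 (cC1M h (C k))) => t tT; first by rewrite addr0.
rewrite (Nop_vof k (bu t tT)) addr0 rcN; ring.
Qed.

Lemma NF_coef_sol u r : NFsol T (vof u) -> ubd T 2 r u -> coef_sol u.
Proof.
move=> C bu k; have h := cC1_cis 0 T (theta k) 0.
apply: (eq_cC1 (cC1M h (C k))) => t tT; first by rewrite addr0 uofK.
rewrite (Nop_vof k (bu t tT)) addr0 -mulrA uofK mulrA.
by rewrite -[theta k * t]opprK -mulNr cisNK mul1r.
Qed.

(** Continuity in weight 6, uniform in k, which continuity of each coefficient does not give; the
    continuity method rests on it. *)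
Definition bd_cont u := forall t e, t \in `[0, T] -> 0 < e -> exists2 d, 0 < d &
  forall s, s \in `[0, T] -> `|s - t| < d -> bd 6 e (fun k => u s k - u t k).

End phases.

Lemma NFsol_sub (R : realType) (T t : R) v : t <= T -> NFsol T v -> NFsol t v.
Proof. by move=> tT C k; have [c1 c2] := C k; split; [exact: C1_sub c1 _ _|exact: C1_sub c2 _ _]. Qed.

Lemma small_sub (R : realType) (T t r : R) : 0 <= t -> t <= T -> small T r -> small t r.
Proof.
move=> t0 tT [r0 h1 h2]; split => //; apply: le_trans h2.
by apply: ler_wpM2l; [exact: sqr_ge0|exact: ler_wpM2r].
Qed.

Section bootstrap.
Variable R : realType.
Local Notation C := R[i].
Variables (T om : R).
Hypothesis T0 : 0 < T.
Implicit Types (u v : R -> int -> C).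

(* Continuity method: a bound by sg on [0, t] improves itself to 3/4 sg. *)
Lemma bootstrap u sg : 0 < sg -> small T (2 * sg) -> NFsol T (vof om u) -> bd_cont T u ->
  bd 6 (sg / 32) (u 0) -> ubd T 6 sg u.
Proof.
move=> sg0 sT Cu cu u0.
have improve t : t \in `[0, T] -> (forall s, s \in `[0, t] -> bd 6 sg (u s)) ->
    bd 6 (3 / 4 * sg) (u t).
  rewrite in_itv/= => /andP[]; rewrite le_eqVlt => /predU1P[<- _ _|t0 tT h].
    by apply: bd_le u0 => //; lra.
  have C := NFsol_sub tT Cu; have st := small_sub (ltW t0) tT sT.
  have bv : ubd t 6 (2 * sg) (vof om u) by move=> s /h; exact: vof_bd.
  have tt : t \in `[0, t] by rewrite in_itv/= lexx ltW.
  have [cv _] := coef_C1_con C.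
  have h1 := bd_le (isT : 6 <= 8)%N (lexx _) (NFmap_bd t0 st cv bv tt).
  have v0 : bd 6 (sg / 32) (vof om u 0).
    by move=> k; rewrite /vof mulr0 cis0 mul1r; exact: u0.
  (* 2 (1/32 + 2/8) = 9/16 is below 3/4; each change of frame costs a factor 2. *)
  apply: (@bd_le _ 6 6 (2 * (sg / 32 + 2 * sg / 8))) => //; first by lra.
  apply: (uof_bd (om := om)) => k; have := bdD v0 h1 k.
  by rewrite -(NFsol_eq t0 k C bv tt) addrC subrK.
pose S := [set t : R | t \in `[0, T] /\ forall s, s \in `[0, t] -> bd 6 sg (u s)].
have S0 : S 0.
  split; first by rewrite in_itv/= lexx ltW.
  move=> s; rewrite in_itv/= => s0; have -> : s = 0 by apply/eqP; rewrite eq_le andbC.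
  by apply: bd_le u0 => //; lra.
have Sub : has_sup S.
  split; first by exists 0.
  by exists T => t [+ _]; rewrite in_itv/= => /andP[].
have tau0 : 0 <= sup S by apply: ub_le_sup => //; exact: (proj2 Sub).
have tauT : sup S <= T.
  by apply: ge_sup; [exists 0|move=> t [+ _]; rewrite in_itv/= => /andP[]].
have tauI : sup S \in `[0, T] by rewrite in_itv/= tau0.
have sg8 : 0 < sg / 8 by rewrite divr_gt0.
have [d d0 hd] := cu _ _ tauI sg8.
have [s1 [s1I hs1] s1d] := sup_adherent d0 Sub.
have s1le : s1 <= sup S by apply: ub_le_sup; [exact: (proj2 Sub)|split].
have near s : s \in `[0, T] -> `|s - sup S| < d -> bd 6 sg (u s).
  (* 3/4 comes from [improve] at s1, and 1/8 from each of the jumps between s1, the supremum and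
     s. *)
  move=> sI sd; apply: (@bd_le _ 6 6 (3 / 4 * sg + sg / 8 + sg / 8)) => //; first by lra.
  have b1 := improve _ s1I hs1.
  have b2 := hd s1 s1I; have {}b2 : bd 6 (sg / 8) (fun k => u s1 k - u (sup S) k).
    by apply: b2; rewrite ltr_norml; apply/andP; split; lra.
  have b3 := hd s sI sd.
  move=> k; have := bdD (bdB b1 b2) b3 k.
  have E (x y z : C) : x - (x - y) + (z - y) = z by ring.
  by rewrite E.
have full t : t \in `[0, T] -> t < sup S + d -> S t.
  rewrite in_itv/= => /andP[t0 tT] td; split; first by rewrite in_itv/= t0.
  move=> s; rewrite in_itv/= => /andP[s0 st].
  have [ss1|s1s] := leP s s1; first by apply: hs1; rewrite in_itv/= s0.
  apply: near; first by rewrite in_itv/= s0 (le_trans st).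
  by rewrite ltr_norml; apply/andP; split; lra.
have TS : sup S = T.
  apply/eqP; rewrite eq_le tauT leNgt; apply/negP => lt.
  pose t := Num.min T (sup S + d / 2).
  have tI : t \in `[0, T].
    rewrite in_itv/= ge_min lexx /= le_min (ltW T0) addr_ge0//; lra.
  have : S t by apply: full => //; rewrite gt_min; apply/orP; right; lra.
  move=> /(ub_le_sup (proj2 Sub)); rewrite leNgt => /negP; apply.
  by rewrite lt_min lt; lra.
move=> t tI; have [_] : S t.
  by apply: full => //; move: tI; rewrite in_itv/= TS => /andP[_ ?]; lra.
by apply; move: tI; rewrite !in_itv/= lexx => /andP[->].
Qed.

End bootstrap.

(** * Fourier series *)

Section fourier_uniqueness.
Variable R : realType.
Local Notation mu := (@lebesgue_measure R).
Implicit Types (f g h : R -> R) (k l : int) (x y : R).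

Definition itg f : Prop := mu.-integrable `[0, 2 * pi] (EFin \o f).

Lemma itgMl f g (M : R) : itg f -> continuous g -> (forall x, `|g x| <= M) -> itg (fun x => f x * g x).
Proof.
move=> fi cg gM; apply: (@integrableMl _ _ _ mu `[0, 2 * pi] _ (EFin \o f) g) => //.
  by apply: measurable_funTS; exact: continuous_measurable_fun.
exists M; split; first exact: num_real.
by move=> y My x _ /=; apply: le_trans (gM x) _; exact: ltW.
Qed.

(** The span of the modes; [trigM] shows that it is an algebra, which is how the powers in [bump]
    belong to it. *)
Inductive trig : (R -> R) -> Prop :=
| trig_cos k : trig (fun x => cos (k%:~R * x))
| trig_sin k : trig (fun x => sin (k%:~R * x))
| trigD f g : trig f -> trig g -> trig (fun x => f x + g x)
| trigZ c f : trig f -> trig (fun x => c * f x)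
| trig_eq f g : trig f -> (forall x, f x = g x) -> trig g.

Lemma trig_cst c : trig (fun=> c).
Proof.
apply: (trig_eq (trigZ c (trig_cos 0))) => x.
by rewrite mulr0z mul0r cos0 mulr1.
Qed.

Lemma trig_mul_cos k f : trig f -> trig (fun x => f x * cos (k%:~R * x)).
Proof.
elim=> {f} [l|l|f g _ Hf _ Hg|c f _ Hf|f g _ Hf fg].
- apply: (trig_eq (trigZ (1/2) (trigD (trig_cos (l + k)) (trig_cos (l - k))))) => x.
  by rewrite intrB intrD mulrBl mulrDl cosD cosB; field.
- apply: (trig_eq (trigZ (1/2) (trigD (trig_sin (l + k)) (trig_sin (l - k))))) => x.
  by rewrite intrB intrD mulrBl mulrDl sinD sinB; field.
- by apply: (trig_eq (trigD Hf Hg)) => x; rewrite mulrDl.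
- by apply: (trig_eq (trigZ c Hf)) => x; rewrite mulrA.
- by apply: (trig_eq Hf) => x; rewrite fg.
Qed.

Lemma trig_mul_sin k f : trig f -> trig (fun x => f x * sin (k%:~R * x)).
Proof.
elim=> {f} [l|l|f g _ Hf _ Hg|c f _ Hf|f g _ Hf fg].
- apply: (trig_eq (trigZ (1/2) (trigD (trig_sin (l + k)) (trigZ (-1) (trig_sin (l - k)))))) => x.
  by rewrite intrB intrD mulrBl mulrDl sinD sinB; field.
- apply: (trig_eq (trigZ (1/2) (trigD (trig_cos (l - k)) (trigZ (-1) (trig_cos (l + k)))))) => x /=.
  by rewrite intrB intrD mulrBl mulrDl cosB cosD; field.
- by apply: (trig_eq (trigD Hf Hg)) => x; rewrite mulrDl.
- by apply: (trig_eq (trigZ c Hf)) => x; rewrite mulrA.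
- by apply: (trig_eq Hf) => x; rewrite fg.
Qed.

Lemma trigM f g : trig f -> trig g -> trig (fun x => f x * g x).
Proof.
move=> tf; elim=> {g} [l|l|g h _ Hg _ Hh|c g _ Hg|g h _ Hg gh].
- exact: trig_mul_cos.
- exact: trig_mul_sin.
- by apply: (trig_eq (trigD Hg Hh)) => x; rewrite mulrDr.
- by apply: (trig_eq (trigZ c Hg)) => x; rewrite mulrCA.
- by apply: (trig_eq Hg) => x; rewrite gh.
Qed.

Lemma trigX f n : trig f -> trig (fun x => f x ^+ n).
Proof.
move=> tf; elim: n => [|n IH]; first exact: trig_cst.
by apply: (trig_eq (trigM tf IH)) => x; rewrite exprS.
Qed.

Lemma cosk_cont k : continuous (fun x : R => cos (k%:~R * x)).
Proof.
have -> : (fun x : R => cos (k%:~R * x)) = (fun x => cos (k%:~R * x + 0)).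
  by apply: funext => x; rewrite addr0.
exact: cos_lin_cont.
Qed.

Lemma sink_cont k : continuous (fun x : R => sin (k%:~R * x)).
Proof.
have -> : (fun x : R => sin (k%:~R * x)) = (fun x => sin (k%:~R * x + 0)).
  by apply: funext => x; rewrite addr0.
exact: sin_lin_cont.
Qed.

Lemma itg_cos f k : itg f -> itg (fun x => f x * cos (k%:~R * x)).
Proof. by move=> fi; apply: (itgMl (M := 1)) => // [|x]; [exact: cosk_cont|exact: cos_max]. Qed.

Lemma itg_sin f k : itg f -> itg (fun x => f x * sin (k%:~R * x)).
Proof. by move=> fi; apply: (itgMl (M := 1)) => // [|x]; [exact: sink_cont|exact: sin_max]. Qed.

Lemma itgD f g : itg f -> itg g -> itg (fun x => f x + g x).
Proof.
by move=> fi gi; apply: (@integrableD _ _ _ mu `[0, 2 * pi] _ (EFin \o f) (EFin \o g)).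
Qed.

Lemma itgZ c f : itg f -> itg (fun x => c * f x).
Proof.
by move=> fi; apply: (@integrableZl _ _ _ mu `[0, 2 * pi] _ c (EFin \o f)).
Qed.

Lemma itgB f g : itg f -> itg g -> itg (fun x => f x - g x).
Proof.
move=> fi gi; have := itgD fi (itgZ (-1) gi).
by apply: eq_integrable => // x _; rewrite /= mulN1r.
Qed.

Lemma twopi_neq0 : 2 * pi != 0 :> R.
Proof. by rewrite mulf_neq0 ?pnatr_eq0// gt_eqF// pi_gt0. Qed.

Lemma twopi_gt0 : 0 < 2 * pi :> R.
Proof. by rewrite mulr_gt0// pi_gt0. Qed.

Definition nullF f := forall k, fcos f k = 0 /\ fsin f k = 0.

Lemma nullF_trig f g : itg f -> nullF f -> trig g ->
  itg (fun x => f x * g x) /\ \int[mu]_(x in `[0, 2 * pi]) (f x * g x) = 0.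
Proof.
move=> fi f0; elim=> {g} [l|l|g h _ [ig Hg] _ [ih Hh]|c g _ [ig Hg]|g h _ Hg gh].
- split; first exact: itg_cos.
  have [/eqP + _] := f0 l; rewrite /fcos mulf_eq0 invr_eq0 (negPf twopi_neq0) /=.
  by move/eqP.
- split; first exact: itg_sin.
  have [_ /eqP] := f0 l; rewrite /fsin mulf_eq0 invr_eq0 (negPf twopi_neq0) /=.
  by move/eqP.
- have E : (fun x => f x * (g x + h x)) = (fun x => f x * g x + f x * h x).
    by apply: funext => x; rewrite mulrDr.
  by rewrite E; split; [exact: itgD|rewrite RintegralD// Hg Hh addr0].
- have E : (fun x => f x * (c * g x)) = (fun x => c * (f x * g x)).
    by apply: funext => x; rewrite mulrCA.
  by rewrite E; split; [exact: itgZ|rewrite RintegralZl// Hg mulr0].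
- by have <- : g = h by apply: funext.
Qed.

(* sin (y / 2) * sin ((x - y) / 2) is positive on ]0, x[ and negative on
   ]x, 2 * pi[, so these trigonometric polynomials in y tend to the indicator of
   [0, x]. *)
Definition bump x n y : R :=
  (1 - (1 / 2 - sin (y / 2) * sin ((x - y) / 2) / 2) ^+ n) ^+ (2 ^ n).

Lemma bump_trig x n : trig (bump x n).
Proof.
pose c := x / 2.
have t1 : trig (fun y => 1 / 2 + (1 / 4) * (cos c + (-1) * (cos c * cos (1%:~R * y) + sin c * sin (1%:~R * y)))).
  apply: trigD; first exact: trig_cst.
  apply: trigZ; apply: trigD; first exact: trig_cst.
  by apply: trigZ; apply: trigD; apply: trigZ; [exact: trig_cos|exact: trig_sin].
have t2 := trigD (trig_cst 1) (trigZ (-1) (trigX n t1)).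
apply: (trig_eq (trigX (2 ^ n) t2)) => y; rewrite /bump mulN1r.
suff -> : 1 / 2 + 1 / 4 * (cos c - (cos c * cos (1%:~R * y) + sin c * sin (1%:~R * y))) =
  1 / 2 - sin (y / 2) * sin ((x - y) / 2) / 2 by rewrite mulN1r.
rewrite mulr1z !mul1r.
have e1 : c = y / 2 + (x - y) / 2 by rewrite /c; field.
have e2 : cos c * cos y + sin c * sin y = cos (y / 2 - (x - y) / 2).
  by rewrite mulrC [sin c * _]mulrC -cosB; congr cos; rewrite /c; field.
by rewrite e2 e1 cosD cosB; field.
Qed.

Lemma ss_le1 y z : `|sin y * sin z| <= 1 :> R.
Proof. by rewrite normrM mulr_ile1// sin_max. Qed.

Lemma bump_base x y : 0 <= 1 / 2 - sin (y / 2) * sin ((x - y) / 2) / 2 <= 1.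
Proof.
have := ss_le1 (y / 2) ((x - y) / 2); set s := _ * _.
by rewrite ler_norml => /andP[? ?]; apply/andP; split; lra.
Qed.

Lemma bump_le1 x n y : `|bump x n y| <= 1.
Proof.
have /andP[q0 q1] := bump_base x y; rewrite /bump; set q := _ - _ in q0 q1 *.
have : 0 <= q ^+ n <= 1 by rewrite exprn_ge0// exprn_ile1.
move=> /andP[a0 a1]; rewrite normrX exprn_ile1// ger0_norm; lra.
Qed.

Lemma pow_small (q : R) : 0 <= q < 1 -> (fun n => q ^+ n) @ \oo --> (0 : R).
Proof. by move=> /andP[q0 q1]; apply: cvg_expr; rewrite ger0_norm. Qed.

Lemma bernoulli (a : R) m : 0 <= a <= 1 -> 1 - m%:R * a <= (1 - a) ^+ m.
Proof.
move=> /andP[a0 a1]; elim: m => [|m IH]; first by rewrite mul0r subr0.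
rewrite exprS; apply: (@le_trans _ _ ((1 - a) * (1 - m%:R * a))).
  rewrite -natr1; have : 0 <= m%:R * a * a by rewrite !mulr_ge0.
  by set M := m%:R; nra.
by apply: ler_wpM2l => //; rewrite subr_ge0.
Qed.

(** By Bernoulli's inequality the value is at least 1 - 2^n q^n = 1 - (2 q)^n. *)
Lemma bump_in q : 0 <= q < 1 / 2 -> (fun n => (1 - q ^+ n) ^+ (2 ^ n)) @ \oo --> (1 : R).
Proof.
move=> /andP[q0 q1].
have h : (fun n => 1 - (2 * q) ^+ n) @ \oo --> (1 : R).
  rewrite -[X in _ --> X]subr0; apply: cvgB; first exact: cvg_cst.
  by apply: pow_small; apply/andP; split; lra.
apply: (squeeze_cvgr _ h (@cvg_cst _ (1 : R) _ _ _)); apply: nearW => n.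
have qn : 0 <= q ^+ n <= 1 by rewrite exprn_ge0// exprn_ile1//; lra.
have /andP[a0 a1] := qn.
apply/andP; split; last by rewrite exprn_ile1 // ?subr_ge0// lerBlDr lerDl.
by apply: le_trans (bernoulli _ qn); rewrite exprMn natrX.
Qed.

(** With a = q^n and m = 2^n, (1 - a)^m (1 + a)^m <= 1 while (1 + a)^m >= m a = (2 q)^n. *)
Lemma bump_out q : 1 / 2 < q <= 1 -> (fun n => (1 - q ^+ n) ^+ (2 ^ n)) @ \oo --> (0 : R).
Proof.
move=> /andP[q0 q1].
have h : (fun n => ((2 * q)^-1) ^+ n) @ \oo --> (0 : R).
  apply: pow_small; rewrite invr_ge0 invf_lt1; last by lra.
  by apply/andP; split; lra.
apply: (squeeze_cvgr _ (@cvg_cst _ (0 : R) _ _ _) h); apply: nearW => n.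
have qn0 : 0 < q ^+ n by rewrite exprn_gt0//; lra.
have qn1 : q ^+ n <= 1 by rewrite exprn_ile1//; lra.
have a0 : 0 <= (1 - q ^+ n) ^+ (2 ^ n) by rewrite exprn_ge0// subr_ge0.
apply/andP; split => //.
have p0 : 0 < (2 * q) ^+ n by rewrite exprn_gt0//; lra.
rewrite exprVn -div1r ler_pdivlMr// exprMn -natrX.
set a := q ^+ n in qn0 qn1 a0 *; set m := (2 ^ n)%N in a0 *.
apply: (@le_trans _ _ ((1 - a) ^+ m * (1 + a) ^+ m)).
  apply: ler_wpM2l => //.
  suff : 1 + m%:R * a <= (1 + a) ^+ m by apply: le_trans; rewrite lerDr.
  elim: m {a0} => [|m IH]; first by rewrite mul0r addr0.
  rewrite exprS; apply: (@le_trans _ _ ((1 + a) * (1 + m%:R * a))).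
    rewrite -natr1; have : 0 <= m%:R * a * a by rewrite !mulr_ge0// ltW.
    by set M := m%:R; nra.
  by apply: ler_wpM2l => //; lra.
rewrite -exprMn exprn_ile1//; nra.
Qed.

Lemma ae_neq3 (a b c : R) (P : R -> Prop) :
  (forall x, x != a -> x != b -> x != c -> P x) -> {ae mu, forall x, P x}.
Proof.
move=> h; exists [set a; b; c]; split.
- by apply: measurableU; [exact: measurableU|].
- by apply: countable_lebesgue_measure0; exact: finite_set_countable.
- move=> x /= nP; have [->|xa] := eqVneq x a; first by left; left.
  have [->|xb] := eqVneq x b; first by left; right.
  by have [->|xc] := eqVneq x c; [right|exfalso; apply: nP; exact: h].
Qed.

(** f integrates to 0 against each [bump x n], and dominated convergence with majorant |f| passes to
    the indicator. *)
Lemma nullF_int0 f x : itg f -> nullF f -> x \in `[0, 2 * pi] ->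
  \int[mu]_(y in `[0, x]) f y = 0.
Proof.
move=> fi f0 xI; have p0 := twopi_gt0.
pose F n y := (f y * bump x n y)%:E.
pose G y := (f y * (if y < x then 1 else 0))%:E.
have mf : measurable_fun `[0, 2 * pi] f by apply/measurable_EFinP; exact: measurable_int fi.
have mG : measurable_fun `[0, 2 * pi] G.
  apply/measurable_EFinP; apply: measurable_funM => //.
  have -> : (fun y => if y < x then 1 else 0) = \1_(`]-oo, x[) :> (R -> R).
    apply: funext => y; rewrite indicE.
    have -> : (y \in `]-oo, x[%classic) = (y < x) by apply/idP/idP; rewrite inE/= in_itv.
    by case: ifP.
  exact: measurable_indic.
pose D : set R := `[0, 2 * pi]%classic.
have nE n : (\int[mu]_(y in D) F n y = 0)%E.
  have [ig ig0] := nullF_trig fi f0 (bump_trig x n).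
  have h : (\int[mu]_(y in D) F n y)%E \is a fin_num.
    by apply: (integrable_fin_num _ ig).
  by rewrite -(fineK h); move: ig0; rewrite /Rintegral => ->.
have [iG _ cvgF] : [/\ mu.-integrable D G,
    [sequence \int[mu]_(y in D) `|F n y - G y|]_n @ \oo --> 0%E &
    [sequence \int[mu]_(y in D) F n y]_n @ \oo --> \int[mu]_(y in D) G y]%E.
  apply: (@dominated_convergence _ _ _ mu D _ F G (fun y => `|f y|%:E)) => //.
  - exact: measurable_itv.
  - move=> n; have [ig _] := nullF_trig fi f0 (bump_trig x n).
    exact: (@measurable_int _ _ _ mu _ _ ig).
  (* At 0, 2 pi and x the base of [bump] is 1/2, the threshold between the two limits. *)
  - apply: (@ae_neq3 0 (2 * pi) x) => y y0 y2 yx /= yI.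
    have {}yI : 0 < y < 2 * pi.
      by move: yI; rewrite /D/= in_itv/= => /andP[? ?]; rewrite !lt_neqAle eq_sym y0 y2; apply/andP.
    have /andP[yp y2p] := yI; move: xI; rewrite in_itv/= => /andP[x0 x2p].
    have s1 : 0 < sin (y / 2) by apply: sin_gt0_pi; apply/andP; split; lra.
    apply/cvg_EFin; first by apply: nearW.
    apply: cvgM; first exact: cvg_cst.
    have /andP[q0 q1] := bump_base x y.
    have [yltx|xlty|E] := ltgtP y x; last by rewrite E eqxx in yx.
    + have s2 : 0 < sin ((x - y) / 2) by apply: sin_gt0_pi; apply/andP; split; lra.
      apply: bump_in; rewrite q0 /=; have := mulr_gt0 s1 s2; lra.
    + have s2 : 0 < sin ((y - x) / 2) by apply: sin_gt0_pi; apply/andP; split; lra.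
      apply: bump_out; rewrite q1 andbT; have := mulr_gt0 s1 s2.
      by rewrite -[(x - y)]opprB mulNr sinN; set p := sin _; set p' := sin _; lra.
  - exact: (@integrable_norm _ _ _ mu `[0, 2 * pi] f fi).
  - by apply/aeW => y n _; rewrite /F lee_fin normrM ler_piMr// bump_le1.
have G0 : (\int[mu]_(y in D) G y = 0)%E.
  rewrite -(cvg_lim _ cvgF)//; apply: lim_near_cst => //.
  by apply: nearW => n; exact: nE.
have ifx : mu.-integrable `[0, x[ (EFin \o f).
  apply: (@integrableS _ _ _ mu `[0, 2 * pi]) => //.
  by move=> y /=; rewrite !in_itv/= => /andP[-> yx] /=; move: xI; rewrite in_itv/= => /andP[_]; apply: le_trans; exact: ltW.
rewrite -Rintegral_itv_bndo_bndc//.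
have -> : `[0, x[%classic = `[0, 2 * pi] `&` `[0, x[ :> set R.
  apply/seteqP; split => y /=; last by case.
  rewrite !in_itv/= => /andP[-> yx]; rewrite yx; split => //=.
  by move: xI; rewrite in_itv/= => /andP[_]; apply: le_trans; exact: ltW.
rewrite Rintegral_mkcondr /Rintegral -[RHS]/(fine 0) -G0; congr fine.
apply: eq_integral => y; rewrite inE /D/= in_itv/= => /andP[y0 _]; rewrite /G patchE.
have -> : (y \in `[0, x[%classic) = (y < x).
  by apply/idP/idP; [rewrite inE/= in_itv/= y0|rewrite inE/= in_itv/= y0].
by case: ifP; rewrite ?mulr1 ?mulr0.
Qed.

(* Differentiating the vanishing primitive. *)
Lemma nullF_eq0 f x : itg f -> nullF f -> {for x, continuous f} -> 0 < x < 2 * pi -> f x = 0.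
Proof.
move=> fi f0 cf /andP[x0 x2].
have [] := continuous_FTC1_closed x2 fi x0 cf => _ <-.
rewrite derive1E; apply: derive_val.
have h : is_derive x (1 : R) (cst 0 : R -> R) 0 by exact: is_derive_cst.
apply: (near_eq_is_derive _ h); near=> y.
rewrite nullF_int0//; apply: subset_itv_oo_cc; near: y.
by apply: near_in_itvoo; rewrite in_itv/= x0.
Unshelve. all: by end_near. Qed.

(** Without continuity the vanishing primitive is differentiated at Lebesgue points; f is cut off
    outside [0, 2 pi] to be integrable on the line. *)
Lemma nullF_ae f : itg f -> nullF f ->
  {ae mu, forall x, 0 < x < 2 * pi -> f x = 0}.
Proof.
move=> fi f0.
have lf : locally_integrable [set: R] (f \_ `[0, 2 * pi]).
  apply: integrable_locally => //.
have := lebesgue_differentiation lf; apply: filterS; first exact: (ae_filter_ringOfSetsType mu).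
move=> x lx /andP[x0 x2].
have i2 : mu.-integrable `[0, 2 * pi] (EFin \o (f \_ `[0, 2 * pi])).
  by rewrite -restrict_EFin; apply/integrable_restrict => //=; rewrite setIid.
have [] := FTC1_lebesgue_pt (a := BLeft 0) x2 i2 _ lx => //.
have -> : (f \_ `[0, 2 * pi]) x = f x.
  by rewrite patchE mem_set//= in_itv/= !ltW.
move=> _ <-; rewrite derive1E; apply: derive_val.
have h : is_derive x (1 : R) (cst 0 : R -> R) 0 by exact: is_derive_cst.
apply: (near_eq_is_derive _ h); near=> y.
have yI : y \in `[0, 2 * pi].
  by apply: subset_itv_oo_cc; near: y; apply: near_in_itvoo; rewrite in_itv/= x0.
apply: etrans (esym (nullF_int0 fi f0 yI)) _; apply: eq_Rintegral => z; rewrite inE/= in_itv/= => /andP[z0 zy].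
by rewrite patchE mem_set//= in_itv/= z0 (le_trans zy)//; move: yI; rewrite in_itv/= => /andP[].
Unshelve. all: by end_near. Qed.

End fourier_uniqueness.

(** * Convolution, inversion and termwise calculus of Fourier series *)

Section fourier_series.
Variable R : realType.
Local Notation C := R[i].
Local Notation mu := (@lebesgue_measure R).
Implicit Types (f g h : R -> R) (a b : int -> C) (k l : int) (x y M G : R).

Lemma cont_of_con f : (forall x, con (x - 1) (x + 1) f) -> continuous f.
Proof.
move=> h x; have := within_continuous_continuous (_ : x - 1 < x + 1) (h x).
by apply; [lra|rewrite in_itv/=; apply/andP; split; lra].
Qed.

Lemma cos_2piZ k : cos (k%:~R * (2 * pi)) = 1 :> R.
Proof.
have h n : cos (n%:R * (2 * pi)) = 1 :> R.
  by have := periodicn (@cosD2pi R) n 0; rewrite add0r cos0 !mulr_natl.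
case: k => n; first exact: h.
by rewrite NegzE mulrNz mulNr cosN; exact: h.
Qed.

Lemma sin_2piZ k : sin (k%:~R * (2 * pi)) = 0 :> R.
Proof.
have h n : sin (n%:R * (2 * pi)) = 0 :> R.
  by have := periodicn (@sinD2pi R) n 0; rewrite add0r sin0 !mulr_natl.
case: k => n; first exact: h.
by rewrite NegzE mulrNz mulNr sinN h oppr0.
Qed.

Lemma cos_per k x : cos (k%:~R * (x + 2 * pi)) = cos (k%:~R * x) :> R.
Proof. by rewrite mulrDr cosD cos_2piZ sin_2piZ mulr1 mulr0 subr0. Qed.

Lemma sin_per k x : sin (k%:~R * (x + 2 * pi)) = sin (k%:~R * x) :> R.
Proof. by rewrite mulrDr sinD cos_2piZ sin_2piZ mulr1 mulr0 addr0. Qed.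

Lemma con_cosk k (c d : R) : con c d (fun x => cos (k%:~R * x)).
Proof. by apply: con_cont; exact: cosk_cont. Qed.

Lemma con_sink k (c d : R) : con c d (fun x => sin (k%:~R * x)).
Proof. by apply: con_cont; exact: sink_cont. Qed.

Lemma int_cosk k : \int[mu]_(x in `[0, 2 * pi]) cos (k%:~R * x) = if k == 0 then 2 * pi else 0 :> R.
Proof.
have p0 := twopi_gt0 R; case: eqP => [->|/eqP k0].
  under eq_Rintegral do rewrite mulr0z mul0r cos0.
  by rewrite Rintegral_cst//= lebesgue_measure_itv/= lte_fin p0 -EFinB subr0 mul1r.
have k0' : k%:~R != 0 :> R by rewrite intr_eq0.
have h := C1Z (k%:~R)^-1 (C1_sin 0 (2 * pi) k%:~R (0 : R)).
have e : 2 * pi \in `[0, 2 * pi : R] by rewrite in_itv/= lexx ltW.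
have := C1_ftc h e; rewrite !addr0 mulr0 sin0 sin_2piZ mulr0 subr0 => h2.
by apply: etrans h2; apply: eq_Rintegral => x _; rewrite addr0 mulrA mulVf// mul1r.
Qed.

Lemma int_sink k : \int[mu]_(x in `[0, 2 * pi]) sin (k%:~R * x) = 0 :> R.
Proof.
have p0 := twopi_gt0 R; have [->|k0] := eqVneq k 0.
  under eq_Rintegral do rewrite mulr0z mul0r sin0.
  by rewrite Rintegral_cst//= mul0r.
have k0' : k%:~R != 0 :> R by rewrite intr_eq0.
have h := C1Z (- (k%:~R)^-1) (C1_cos 0 (2 * pi) k%:~R (0 : R)).
have e : 2 * pi \in `[0, 2 * pi : R] by rewrite in_itv/= lexx ltW.
have := C1_ftc h e; rewrite !addr0 mulr0 cos0 cos_2piZ subrr => h2.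
by apply: etrans h2; apply: eq_Rintegral => x _; rewrite addr0 mulrA mulNr mulrN opprK mulVf// mul1r.
Qed.

(** The series of primitives is differentiated termwise, and the fundamental theorem evaluates it at
    d. The factor 1 + (d - c) lets one majorant serve primitives and integrands. *)
Lemma int_ssum (c d : R) (F : int -> R -> R) (D : int -> R) M : c < d -> asum D M ->
  (forall l, con c d (F l)) -> (forall l x, x \in `[c, d] -> `|F l x| <= D l) ->
  \int[mu]_(x in `[c, d]) ssum (F ^~ x) = ssum (fun l => \int[mu]_(x in `[c, d]) F l x).
Proof.
move=> cd DM cF FD; have dd : d \in `[c, d] by rewrite in_itv/= lexx ltW.
have D0 l : 0 <= D l.
  by apply: le_trans (FD l c _) => //; rewrite in_itv/= lexx ltW.
have h := @C1_ssum _ c d (fun l t => 0 + \int[mu]_(x in `[c, t]) F l x) F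
  (fun l => (1 + (d - c)) * D l) _ cd (asumZ (1 + (d - c)) DM) (fun l => C1_int 0 cd (cF l)).
have -> := C1_ftc (h _ _) dd.
- rewrite [X in _ - X](_ : _ = 0); last first.
    by rewrite -[RHS](@ssum_eq0 R); apply: eq_ssum => l; rewrite set_itv1 Rintegral_set1 addr0.
  by rewrite subr0; apply: eq_ssum => l; rewrite add0r.
- move=> l t; rewrite add0r in_itv/= => /andP[ct td].
  have sub : `[c, t] `<=` `[c, d] by exact: subset_itvl.
  apply: (le_trans (le_abs_int ct (con_sub (cF l) sub) (fun s st => FD l s (sub s st)))).
  by have := D0 l; set z := D l; nra.
- move=> l t /(FD l) /le_trans; apply.
  by have := D0 l; set z := D l; nra.
Qed.

Definition hat f k : C := Complex (fcos f k) (- fsin f k).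

(** The symmetry of the coefficients of a real function. *)
Definition herm a := forall k,
  complex.Re (a (- k)) = complex.Re (a k) /\ complex.Im (a (- k)) = - complex.Im (a k).

Lemma hat_herm f : itg f -> herm (hat f).
Proof.
move=> fi k; rewrite /hat /= /fcos /fsin; split.
  by congr (_ * _); apply: eq_Rintegral => x _; rewrite mulrNz mulNr cosN.
have -> : (fun x => f x * sin ((- k)%:~R * x)) = (fun x => (-1) * (f x * sin (k%:~R * x))).
  by apply: funext => x; rewrite mulN1r mulrNz [- _ * x]mulNr sinN mulrN.
by rewrite RintegralZl//; [ring|exact: itg_sin].
Qed.

(* The imaginary parts cancel for hermitian a. *)
Definition ser a x : R := ssum (fun l => complex.Re (a l * cis (l%:~R * x))).

Lemma n1_acis a l y : n1 (a l * cis y) <= 2 * n1 (a l).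
Proof. by rewrite mulrC; apply: le_trans (n1M _ _) _; apply: ler_wpM2r (n1_cis _); exact: n1_ge0. Qed.

Lemma casum_cis a M (y : int -> R) : casum a M -> casum (fun l => a l * cis (y l)) (2 * M).
Proof.
move=> aM; have h : asum (fun l => 2 * n1 (a l)) (2 * M).
  by have := asumZ 2 aM; rewrite ger0_norm.
by apply: (casum_dom _ h) => l; exact: n1_acis.
Qed.

Lemma ser_le a M x : casum a M -> `|ser a x| <= 2 * M.
Proof. by move=> aM; apply: norm_ssum_le; exact: casum_Re (casum_cis _ aM). Qed.

Lemma ser_per a x : ser a (x + 2 * pi) = ser a x.
Proof. by apply: eq_ssum => l; rewrite /cis cos_per sin_per. Qed.

Lemma con_Re_cis (z : C) k (c d : R) : con c d (fun x => complex.Re (z * cis (k%:~R * x))).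
Proof.
have h : con c d (fun x => complex.Re z * cos (k%:~R * x) - complex.Im z * sin (k%:~R * x)).
  by apply: conB; apply: conM; rewrite ?/con; [exact: con_cst|exact: con_cosk|exact: con_cst|exact: con_sink].
by apply: (con_eq h) => x _; rewrite cReM.
Qed.

Lemma con_Im_cis (z : C) k (c d : R) : con c d (fun x => complex.Im (z * cis (k%:~R * x))).
Proof.
have h : con c d (fun x => complex.Re z * sin (k%:~R * x) + complex.Im z * cos (k%:~R * x)).
  by apply: conD; apply: conM; [exact: con_cst|exact: con_sink|exact: con_cst|exact: con_cosk].
by apply: (con_eq h) => x _; rewrite cImM.
Qed.

Lemma dom2 a M : casum a M -> asum (fun l => 2 * n1 (a l)) (2 * M).
Proof. by move=> /(asumZ 2); rewrite ger0_norm. Qed.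

Lemma ser_cont a M : casum a M -> continuous (ser a).
Proof.
move=> aM; apply: cont_of_con => x; apply: (con_ssum (dom2 aM)) => [l|l y _].
  exact: con_Re_cis.
by apply: le_trans (norm_Re _) _; exact: n1_acis.
Qed.

Definition Dser a l : C := ii * rc l%:~R * a l.

Lemma ser_derive a M N x : casum a M -> casum (Dser a) N ->
  is_derive x (1 : R) (ser a) (ser (Dser a) x).
Proof.
move=> aM dN; have xx : x - 1 < x + 1 by lra.
have [] := @C1_ssum _ (x - 1) (x + 1) (fun l y => complex.Re (a l * cis (l%:~R * y)))
  (fun l y => complex.Re (Dser a l * cis (l%:~R * y)))
  (fun l => 2 * n1 (a l) + 2 * n1 (Dser a l)) _ xx (asumD (dom2 aM) (dom2 dN)).
- move=> l; have [h _] := cC1Z (a l) (cC1_cis (x - 1) (x + 1) l%:~R 0).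
  by apply: (eq_C1 h) => y _; rewrite addr0// /Dser; congr complex.Re; ring.
- move=> l y _; apply: le_trans (norm_Re _) _; apply: le_trans (n1_acis _ _ _) _.
  by rewrite lerDl mulr_ge0// n1_ge0.
- move=> l y _; apply: le_trans (norm_Re _) _; apply: le_trans (n1_acis _ _ _) _.
  by rewrite lerDr mulr_ge0// n1_ge0.
by move=> _ _; apply; rewrite in_itv/=; apply/andP; split; lra.
Qed.

Lemma dom_mul a M g G (c d : R) : casum a M -> 0 <= G -> (forall x, `|g x| <= G) ->
  asum (fun l => G * (2 * n1 (a l))) (G * (2 * M)).
Proof. by move=> aM G0 gG; have := asumZ G (dom2 aM); rewrite ger0_norm. Qed.

Lemma cont_itg f : continuous f -> itg f.
Proof. by move=> cf; apply: con_integrable; exact: con_cont. Qed.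

Lemma hatB f g k : itg f -> itg g -> hat (fun x => f x - g x) k = hat f k - hat g k.
Proof.
move=> fi gi; apply: eq_c; rewrite !cE /= /fcos /fsin.
  rewrite -mulrBr -RintegralB//; [|exact: itg_cos..].
  by congr (_ * _); apply: eq_Rintegral => x _; rewrite mulrBl.
rewrite -opprD -mulrBr -RintegralB//; [|exact: itg_sin..].
by congr (- (_ * _)); apply: eq_Rintegral => x _; rewrite mulrBl.
Qed.

Lemma hat_nullF f : (forall k, hat f k = 0) -> nullF f.
Proof.
move=> h k; have := h k; rewrite /hat => -[-> /eqP]; rewrite oppr_eq0 => /eqP ->.
by [].
Qed.

Lemma per_int f : (forall x, f (x + 2 * pi) = f x) -> forall k x, f (x + k%:~R * (2 * pi)) = f x.
Proof.
move=> fp; have h n x : f (x + n%:R * (2 * pi)) = f x.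
  elim: n x => [|n IH] x; first by rewrite mul0r addr0.
  by rewrite -natr1 mulrDl mul1r addrA fp IH.
case=> n x; first exact: h.
by rewrite NegzE mulrNz mulNr -[in RHS](subrK (n.+1%:R * (2 * pi)) x) h.
Qed.

Lemma mod_2pi x : exists k : int, 0 <= x - k%:~R * (2 * pi) < 2 * pi.
Proof.
have p0 := twopi_gt0 R; exists (Num.floor (x / (2 * pi))).
have /andP[] := floor_itv (x / (2 * pi)).
rewrite ler_pdivlMr// intrD ltr_pdivrMr// mulrDl mul1r => k1 k2.
by apply/andP; split; lra.
Qed.

(** The point 0 is reached by continuity from the right, every other point by translation. *)
Lemma per_eq0 f : continuous f -> (forall x, f (x + 2 * pi) = f x) ->
  (forall x, 0 < x < 2 * pi -> f x = 0) -> forall x, f x = 0.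
Proof.
move=> cf fp f0 x; have p0 := twopi_gt0 R.
have [k yb] := mod_2pi x; set y := x - k%:~R * (2 * pi) in yb.
have -> : f x = f y by rewrite -(per_int fp k y) subrK.
have /andP[] := yb; rewrite le_eqVlt => /predU1P[<- _|y0 y2]; last by apply: f0; rewrite y0.
have c0 : f z @[z --> 0^'+] --> f 0 by apply: cvg_at_right_filter; exact: cf.
rewrite -(cvg_lim _ c0)//; apply: lim_near_cst => //; near=> z; apply: f0; apply/andP; split => //.
Unshelve. all: by end_near. Qed.

Lemma ssum_odd (f : int -> R) : (forall k, f (- k) = - f k) -> ssum f = 0.
Proof.
move=> fo; rewrite -(ssum_eq0 R); congr (limn _); apply: funext => n.
elim: n => [|n IH].
  by rewrite !psum0; have := fo 0; rewrite oppr0 => ?; lra.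
by rewrite !psumS IH psum_eq0 fo !addr0 addNr.
Qed.

Lemma cser_real a x : herm a -> csum (fun l => a l * cis (l%:~R * x)) = rc (ser a x).
Proof.
move=> ha; apply: eq_c => //=; apply: ssum_odd => k; have [hr hi] := ha k.
by rewrite !cImM /= hr hi mulrNz mulNr cosN sinN; ring.
Qed.

Lemma hat_bounded g G k : continuous g -> (forall x, `|g x| <= G) -> n1 (hat g k) <= 2 * G.
Proof.
move=> cg gG; have p0 := twopi_gt0 R; have cgi : con 0 (2 * pi) g by exact: con_cont.
have h (t : R -> R) : con 0 (2 * pi) t -> (forall x, `|t x| <= 1) ->
    `|(2 * pi)^-1 * \int[mu]_(x in `[0, 2 * pi]) (g x * t x)| <= G.
  move=> ct t1; rewrite normrM ger0_norm; last by rewrite invr_ge0 ltW.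
  rewrite mulrC ler_pdivrMr//.
  have -> : G * (2 * pi) = G * (2 * pi - 0) by rewrite subr0.
  apply: le_abs_int; [exact: ltW|exact: conM|move=> x _].
  by rewrite normrM -[leRHS]mulr1; apply: ler_pM.
rewrite /n1 /= normrN mulr2n mulrDl mul1r; apply: lerD; apply: h.
- exact: con_cosk.
- by move=> x; exact: cos_max.
- exact: con_sink.
- by move=> x; exact: sin_max.
Qed.

Lemma casum_conv a b M N k : casum a M -> (forall l, n1 (b l) <= N) ->
  casum (fun l => a l * b (k - l)) (`|N| * M).
Proof.
move=> aM bN; apply: (casum_dom _ (asumZ N aM)) => l.
by apply: le_trans (n1M _ _) _; rewrite mulrC; apply: ler_wpM2r; rewrite ?n1_ge0.
Qed.

(** The absolutely convergent series of the first factor is integrated termwise against g, and its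
    l-th term shifts the coefficients of g by l. The case g = 1 gives [hat_ser]. *)
Lemma hat_mul a M g G k : casum a M -> herm a -> continuous g -> (forall x, `|g x| <= G) ->
  hat (fun x => ser a x * g x) k = csum (fun l => a l * hat g (k - l)).
Proof.
move=> aM ha cg gG; have p0 := twopi_gt0 R.
have G0 : 0 <= G by apply: le_trans (gG 0).
have D := dom_mul 0 0 aM G0 gG.
pose F l x := a l * cis (l%:~R * x) * cis (- k%:~R * x).
have FE l x : F l x = a l * cis ((l - k)%:~R * x).
  by rewrite /F -mulrA -cisD; congr (_ * cis _); rewrite intrB; ring.
have sumF x : csum (F ^~ x) = rc (ser a x) * cis (- k%:~R * x).
  rewrite -(cser_real x ha) mulrC -(csumMl _ (casum_cis (fun l => l%:~R * x) aM)).
  by apply: eq_csum => l; rewrite mulrC.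
have dm l x z : `|z| <= n1 (F l x) -> `|z * g x| <= G * (2 * n1 (a l)).
  move=> zF; rewrite normrM mulrC; apply: ler_pM => //.
  by apply: le_trans zF _; rewrite FE; exact: n1_acis.
have FS x : casum (F ^~ x) (2 * M).
  by apply: (asum_eq _ (casum_cis (fun l => (l - k)%:~R * x) aM)) => l; rewrite FE.
have sm (t : int -> R) x : asum t (2 * M) -> ssum t * g x = ssum (fun l => t l * g x).
  by move=> tS; rewrite mulrC -(ssumZ _ tS); apply: eq_ssum => l; rewrite mulrC.
have hS := casum_conv k aM (fun l => hat_bounded l cg gG).
have cgi : con 0 (2 * pi) g by exact: con_cont.
have cR l : con 0 (2 * pi) (fun x => complex.Re (F l x)).
  by apply: (con_eq (@con_Re_cis (a l) (l - k) 0 (2 * pi))) => x _; rewrite FE.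
have cI l : con 0 (2 * pi) (fun x => complex.Im (F l x)).
  by apply: (con_eq (@con_Im_cis (a l) (l - k) 0 (2 * pi))) => x _; rewrite FE.
have igc j : mu.-integrable `[0, 2 * pi] (EFin \o (fun x => g x * cos (j%:~R * x))).
  exact: itg_cos (cont_itg cg).
have igs j : mu.-integrable `[0, 2 * pi] (EFin \o (fun x => g x * sin (j%:~R * x))).
  exact: itg_sin (cont_itg cg).
have lin (p q : R) j : \int[mu]_(x in `[0, 2 * pi]) (p * (g x * cos (j%:~R * x)) + q * (g x * sin (j%:~R * x)))
    = (2 * pi) * (p * fcos g j + q * fsin g j).
  rewrite RintegralD//; [|exact: itgZ (itg_cos _ (cont_itg cg))|exact: itgZ (itg_sin _ (cont_itg cg))].
  rewrite RintegralZl// RintegralZl// /fcos /fsin.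
  have c2 (A B : R) : p * A + q * B = 2 * pi * (p * ((2 * pi)^-1 * A) + q * ((2 * pi)^-1 * B)).
    have gen P : P != 0 -> p * A + q * B = 2 * P * (p * ((2 * P)^-1 * A) + q * ((2 * P)^-1 * B)).
      by move=> Pn; field.
    exact: gen (lt0r_neq0 (pi_gt0 R)).
  exact: c2.
apply: eq_c => /=; rewrite /fcos /fsin.
- have E x : ser a x * g x * cos (k%:~R * x) = ssum (fun l => complex.Re (F l x) * g x).
    rewrite -(sm _ _ (casum_Re (FS x))).
    have -> : ssum (fun l => complex.Re (F l x)) = complex.Re (csum (F ^~ x)) by [].
    by rewrite sumF cReM /= mulNr cosN; ring.
  under eq_Rintegral do rewrite E.
  rewrite (int_ssum p0 D); last 2 first.
  + by move=> l; exact: conM (cR l) cgi.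
  + by move=> l x _; apply: dm; exact: norm_Re.
  have E2 l : \int[mu]_(x in `[0, 2 * pi]) (complex.Re (F l x) * g x) = (2 * pi) * complex.Re (a l * hat g (k - l)).
    rewrite cReM /= mulrN opprK -lin; apply: eq_Rintegral => x _.
    by rewrite FE cReM /= -[l - k]opprB mulrNz mulNr cosN sinN; ring.
  by rewrite (eq_ssum E2) (ssumZ _ (casum_Re hS)) mulrA mulVf ?mul1r// gt_eqF.
- have E x : ser a x * g x * sin (k%:~R * x) = ssum (fun l => - complex.Im (F l x) * g x).
    rewrite -(sm _ _ (asumN (casum_Im (FS x)))) (ssumN (casum_Im (FS x))).
    have -> : ssum (fun l => complex.Im (F l x)) = complex.Im (csum (F ^~ x)) by [].
    by rewrite sumF cImM /= [- _ * x]mulNr sinN; ring.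
  under eq_Rintegral do rewrite E.
  rewrite (int_ssum p0 D); last 2 first.
  + by move=> l; exact: conM (conN (cI l)) cgi.
  + by move=> l x _; apply: dm; rewrite normrN; exact: norm_Im.
  have E2 l : \int[mu]_(x in `[0, 2 * pi]) (- complex.Im (F l x) * g x) = (- (2 * pi)) * complex.Im (a l * hat g (k - l)).
    rewrite cImM /= mulNr.
    have -> : 2 * pi * (complex.Re (a l) * - fsin g (k - l) + complex.Im (a l) * fcos g (k - l)) =
      - (2 * pi * ((- complex.Im (a l)) * fcos g (k - l) + complex.Re (a l) * fsin g (k - l))) by ring.
    rewrite opprK -lin; apply: eq_Rintegral => x _.
    by rewrite FE cImM /= -[l - k]opprB mulrNz [- _ * x]mulNr cosN sinN; ring.
  rewrite (eq_ssum E2) (ssumZ _ (casum_Im hS)) mulNr mulrN opprK mulrA mulVf ?mul1r// gt_eqF//.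
Qed.

Lemma hat_one k : hat (fun=> 1) k = if k == 0 then 1 else 0.
Proof.
apply: eq_c; rewrite /hat /fcos /fsin /=.
  under eq_Rintegral do rewrite mul1r.
  by rewrite int_cosk; case: ifP => _; rewrite ?mulr0// mulVf// twopi_neq0.
under eq_Rintegral do rewrite mul1r.
by rewrite int_sink mulr0 oppr0; case: ifP.
Qed.

Lemma hat_ser a M k : casum a M -> herm a -> hat (ser a) k = a k.
Proof.
move=> aM ha; have one_le x : `|1 : R| <= 1 by rewrite normr1.
have := hat_mul k aM ha (fun x => cvg_cst (1 : R)) one_le.
have -> : (fun x => ser a x * 1) = ser a by apply: funext => x; rewrite mulr1.
move=> ->; rewrite -[RHS](csum_delta k (a k)); apply: eq_csum => l; rewrite hat_one.
by rewrite subr_eq0 eq_sym; case: eqP => [->|_]; rewrite ?mulr1 ?mulr0.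
Qed.

(** By [hat_ser] f and its series have the same coefficients; their difference is continuous and
    periodic, so it vanishes. *)
Lemma fourier_inversion f M : continuous f -> (forall x, f (x + 2 * pi) = f x) ->
  casum (hat f) M -> forall x, f x = ser (hat f) x.
Proof.
move=> cf fp fM x; have cs := ser_cont fM.
have cg : continuous (fun x => f x - ser (hat f) x) by move=> y; apply: cvgB; [exact: cf|exact: cs].
apply/eqP; rewrite -subr_eq0; apply/eqP.
apply: (per_eq0 cg) => [y|y y2]; first by rewrite fp ser_per.
apply: (nullF_eq0 (cont_itg cg)) => //; last exact: cg.
apply: hat_nullF => k; rewrite (hatB _ (cont_itg cf) (cont_itg cs)).
by rewrite (hat_ser k fM (hat_herm (cont_itg cf))) subrr.
Qed.

End fourier_series.

(** * Shifts and reflections of series over the integers *)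

Section reindexing.
Variable R : realType.
Implicit Types (f : int -> R) (M : R).

Lemma psum_opp f n : psum (fun k => f (- k)) n = psum f n.
Proof.
elim: n => [|n IH]; first by rewrite !psum0 oppr0.
by rewrite !psumS IH opprK; ring.
Qed.

Lemma ssum_opp f : ssum (fun k => f (- k)) = ssum f.
Proof. by congr (limn _); apply: funext => n; exact: psum_opp. Qed.

Lemma ssum_le_psum f M (B : R) : asum f M -> (forall n, psum f n <= B) -> ssum f <= B.
Proof.
move=> fM fB; apply: limr_le; first by apply/cvg_ex; eexists; exact: ssum_cvg fM.
by apply: nearW.
Qed.

(** For nonnegative terms [psum_shift_le] gives one inequality, and the opposite shift the other; in
    general f = (f + |f|) - |f|. *)
Lemma ssum_shift f M c : asum f M -> ssum (fun k => f (k - c)) = ssum f.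
Proof.
have le_nneg (g : int -> R) N d : (forall k, 0 <= g k) -> asum g N -> ssum (fun k => g (k - d)) <= ssum g.
  move=> g0 gN; apply: (ssum_le_psum (asum_shift d gN)) => n.
  by apply: le_trans (psum_shift_le _ _ g0) _; exact: psum_le_ssum gN g0.
have nneg (g : int -> R) N : (forall k, 0 <= g k) -> asum g N -> ssum (fun k => g (k - c)) = ssum g.
  move=> g0 gN; apply/eqP; rewrite eq_le (le_nneg _ _ _ g0 gN)/=.
  have := le_nneg _ _ (- c) (fun k => g0 (k - c)) (asum_shift c gN).
  by under eq_ssum do rewrite opprK addrK.
move=> fM; have aM : asum (fun k => `|f k|) M by apply: asum_domn fM => k; rewrite normr_id.
have pM := asumD fM aM.
have p0 k : 0 <= f k + `|f k| by have := ler_norm (- f k); rewrite normrN; lra.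
have E k : f k = (f k + `|f k|) - `|f k| by rewrite addrK.
rewrite (eq_ssum (fun k => E (k - c))) (ssumB (asum_shift c pM) (asum_shift c aM)).
rewrite (nneg _ _ p0 pM) (nneg _ _ (fun k => normr_ge0 (f k)) aM) -(ssumB pM aM).
by apply: eq_ssum => k; rewrite addrK.
Qed.

Lemma ssum_refl f M c : asum f M -> ssum (fun k => f (c - k)) = ssum f.
Proof.
move=> fM; rewrite -[RHS](ssum_shift (- c) fM) -[RHS]ssum_opp.
by apply: eq_ssum => k; rewrite opprK addrC.
Qed.

Lemma csum_refl (f : int -> R[i]) M c : casum f M -> csum (fun k => f (c - k)) = csum f.
Proof.
by move=> fM; apply: eq_c => /=; [exact: (ssum_refl c (casum_Re fM))|exact: (ssum_refl c (casum_Im fM))].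
Qed.

End reindexing.

(** * Weighted summability and derivatives *)

Section weighted_sums.
Variable R : realType.
Local Notation C := R[i].
Implicit Types (a b : int -> C) (k l : int) (M al : R).

(** Going from l^2 to l^1 costs one weight. To avoid roots, X Y <= (c / 2) X^2 + Y^2 / (2 c) is
    summed with Y the inverse of [J l]; c = 2 / al balances the two sums, and for al = 0 the choice
    c = 2 / e gives a bound by any e > 0. *)
Lemma hs_asum s al a : 0 <= al -> hs s.+1 al a -> asum (fun l => J R l ^+ s * n1 (a l)) (2 * al).
Proof.
move=> al0 h.
have key (c : R) : 0 < c -> asum (fun l => J R l ^+ s * n1 (a l)) (c / 2 * al ^+ 2 + 2 / c).
  move=> c0.
  have := asumD (asumZ (c / 2) h) (asumZ (1 / (2 * c)) (asum_J2 R)).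
  rewrite !ger0_norm ?divr_ge0 ?mulr_ge0 ?(ltW c0)//.
  have -> : 1 / (2 * c) * 4 = 2 / c by field; rewrite gt_eqF.
  apply: asum_dom => l; rewrite ger0_norm ?mulr_ge0 ?n1_ge0 ?exprn_ge0 ?(ltW (J_gt0 R l))//.
  have j0 := J_gt0 R l; rewrite [_ ^+ s.+1]exprS.
  set j := J R l; set w := j ^+ s; set n := n1 (a l).
  have -> : w * n = (j * w * n) * j^-1 by field; rewrite gt_eqF.
  have -> : (j ^+ 2)^-1 = j^-1 ^+ 2 by rewrite exprVn.
  set X := j * w * n; set Y := j^-1.
  have cV : c * c^-1 = 1 by rewrite mulfV// gt_eqF.
  have ci : 0 < c^-1 by rewrite invr_gt0.
  have -> : 1 / (2 * c) * Y ^+ 2 = c^-1 / 2 * Y ^+ 2 by field; rewrite gt_eqF.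
  suff : 0 <= c / 2 * (X - c^-1 * Y) ^+ 2.
    have gen c' : c / 2 * (X - c' * Y) ^+ 2 = c / 2 * X ^+ 2 - (c * c') * X * Y + (c * c') * (c' / 2 * Y ^+ 2) by field.
    by rewrite gen cV !mul1r; lra.
  by rewrite mulr_ge0 ?sqr_ge0// divr_ge0// ltW.
have [al1|] := ltP 0 al.
  have := key (2 / al); rewrite divr_gt0// => /(_ isT).
  have -> // : 2 / al / 2 * al ^+ 2 + 2 / (2 / al) = 2 * al by field; rewrite gt_eqF.
move=> al1; have -> : al = 0 by apply/eqP; rewrite eq_le al1 al0.
move=> n; rewrite mulr0; apply/ler_addgt0Pr => e e0; rewrite add0r.
have := key (2 / e) _ n; rewrite divr_gt0// => /(_ isT).
have -> : al = 0 by apply/eqP; rewrite eq_le al1 al0.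
by have -> : 2 / e / 2 * 0 ^+ 2 + 2 / (2 / e) = e by rewrite expr0n/= mulr0 add0r; field; rewrite gt_eqF.
Qed.

Lemma n1_Dser a l : n1 (Dser a l) <= J R l * n1 (a l).
Proof.
rewrite /Dser -mulrA n1_i n1_rc; apply: ler_wpM2r; first exact: n1_ge0.
by rewrite JE lerDr.
Qed.

Lemma n1_iter_Dser j a l : n1 (iter j (@Dser R) a l) <= J R l ^+ j * n1 (a l).
Proof.
elim: j => [|j IH]; first by rewrite expr0 mul1r.
rewrite iterS; apply: le_trans (n1_Dser _ _) _.
by rewrite exprS -mulrA; apply: ler_wpM2l => //; exact/ltW/J_gt0.
Qed.

Lemma casum_Dser j s a M : (j <= s)%N -> asum (fun l => J R l ^+ s * n1 (a l)) M ->
  casum (iter j (@Dser R) a) M.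
Proof.
move=> js; apply: casum_dom => l; apply: le_trans (n1_iter_Dser _ _ _) _.
by apply: ler_wpM2r; rewrite ?n1_ge0// ler_weXn2l// J_ge1.
Qed.

Lemma iter_DserE j a l : iter j (@Dser R) a l = (ii * rc l%:~R) ^+ j * a l.
Proof. by elim: j => [|j IH]; rewrite ?expr0 ?mul1r// iterS {1}/Dser IH exprS; ring. Qed.

Lemma herm_Dser a : herm a -> herm (Dser a).
Proof.
move=> ha k; have [hr hi] := ha k; rewrite /Dser !cE /= hr hi mulrNz; split; ring.
Qed.

Lemma derive1n_ser j s a M : (j <= s)%N -> asum (fun l => J R l ^+ s * n1 (a l)) M ->
  derive1n j (ser a) = ser (iter j (@Dser R) a).
Proof.
elim: j => // j IH js aM; rewrite derive1nS IH; [|exact: ltnW|by []].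
apply: funext => x; rewrite derive1E.
have h := @ser_derive _ (iter j (@Dser R) a) M M x (casum_Dser (ltnW js) aM) (casum_Dser js aM).
by rewrite derive_val.
Qed.

Lemma bd_asum s al a : 0 <= al -> bd s.+2 al a -> asum (fun l => J R l ^+ s * n1 (a l)) (4 * al).
Proof.
move=> al0 h; have := asumZ al (asum_J2 R); rewrite ger0_norm// mulrC.
apply: asum_dom => l; rewrite ger0_norm ?mulr_ge0 ?n1_ge0 ?exprn_ge0 ?(ltW (J_gt0 R l))//.
have := ler_wpM2l (ltW (JX_gt0 R l s)) (h l); rewrite !exprS => /le_trans; apply.
have j0 := J_gt0 R l; have js := JX_gt0 R l s.
by rewrite le_eqVlt; apply/orP; left; apply/eqP; field; rewrite !gt_eqF.
Qed.

End weighted_sums.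

(** * The nonlinearity and the Sobolev norms on the Fourier side *)

Section nonlinearity.
Variable R : realType.
Local Notation C := R[i].
Implicit Types (a b : int -> C) (k l : int) (M N al : R).

Lemma casum_n1_le a M l : casum a M -> n1 (a l) <= M.
Proof. by move=> /(asum_term l); rewrite ger0_norm ?n1_ge0. Qed.

(** The function is the derivative of minus the square of the series: symmetrizing l and k - l in
    the convolution replaces the factor k - l by k / 2. *)
Lemma hat_nonlin a M N k : casum a M -> casum (Dser a) N -> herm a ->
  hat (fun x => - 2 * ser a x * ser (Dser a) x) k = - ii * rc k%:~R * csum (fun l => a l * a (k - l)).
Proof.
move=> aM dN ha.
pose b l : C := rc (-2) * Dser a l.
have bM : casum b (`|2| * N).
  by apply: (asum_eq _ (asumZ 2 dN)) => l; rewrite n1_rc normrN ger0_norm.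
have hb : herm b.
  have e1 (z : C) : complex.Re (rc (-2) * z) = -2 * complex.Re z by rewrite cReM /=; ring.
  have e2 (z : C) : complex.Im (rc (-2) * z) = -2 * complex.Im z by rewrite cImM /=; ring.
  by move=> l; have [hr hi] := herm_Dser ha l; rewrite /b !e1 !e2 hr hi mulrN.
have serb x : ser b x = -2 * ser (Dser a) x.
  rewrite -(ssumZ _ (casum_Re (casum_cis (fun l => l%:~R * x) dN))); apply: eq_ssum => l.
  by rewrite /b -mulrA [LHS]cReM /=; ring.
have -> : (fun x => - 2 * ser a x * ser (Dser a) x) = (fun x => ser a x * ser b x).
  by apply: funext => x; rewrite serb; ring.
rewrite (hat_mul k aM ha (ser_cont bM) (fun x => ser_le x bM)).
have E l : a l * hat (ser b) (k - l) = rc (-2) * ii * (rc (k - l)%:~R * (a l * a (k - l))).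
  by rewrite (hat_ser _ bM hb) /b /Dser; ring.
have cm l : n1 (a l) <= M by exact: casum_n1_le.
have S1 := casum_conv k aM cm.
have S2 : casum (fun l => Dser a l * a (k - l)) (`|M| * N) by exact: casum_conv.
have S3 : casum (fun l => rc (k - l)%:~R * (a l * a (k - l))) (`|M| * N).
  apply: (asum_eq _ (asum_refl k S2)) => l; rewrite subKr /Dser -!mulrA n1_i.
  by congr n1; ring.
rewrite (eq_csum E) (csumMl _ S3).
have e1 : csum (fun l => rc (k - l)%:~R * (a l * a (k - l))) = csum (fun l => rc l%:~R * (a l * a (k - l))).
  rewrite -(csum_refl k S3); apply: eq_csum => l; rewrite subKr; ring.
have e2 : csum (fun l => rc (k - l)%:~R * (a l * a (k - l))) + csum (fun l => rc l%:~R * (a l * a (k - l)))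
   = rc k%:~R * csum (fun l => a l * a (k - l)).
  have S4 : casum (fun l => rc l%:~R * (a l * a (k - l))) (`|M| * N).
    by apply: (asum_eq _ (asum_refl k S3)) => l; rewrite subKr; congr n1; ring.
  rewrite -(csumD S3 S4) -(csumMl _ S1); apply: eq_csum => l.
  by rewrite -mulrDl -rcD -intrD subrK.
set X := csum (fun l => a l * a (k - l)) in e2 *; set Y := csum _ in e1 e2 *.
have two : rc (-2) = - (1 + 1) :> C by rewrite -[1 in RHS]/(rc 1) -rcD rcN.
have gen (p Z W : C) : Y = Z -> Y + Z = W -> - (1 + 1) * p * Y = - p * W by move=> <- <-; ring.
by rewrite two (gen ii _ _ e1 e2); ring.
Qed.

(** For nonzero k the terms l = 0 and l = k each contain m a_k; together they form the transport
    term -2 m u_x. At k = 0 they coincide, but the factor k kills everything. *)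
Lemma conv_Nop a al (m : R) k : bd 2 al a -> a 0 = rc m ->
  - ii * rc k%:~R * csum (fun l => a l * a (k - l)) = Nop 0 a a k - ii * rc (2 * m * k%:~R) * a k.
Proof.
move=> aM a0.
have cm l : n1 (a l) <= al.
  apply: le_trans (aM l) _; rewrite ler_pdivrMr ?JX_gt0//.
  by have := bd_ge0 aM; have := JX_ge1 R l 2; set z := _ ^+ 2; nra.
have cS : casum a (4 * al).
  apply: (asum_eq _ (@bd_asum R 0 al a (bd_ge0 aM) aM)) => l; by rewrite expr0 mul1r.
have S1 := casum_conv k cS cm.
have sN := casum_gterm 0 k (@mN_mle R) aM aM.
rewrite /Nop /gop -mulrA -(csumMl _ S1).
have [->|k0] := eqVneq k 0.
  rewrite mulr0z mulr0 [rc 0](_ : _ = 0)// mulr0 mul0r subr0; congr (_ * _); apply: eq_csum => l.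
  by rewrite /gterm /mN mulr0z [0 * nonres _ _ _]mul0r [rc 0](_ : _ = 0)// !mul0r.
have E l : rc k%:~R * (a l * a (k - l)) = gterm (@mN R) 0 a a k l +
    ((if l == 0 then rc k%:~R * (rc m * a k) else 0) + (if l == k then rc k%:~R * (rc m * a k) else 0)).
  rewrite /gterm /mN /nonres mulr0 cis0 mulr1.
  have [->|l0] := eqVneq l 0; first by rewrite eq_sym (negbTE k0) /= subr0 a0 mulr0 [rc 0](_ : _ = 0)// mul0r add0r addr0.
  have [->|lk] := eqVneq l k; first by rewrite subrr a0 mulr0 [rc 0](_ : _ = 0)// mul0r !add0r [a k * _]mulrC.
  by rewrite mulr1 !addr0.
rewrite (eq_csum E) (csumD sN (casumD (casum_delta _ _) (casum_delta _ _))).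
rewrite (csumD (casum_delta _ _) (casum_delta _ _)) !csum_delta.
have two : rc (2 * m * k%:~R) = (1 + 1) * (rc m * rc k%:~R) :> C.
  by apply: eq_c; rewrite !cE /=; ring.
by rewrite two; ring.
Qed.

End nonlinearity.

(** * Sobolev norms as weighted sums of coefficients *)

Section sobolev_coefficients.
Variable R : realType.
Local Notation C := R[i].
Local Notation mu := (@lebesgue_measure R).
Implicit Types (f g : R -> R) (a b : int -> C) (k l : int) (M N al : R) (w : int -> R).

(** The window of [psum] as a duplicate-free list, to be compared with the finite sets behind
    [esum]. *)
Definition zseq n : seq int := [seq j%:Z - n%:Z | j : nat <- iota 0 n.*2.+1].

Lemma zseq_uniq n : uniq (zseq n).
Proof. by rewrite map_inj_uniq ?iota_uniq// => i j /addIr []. Qed.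

Lemma mem_zseq n k : (`|k| <= n)%N -> k \in zseq n.
Proof.
move=> kn; apply/mapP; exists (absz (k + n%:Z)); last by lia.
by rewrite mem_iota; lia.
Qed.

Lemma psum_zseq w n : psum w n = \sum_(k <- zseq n) w k.
Proof. by rewrite psumE big_map /index_iota subn0. Qed.

Lemma esum_le w M : (forall k, 0 <= w k) -> asum w M ->
  (\esum_(k in [set: int]) (w k)%:E <= M%:E)%E.
Proof.
move=> w0 wM; apply: ge_ereal_sup => _ [A [fA _] <-].
rewrite fsbig_finite// sumEFin lee_fin.
set s := finmap.enum_fset _; have us : uniq s by exact: finmap.fset_uniq.
pose n := (\max_(k <- s) `|k|)%N.
have ss : {subset s <= zseq n}.
  by move=> k ks; apply: mem_zseq; exact: (@leq_bigmax_seq _ _ xpredT (fun k : int => `|k|%N)).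
have -> : \sum_(k <- s) w k = \sum_(k <- zseq n | k \in s) w k.
  rewrite -[RHS]big_filter; apply: perm_big; apply: uniq_perm => //.
    exact/filter_uniq/zseq_uniq.
  move=> k; rewrite mem_filter; case: (boolP (k \in s)) => //= ks.
  by rewrite (ss _ ks).
apply: (@le_trans _ _ (psum (fun k => `|w k|) n)) => //.
rewrite psum_zseq big_mkcond /=; apply: ler_sum => k _.
by case: ifP => // _; exact: ler_norm.
Qed.

Lemma esum_asum w M : (forall k, 0 <= w k) ->
  (\esum_(k in [set: int]) (w k)%:E <= M%:E)%E -> asum w M.
Proof.
move=> w0 wM; apply: asum_nneg => // n; rewrite psum_zseq -lee_fin -sumEFin.
rewrite fsbig_seq ?zseq_uniq//; apply: le_trans wM.
by apply: esum_ge; exists [set` zseq n] => //; split => //; exact: finite_seq.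
Qed.

Definition sqterm s f k : R := (1 + (k%:~R : R) ^+ 2) ^+ s * (fcos f k ^+ 2 + fsin f k ^+ 2).

Lemma sqterm_ge0 s f k : 0 <= sqterm s f k.
Proof. by apply: mulr_ge0; [apply: exprn_ge0|]; rewrite addr_ge0 ?sqr_ge0. Qed.

Lemma J_sq k : J R k ^+ 2 <= 2 * (1 + k%:~R ^+ 2) /\ 1 + k%:~R ^+ 2 <= J R k ^+ 2.
Proof.
rewrite JE; have -> : (k%:~R : R) ^+ 2 = `|k%:~R| ^+ 2 by rewrite real_normK// num_real.
have := normr_ge0 (k%:~R : R); set z := `|_|; have := sqr_ge0 (1 - z); split; nra.
Qed.

Lemma sqterm_le s f k : sqterm s f k <= (J R k ^+ s * n1 (hat f k)) ^+ 2.
Proof.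
rewrite exprMn exprAC; apply: ler_pM; rewrite ?addr_ge0 ?sqr_ge0 ?exprn_ge0 ?addr_ge0 ?sqr_ge0//.
  by apply: lerXn2r; rewrite ?nnegrE ?addr_ge0 ?sqr_ge0//; exact: (J_sq k).2.
rewrite /n1 /= normrN -[fcos f k ^+ 2]real_normK ?num_real// -[fsin f k ^+ 2]real_normK ?num_real//.
have := normr_ge0 (fcos f k); have := normr_ge0 (fsin f k).
by set z := `|_|; set y := `|_|; nra.
Qed.

(** [J_sq] costs 2^s and [n1] a factor 2; their product is enlarged to a perfect square, so that the
    norms compare with the root-free constant 2^(s+1). *)
Lemma sqterm_ge s f k : (J R k ^+ s * n1 (hat f k)) ^+ 2 <= (2 ^+ s.+1) ^+ 2 * sqterm s f k.
Proof.
have -> : (2 ^+ s.+1) ^+ 2 * sqterm s f k =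
  (2 * (1 + k%:~R ^+ 2)) ^+ s * (2 ^+ s.+2 * (fcos f k ^+ 2 + fsin f k ^+ 2)).
  have e : (s.+1 * 2 = s + s.+2)%N by lia.
  by rewrite /sqterm -exprM e exprD [(2 * _) ^+ s]exprMn mulrACA.
rewrite exprMn exprAC; apply: ler_pM; rewrite ?sqr_ge0 ?exprn_ge0 ?sqr_ge0//.
  by apply: lerXn2r; rewrite ?nnegrE ?mulr_ge0 ?addr_ge0 ?sqr_ge0//; exact: (J_sq k).1.
apply: (@le_trans _ _ (2 * (fcos f k ^+ 2 + fsin f k ^+ 2))).
  rewrite /n1 /= normrN -[fcos f k ^+ 2]real_normK ?num_real// -[fsin f k ^+ 2]real_normK ?num_real//.
  by set z := `|_|; set y := `|_|; have := sqr_ge0 (z - y); nra.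
apply: ler_wpM2r; first by rewrite addr_ge0 ?sqr_ge0.
by rewrite -[leLHS]expr1 ler_weXn2l// ler1n.
Qed.

Lemma norm_sq s f : (sobolev_sqnorm s f < +oo)%E ->
  sobolev_sqnorm s f = (sobolev_norm s f ^+ 2)%:E.
Proof.
move=> h; have p : (0 <= sobolev_sqnorm s f)%E.
  by apply: esum_ge0 => k _; rewrite lee_fin; exact: sqterm_ge0.
have fn : sobolev_sqnorm s f \is a fin_num by rewrite ge0_fin_numE.
by rewrite /sobolev_norm sqr_sqrtr ?fineK// fine_ge0.
Qed.

Lemma norm_ge0 s f : 0 <= sobolev_norm s f.
Proof. exact: sqrtr_ge0. Qed.

Lemma sobolev_hs s f : (sobolev_sqnorm s f < +oo)%E ->
  hs s (2 ^+ s.+1 * sobolev_norm s f) (hat f).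
Proof.
move=> h; have e := norm_sq h.
have : asum (sqterm s f) (sobolev_norm s f ^+ 2).
  by apply: esum_asum; [exact: sqterm_ge0|rewrite -e].
move=> /(asumZ ((2 ^+ s.+1) ^+ 2)); rewrite ger0_norm ?exprn_ge0// -exprMn.
by apply: asum_dom => k; rewrite ger0_norm ?sqr_ge0//; exact: sqterm_ge.
Qed.

Lemma hs_sqnorm s f M : asum (fun k => (J R k ^+ s * n1 (hat f k)) ^+ 2) M ->
  (sobolev_sqnorm s f <= M%:E)%E.
Proof.
move=> h; apply: esum_le; first exact: sqterm_ge0.
by apply: asum_dom h => k; rewrite ger0_norm ?sqterm_ge0//; exact: sqterm_le.
Qed.

Lemma hs_norm_sq s f M : asum (fun k => (J R k ^+ s * n1 (hat f k)) ^+ 2) M ->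
  sobolev_norm s f ^+ 2 <= M.
Proof.
move=> /hs_sqnorm h; rewrite -lee_fin -norm_sq//.
by apply: le_lt_trans h _; exact: ltry.
Qed.

Lemma hs_norm s f al : 0 <= al -> hs s al (hat f) ->
  (sobolev_sqnorm s f < +oo)%E /\ sobolev_norm s f <= al.
Proof.
move=> al0 h; split; first by apply: le_lt_trans (hs_sqnorm h) _; exact: ltry.
have := hs_norm_sq h; rewrite ler_sqr ?nnegrE// norm_ge0//.
Qed.

(** |f| <= 1 + f^2 on a set of finite measure. *)
Lemma sobolev_itg s f : sobolev s f -> itg f.
Proof.
move=> [_ mf if2 _]; have i1 : mu.-integrable `[0, 2 * pi] (EFin \o (fun x : R => 1 : R)).
  by apply: cont_itg => x; exact: cst_continuous.
have i3 := itgD i1 if2.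
apply: le_integrable i3 => //.
  by apply/measurable_EFinP; apply: measurable_funTS.
move=> x _ /=; rewrite lee_fin [leRHS]ger0_norm ?addr_ge0 ?sqr_ge0//.
by rewrite -[f x ^+ 2]real_normK ?num_real//; set z := `|_|; nra.
Qed.

Lemma ser_sobolev s a M al : casum a M -> herm a -> 0 <= al -> hs s al a ->
  sobolev s (ser a) /\ sobolev_norm s (ser a) <= al.
Proof.
move=> aM ha al0 h.
have h' : hs s al (hat (ser a)).
  by apply: (asum_eq _ h) => k; rewrite (hat_ser k aM ha).
have [h1 h2] := hs_norm al0 h'; split => //; split => //.
- exact: ser_per.
- by apply: continuous_measurable_fun; exact: ser_cont aM.
- by apply: (@cont_itg _ (fun x => ser a x * ser a x)) => x; apply: cvgM; exact: ser_cont aM x.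
Qed.

End sobolev_coefficients.

(** * Fourier coefficients of a solution *)

Section solution_coefficients.
Variable R : realType.
Local Notation C := R[i].
Local Notation mu := (@lebesgue_measure R).
Implicit Types (f g h : R -> R) (a b : int -> C) (k l : int) (x y s t e d M G om T : R).

Lemma hatD f g k : itg f -> itg g -> hat (fun x => f x + g x) k = hat f k + hat g k.
Proof.
move=> fi gi; apply: eq_c; rewrite !cE /= /fcos /fsin.
  rewrite -mulrDr -RintegralD//; [|exact: itg_cos..].
  by congr (_ * _); apply: eq_Rintegral => x _; rewrite mulrDl.
rewrite -opprD -mulrDr -RintegralD//; [|exact: itg_sin..].
by congr (- (_ * _)); apply: eq_Rintegral => x _; rewrite mulrDl.
Qed.

Lemma hatZ c f k : itg f -> hat (fun x => c * f x) k = rc c * hat f k.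
Proof.
move=> fi; apply: eq_c; rewrite !cE /= /fcos /fsin.
  under eq_Rintegral do rewrite -mulrA.
  by rewrite RintegralZl//; [ring|exact: itg_cos].
under eq_Rintegral do rewrite -mulrA.
by rewrite RintegralZl//; [ring|exact: itg_sin].
Qed.

Lemma hat_ae f g : itg f -> itg g -> {ae mu, forall x, f x = g x} -> forall k, hat f k = hat g k.
Proof.
move=> fi gi fg k.
have key (t : R -> R) : itg (fun x => f x * t x) -> itg (fun x => g x * t x) ->
    \int[mu]_(x in `[0, 2 * pi]) (f x * t x) = \int[mu]_(x in `[0, 2 * pi]) (g x * t x).
  move=> fti gti; rewrite /Rintegral; congr fine; apply: ae_eq_integral => //.
  - by case/integrableP: fti.
  - by case/integrableP: gti.
  - move: fg; apply: filterS; first exact: (ae_filter_ringOfSetsType mu).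
    by move=> x fx _ /=; rewrite fx.
by rewrite /hat /fcos /fsin key; [rewrite key//; exact: itg_sin|exact: itg_cos..].
Qed.

Lemma is_derive_eps f t (l : R) :
  (forall e, 0 < e -> exists2 d, 0 < d & forall s, `|s - t| < d -> `|f s - f t - (s - t) * l| <= e * `|s - t|) ->
  is_derive t (1 : R) f l.
Proof.
move=> h; have c : (h^-1 *: ((f \o shift t) (h *: (1 : R)) - f t)) @[h --> 0^'] --> l.
  apply/cvgrPdist_le => e e0; have [d d0 hd] := h e e0.
  near=> y; have y0 : y != 0 by near: y; exact: nbhs_dnbhs_neq.
  have yd : `|y| < d.
    by near: y; apply: dnbhs0_lt.
  have := hd (y + t); rewrite addrK => /(_ yd) h1.
  rewrite /= [y *: _]mulr1 distrC.
  have -> : y^-1 *: (f (y + t) - f t) - l = y^-1 * (f (y + t) - f t - y * l).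
    by rewrite [RHS]mulrBr mulrA mulVf// mul1r.
  by rewrite normrM normfV mulrC ler_pdivrMr ?normr_gt0.
split; first by apply/cvg_ex; exists l.
exact: (cvg_lim _ c).
Unshelve. all: by end_near. Qed.

(** Neither e nor the interval changes in the conclusion, so for a family of functions the estimate
    is uniform over the family. *)
Lemma mvt_eps f (df : R -> R) (a b l e : R) : (forall x, x \in `]a, b[ -> is_derive x (1 : R) f (df x)) ->
  (forall x, x \in `]a, b[ -> `|df x - l| <= e) ->
  forall x y, x \in `]a, b[ -> y \in `]a, b[ -> `|f y - f x - (y - x) * l| <= e * `|y - x|.
Proof.
move=> fd dfe.
have key x y : x < y -> x \in `]a, b[ -> y \in `]a, b[ -> `|f y - f x - (y - x) * l| <= e * `|y - x|.
  move=> xy xab yab.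
  have sub z : z \in `[x, y] -> z \in `]a, b[.
    move: xab yab; rewrite !in_itv/= => /andP[ax _] /andP[_ yb] /andP[xz zy].
    by rewrite (lt_le_trans ax xz) (le_lt_trans zy yb).
  have [|z zxy ->] := @MVT R f df x y xy (fun z zx => fd z (sub z (subset_itv_oo_cc zx))).
    apply: derivable_within_continuous => z zxy; have [] := fd z (sub z zxy); by [].
  have -> : df z * (y - x) - (y - x) * l = (df z - l) * (y - x) by ring.
  by rewrite normrM; apply: ler_wpM2r => //; exact/dfe/sub/subset_itv_oo_cc.
move=> x y xab yab; have [xy|yx|->] := ltgtP x y; first exact: key.
- have := key y x yx yab xab.
  have -> : f y - f x - (y - x) * l = - (f x - f y - (x - y) * l) by ring.
  by rewrite normrN [`|y - x|]distrC.
- by rewrite !subrr mul0r subrr normr0 mulr0.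
Qed.

Lemma serB a b M N x : casum a M -> casum b N -> ser (fun l => a l - b l) x = ser a x - ser b x.
Proof.
move=> aM bN; rewrite -(ssumB (casum_Re (casum_cis (fun l => l%:~R * x) aM)) (casum_Re (casum_cis (fun l => l%:~R * x) bN))).
by apply: eq_ssum => l; rewrite mulrBl cReD cReN.
Qed.

Lemma serD a b M N x : casum a M -> casum b N -> ser (fun l => a l + b l) x = ser a x + ser b x.
Proof.
move=> aM bN; rewrite -(ssumD (casum_Re (casum_cis (fun l => l%:~R * x) aM)) (casum_Re (casum_cis (fun l => l%:~R * x) bN))).
by apply: eq_ssum => l; rewrite mulrDl cReD.
Qed.

Lemma serZ c a M x : casum a M -> ser (fun l => rc c * a l) x = c * ser a x.
Proof.
move=> aM; rewrite -(ssumZ _ (casum_Re (casum_cis (fun l => l%:~R * x) aM))).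
by apply: eq_ssum => l; rewrite -mulrA [LHS]cReM /= mul0r subr0.
Qed.

Lemma eq_ser a b x : (forall l, a l = b l) -> ser a x = ser b x.
Proof. by move=> ab; apply: eq_ssum => l; rewrite ab. Qed.

Definition rhs om f x : R := derive1n 5 f x - 2 * f x * derive1 f x + om * derive1 f x.

Definition D5 a : int -> C := iter 5 (@Dser R) a.

Definition wsum a M : Prop := asum (fun l => J R l ^+ 5 * n1 (a l)) M.

Lemma wsum0 a M : wsum a M -> casum a M.
Proof. exact: (@casum_Dser _ 0). Qed.
Lemma wsum1 a M : wsum a M -> casum (Dser a) M.
Proof. exact: (@casum_Dser _ 1). Qed.
Lemma wsum5 a M : wsum a M -> casum (D5 a) M.
Proof. exact: (@casum_Dser _ 5). Qed.

Lemma iter_DserB j a b l : iter j (@Dser R) (fun k => a k - b k) l =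
  iter j (@Dser R) a l - iter j (@Dser R) b l.
Proof. by rewrite !iter_DserE mulrBr. Qed.

Lemma rhs_ser om a M x : wsum a M ->
  rhs om (ser a) x = ser (D5 a) x - 2 * ser a x * ser (Dser a) x + om * ser (Dser a) x.
Proof.
move=> aM; rewrite /rhs (derive1n_ser (s := 5) (M := M))//.
by rewrite -[derive1 (ser a)]/(derive1n 1 (ser a)) (derive1n_ser (s := 5) (M := M)).
Qed.

(** The product is expanded around the values of a, so that the size of b enters only through M and
    e. *)
Lemma rhs_dist om a b M N e x : wsum a M -> wsum b N -> wsum (fun k => a k - b k) e ->
  `|rhs om (ser b) x - rhs om (ser a) x| <= 2 * e * (1 + `|om| + 8 * M + 4 * e).
Proof.
move=> aM bN abe; rewrite (rhs_ser _ _ aM) (rhs_ser _ _ bN).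
have d0 : `|ser a x - ser b x| <= 2 * e.
  by rewrite -(serB x (wsum0 aM) (wsum0 bN)); apply: ser_le; exact: wsum0.
have d1 : `|ser (Dser a) x - ser (Dser b) x| <= 2 * e.
  rewrite -(serB x (wsum1 aM) (wsum1 bN)).
  by rewrite -(eq_ser x (fun l => iter_DserB 1 a b l)); apply: ser_le; exact: (wsum1 abe).
have d5 : `|ser (D5 a) x - ser (D5 b) x| <= 2 * e.
  rewrite -(serB x (wsum5 aM) (wsum5 bN)).
  by rewrite -(eq_ser x (fun l => iter_DserB 5 a b l)); apply: ser_le; exact: (wsum5 abe).
have f0 := ser_le x (wsum0 aM); have f1 := ser_le x (wsum1 aM).
have gen (p q r p' q' r' : R) : `|p - p'| <= 2 * e -> `|q - q'| <= 2 * e -> `|r - r'| <= 2 * e ->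
    `|p| <= 2 * M -> `|q| <= 2 * M ->
    `|(r' - 2 * p' * q' + om * q') - (r - 2 * p * q + om * q)| <= 2 * e * (1 + `|om| + 8 * M + 4 * e).
  move=> h0 h1 h5 g0 g1.
  have -> : (r' - 2 * p' * q' + om * q') - (r - 2 * p * q + om * q) =
    - (r - r') - om * (q - q') + 2 * (p * (q - q') + (p - p') * q - (p - p') * (q - q')) by ring.
  set A := r - r' in h5 *; set B := q - q' in h1 *; set D := p - p' in h0 *.
  have e0 : 0 <= 2 * e by exact: le_trans h0.
  have M0 : 0 <= 2 * M by exact: le_trans g0.
  have b1 : `|om * B| <= `|om| * (2 * e) by rewrite normrM ler_wpM2l.
  have b2 : `|p * B| <= 2 * M * (2 * e) by rewrite normrM ler_pM.
  have b3 : `|D * q| <= 2 * e * (2 * M) by rewrite normrM ler_pM.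
  have b4 : `|D * B| <= 2 * e * (2 * e) by rewrite normrM ler_pM.
  move: h5 b1 b2 b3 b4; move: (om * B) (p * B) (D * q) (D * B) `|om| => X1 X2 X3 X4 o.
  rewrite !ler_norml => /andP[? ?] /andP[? ?] /andP[? ?] /andP[? ?] /andP[? ?].
  by apply/andP; split; nra.
exact: gen d0 d1 d5 f0 f1.
Qed.

Lemma rhs_cont om a M : wsum a M -> continuous (rhs om (ser a)).
Proof.
move=> aM; have -> : rhs om (ser a) = (fun x => ser (D5 a) x - 2 * ser a x * ser (Dser a) x + om * ser (Dser a) x).
  by apply: funext => x; exact: rhs_ser aM.
have c0 := ser_cont (wsum0 aM); have c1 := ser_cont (wsum1 aM); have c5 := ser_cont (wsum5 aM).
move=> x; apply: cvgD; first apply: cvgB; first exact: c5.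
  by apply: cvgM; [apply: cvgM; [exact: cvg_cst|exact: c0]|exact: c1].
by apply: cvgM; [exact: cvg_cst|exact: c1].
Qed.

Lemma herm_comb a b c : herm a -> herm b -> herm (fun l => a l + rc c * b l).
Proof.
move=> ha hb l; have [r1 i1] := ha l; have [r2 i2] := hb l.
by rewrite !cReD !cImD !cReM !cImM /= r1 i1 r2 i2; split; ring.
Qed.

(** i^5 = i produces k^5, and [conv_Nop] shifts the linear frequency by -2 m. *)
Lemma hat_rhs om a al (m : R) M k : wsum a M -> bd 2 al a -> herm a -> a 0 = rc m ->
  hat (rhs om (ser a)) k = ii * rc (theta (om - 2 * m) k) * a k + Nop 0 a a k.
Proof.
move=> aM abd ha a0.
pose b l := D5 a l + rc om * Dser a l.
have h1 : herm (D5 a) by do 5 apply: herm_Dser.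
have h2 := herm_Dser ha.
pose o := `|om|.
have bM : casum b (M + `|o| * M).
  apply: (casum_dom _ (asumD (wsum5 aM) (asumZ o (wsum1 aM)))) => l.
  by apply: le_trans (n1D _ _) _; rewrite n1_rc.
have hb : herm b.
  exact: herm_comb.
have c0 := ser_cont (wsum0 aM); have c1 := ser_cont (wsum1 aM).
have E x : rhs om (ser a) x = ser b x + - 2 * ser a x * ser (Dser a) x.
  rewrite (rhs_ser _ _ aM) (serD x (wsum5 aM) (N := `|o| * M)); last first.
    by apply: (casum_dom _ (asumZ o (wsum1 aM))) => l; rewrite n1_rc.
  by rewrite (serZ _ _ (wsum1 aM)); ring.
have -> : rhs om (ser a) = (fun x => ser b x + - 2 * ser a x * ser (Dser a) x) by apply: funext.
rewrite hatD; last 2 first.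
- exact: cont_itg (ser_cont bM).
- apply: cont_itg => x; apply: cvgM; [apply: cvgM; [exact: cvg_cst|exact: c0]|exact: c1].
rewrite (hat_ser k bM hb) (hat_nonlin k (wsum0 aM) (wsum1 aM) ha) (conv_Nop k abd a0).
rewrite /b /D5 iter_DserE /theta /Dser.
have rcX n (x : R) : rc (x ^+ n) = rc x ^+ n :> C.
  by elim: n => // n IH; rewrite !exprS rcM IH.
have two : rc (2 * m * k%:~R) = rc (2 * m) * rc k%:~R :> C by exact: rcM.
rewrite [rc (_ ^+ 5 + _)]rcD rcX [rc ((om - _) * _)]rcM two rcD rcN.
have i5 : (ii : C) ^+ 5 = ii.
  have gen (j : C) : j * j = -1 -> j ^+ 5 = j.
    move=> h; have -> : j ^+ 5 = (j * j) * (j * j) * j by ring.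
    by rewrite h mulrNN !mul1r.
  exact: gen _ (@iiM R).
have gen (j p q r x y : C) : j ^+ 5 = j -> (j * p) ^+ 5 * x + q * (j * p * x) + (y - j * (r * p) * x) =
  j * (p ^+ 5 + (q - r) * p) * x + y.
  by move=> j5; rewrite exprMn j5; ring.
exact: gen i5.
Qed.

Lemma herm0 a : herm a -> a 0 = rc (complex.Re (a 0)).
Proof. by move=> /(_ 0); rewrite oppr0 => -[_ h]; apply: eq_c => //=; lra. Qed.

(** A continuous function dominating the weight 2 bound is maximized over [0, T]. The weighted l^1
    norm is one: weight 6 makes it finite and [bd_cont] continuous. *)
Lemma bd_cont_bounded T (v : R -> int -> C) : 0 < T -> bd_cont T v ->
  (forall t, t \in `[0, T] -> exists r, bd 6 r (v t)) -> exists r, ubd T 2 r v.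
Proof.
move=> T0 vc vb.
pose N t := ssum (fun k => J R k ^+ 2 * n1 (v t k)).
have bs (b : int -> C) r : bd 6 r b -> asum (fun k => J R k ^+ 2 * n1 (b k)) (4 * r).
  by move=> h; apply: bd_asum; [exact: bd_ge0 h|exact: (bd_le _ _ h)].
have cN : con 0 T N.
  apply/conP => t tT; apply/cvgrPdist_le => e e0.
  have [d d0 hd] := vc t (e / 4) tT (divr_gt0 e0 (ltr0n _ 4)).
  rewrite near_withinE; apply/nbhs_ballP; exists d => // s /= st sT.
  have st' : `|s - t| < d by rewrite distrC.
  have [r hr] := vb t tT; have [r' hr'] := vb s sT.
  have := bs _ _ (hd s sT st'); rewrite mulrC divfK ?pnatr_eq0// => hS.
  rewrite -(ssumB (bs _ _ hr) (bs _ _ hr')); apply: norm_ssum_le.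
  apply: (asum_dom _ hS) => k; rewrite -mulrBr normrM ger0_norm ?(ltW (JX_gt0 _ _ _))//.
  apply: ler_wpM2l; first exact/ltW/JX_gt0.
  have tri (z w : C) : n1 z <= n1 w + n1 (w - z).
    by have := n1B w (w - z); rewrite opprB addrC subrK.
  have h1 := tri (v t k) (v s k); have h2 := tri (v s k) (v t k).
  by rewrite n1_distC in h2; rewrite ler_norml; apply/andP; split; lra.
have [c cT hc] := EVT_max (ltW T0) cN.
exists (N c) => t tT k; rewrite ler_pdivlMr ?JX_gt0// mulrC; apply: le_trans (hc t tT).
have [r /bs hr] := vb t tT.
have p0 l : 0 <= J R l ^+ 2 * n1 (v t l) by rewrite mulr_ge0 ?n1_ge0// (ltW (JX_gt0 _ _ _)).
apply: le_trans (psum_le_ssum `|k|%N hr p0).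
rewrite -[leLHS](psum_delta _ (leqnn `|k|%N)); apply: le_psum => l.
by case: eqP => // ->.
Qed.

Section solution.
Variables (om T : R) (u0 : R -> R) (u : R -> R -> R).
Hypotheses (T0 : 0 < T) (sol : is_solution om T u0 u).

Definition uh t : int -> C := hat (u t).
Definition nrm t : R := sobolev_norm 6 (u t).
Definition dst t s : R := sobolev_norm 6 (fun x => u s x - u t x).
(* 2 ^ (s + 1) with s = 6, from sqterm_ge. *)
Local Notation c7 := (2 ^+ 7 : R).

Lemma c7_ge0 : 0 <= c7. Proof. exact: exprn_ge0. Qed.

Lemma uh_hs t : t \in `[0, T] -> hs 6 (c7 * nrm t) (uh t).
Proof. by move=> tT; have [h _ _ _] := sol; have [[_ _ _ /sobolev_hs]] := h t tT. Qed.

Lemma uh_wsum t : t \in `[0, T] -> wsum (uh t) (2 * (c7 * nrm t)).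
Proof. by move=> /uh_hs; apply: hs_asum; rewrite mulr_ge0 ?c7_ge0// norm_ge0. Qed.

Lemma uh_bd t : t \in `[0, T] -> bd 6 (c7 * nrm t) (uh t).
Proof. by move=> /uh_hs; apply: hs_bd; rewrite mulr_ge0 ?c7_ge0// norm_ge0. Qed.

Lemma u_itg t : t \in `[0, T] -> itg (u t).
Proof. by move=> tT; have [h _ _ _] := sol; have [_ /cont_itg] := h t tT. Qed.

Lemma uh_herm t : t \in `[0, T] -> herm (uh t).
Proof. by move=> /u_itg; exact: hat_herm. Qed.

Lemma u_ser t : t \in `[0, T] -> u t = ser (uh t).
Proof.
move=> tT; have [h _ _ _] := sol; have [[up _ _ _] uc] := h t tT.
by apply: funext; exact: fourier_inversion uc up (wsum0 (uh_wsum tT)).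
Qed.

Lemma uh_dist t s : t \in `[0, T] -> s \in `[0, T] ->
  hs 6 (c7 * dst t s) (fun k => uh s k - uh t k).
Proof.
move=> tT sT.
have E k : hat (fun x => u s x - u t x) k = uh s k - uh t k by exact: hatB (u_itg sT) (u_itg tT).
have p r : 0 <= c7 * nrm r by rewrite mulr_ge0 ?c7_ge0// norm_ge0.
(* Finiteness comes first: [sobolev_norm] is 0 when the sum is infinite, so a small [dst] alone
   would say nothing. *)
have h := hsB (p s) (p t) (uh_hs sT) (uh_hs tT).
have h' : hs 6 (2 * (c7 * nrm s + c7 * nrm t)) (hat (fun x => u s x - u t x)).
  by apply: (asum_eq _ h) => k; rewrite E.
have [fin _] := hs_norm (mulr_ge0 (ler0n _ 2) (addr_ge0 (p s) (p t))) h'.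
by apply: (asum_eq _ (sobolev_hs fin)) => k; rewrite E.
Qed.

Lemma dst_near t e : t \in `[0, T] -> 0 < e -> exists2 d, 0 < d &
  forall s, s \in `[0, T] -> `|s - t| < d -> c7 * dst t s <= e.
Proof.
move=> tT e0; have [_ h _ _] := sol; have c0 : 0 < c7 by rewrite exprn_gt0.
have := h t tT; move=> /cvgrPdist_le /(_ (e / c7) (divr_gt0 e0 c0)).
rewrite near_withinE => /nbhs_ballP[d /= d0 hd]; exists d => // s sT st.
have bs : ball t d s by rewrite /ball/= distrC.
have := hd s bs sT; rewrite sub0r normrN ger0_norm ?norm_ge0// ler_pdivlMr// mulrC; exact.
Qed.

Lemma uh_near t e : t \in `[0, T] -> 0 < e -> exists2 d, 0 < d &
  forall s, s \in `[0, T] -> `|s - t| < d -> hs 6 e (fun k => uh s k - uh t k).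
Proof.
move=> tT e0; have [d d0 hd] := dst_near tT e0; exists d => // s sT st.
apply: hs_le (uh_dist tT sT); last exact: hd.
by rewrite mulr_ge0 ?c7_ge0// norm_ge0.
Qed.

Lemma uh_bd_cont : bd_cont T uh.
Proof.
move=> t e tT e0; have [d d0 hd] := uh_near tT e0; exists d => // s sT st.
by apply: hs_bd; [exact: ltW|exact: hd].
Qed.

Lemma uh_ubd : exists r, ubd T 2 r uh.
Proof. by apply: bd_cont_bounded uh_bd_cont _ => // t tT; eexists; exact: uh_bd tT. Qed.

Lemma ccon_eps (F : R -> C) : (forall t e, t \in `[0, T] -> 0 < e -> exists2 d, 0 < d &
    forall s, s \in `[0, T] -> `|s - t| < d -> n1 (F s - F t) <= e) -> ccon 0 T F.
Proof.
move=> h; split; apply/conP => t tT; apply/cvgrPdist_le => e e0; have [d d0 hd] := h t e tT e0;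
  rewrite near_withinE; apply/nbhs_ballP; exists d => // s /= st sT;
  rewrite distrC -?cReN -?cImN -?cReD -?cImD; [apply: le_trans (norm_Re _) _|apply: le_trans (norm_Im _) _];
  by apply: hd; rewrite // distrC.
Qed.

Lemma uh_con : coef_con T uh.
Proof.
move=> k; apply: ccon_eps => t e tT e0; have [d d0 hd] := uh_bd_cont tT e0.
exists d => // s sT st; apply: le_trans (hd s sT st k) _.
by rewrite ler_pdivrMr ?JX_gt0// ler_peMr ?JX_ge1// ltW.
Qed.

Lemma rhs_near t e : t \in `[0, T] -> 0 < e -> exists2 d, 0 < d &
  forall s, s \in `[0, T] -> `|s - t| < d -> forall x, `|rhs om (u s) x - rhs om (u t) x| <= e.
Proof.
move=> tT e0; pose M := 2 * (c7 * nrm t).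
have M0 : 0 <= M by rewrite !mulr_ge0 ?c7_ge0// norm_ge0.
pose K := 2 * 2 * (1 + `|om| + 8 * M + 8).
have K0 : 0 < K by rewrite /K; have := normr_ge0 om; lra.
(* The cap 1 makes the quadratic bound of [rhs_dist] linear in e'. *)
pose e' := Num.min 1 (e / K).
have e'0 : 0 < e' by rewrite lt_min ltr01 divr_gt0.
have [d d0 hd] := uh_near tT e'0; exists d => // s sT st x.
have ws : wsum (fun k => uh t k - uh s k) (2 * e').
  apply: (asum_eq _ (hs_asum (ltW e'0) (hd s sT st))) => k; by rewrite n1_distC.
rewrite (u_ser sT) (u_ser tT).
apply: le_trans (rhs_dist om x (uh_wsum tT) (uh_wsum sT) ws) _; rewrite -/M.
have e1 : e' <= 1 by rewrite ge_min lexx.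
have e2 : e' * K <= e by rewrite -ler_pdivlMr// ge_min lexx orbT.
apply: le_trans e2; rewrite /K.
have gen (o m r : R) : 0 <= o -> 0 <= m -> r <= 1 -> 0 < r ->
    2 * (2 * r) * (1 + o + 8 * m + 4 * (2 * r)) <= r * (2 * 2 * (1 + o + 8 * m + 8)).
  by move=> o0 m0 r1 r0; nra.
exact: gen.
Qed.

Lemma u_rhs_cont t : t \in `[0, T] -> continuous (rhs om (u t)).
Proof. by move=> tT; rewrite (u_ser tT); exact: rhs_cont (uh_wsum tT). Qed.

Lemma rhs_con k : ccon 0 T (fun t => hat (rhs om (u t)) k).
Proof.
apply: ccon_eps => t e tT e0; have [d d0 hd] := rhs_near tT (divr_gt0 e0 (ltr0n _ 2)).
exists d => // s sT st.
rewrite -(hatB _ (cont_itg (u_rhs_cont sT)) (cont_itg (u_rhs_cont tT))).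
apply: le_trans (hat_bounded (G := e / 2) _ _ _) _; last by rewrite mulrC divfK// pnatr_eq0.
- by move=> x; apply: cvgB; [exact: u_rhs_cont sT x|exact: u_rhs_cont tT x].
- exact: hd.
Qed.

(** The equation gives a time derivative at each x separately. As the right-hand side varies
    uniformly in x ([rhs_near]), [mvt_eps] bounds the remainder uniformly in x, and the sup norm
    bounds the coefficient. *)
Lemma uh_deriv k t : t \in `]0, T[ -> forall e, 0 < e -> exists2 d, 0 < d &
  forall s, `|s - t| < d -> n1 (uh s k - uh t k - rc (s - t) * hat (rhs om (u t)) k) <= e * `|s - t|.
Proof.
move=> tT e e0; have tT' := subset_itv_oo_cc tT.
have [d1 d10 hd] := rhs_near tT' (divr_gt0 e0 (ltr0n _ 2)).
have [p1 p2] : 0 < t /\ t < T by move: tT; rewrite in_itv/= => /andP.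
pose d := Num.min d1 (Num.min t (T - t)).
have d0 : 0 < d by rewrite !lt_min d10 p1 subr_gt0 p2.
exists d => // s st.
have [q1 q2 q3] : [/\ d <= d1, d <= t & d <= T - t] by rewrite /d; split; rewrite !ge_min !lexx ?orbT.
move: d d0 st q1 q2 q3 => d d0 st q1 q2 q3.
have inI r : r \in `](t - d), (t + d)[ -> (r \in `]0, T[) /\ (`|r - t| < d1).
  rewrite !in_itv/= => /andP[r1 r2]; split; first by apply/andP; split; lra.
  by rewrite ltr_norml; apply/andP; split; lra.
have sI : s \in `](t - d), (t + d)[ by move: st; rewrite ltr_norml in_itv/= => /andP[? ?]; apply/andP; split; lra.
have tI : t \in `](t - d), (t + d)[ by rewrite in_itv/=; apply/andP; split; lra.
have sT := subset_itv_oo_cc (inI s sI).1.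
have [_ _ eq _] := sol.
have bnd x : `|u s x - u t x - (s - t) * rhs om (u t) x| <= e / 2 * `|s - t|.
  have Hd r : r \in `](t - d), (t + d)[ -> is_derive r (1 : R) (u ^~ x) (rhs om (u r) x).
    by move=> rI; apply: eq; have [] := inI r rI.
  have He r : r \in `](t - d), (t + d)[ -> `|rhs om (u r) x - rhs om (u t) x| <= e / 2.
    by move=> rI; have [rT rd] := inI r rI; apply: hd => //; exact: subset_itv_oo_cc.
  exact: (mvt_eps Hd He tI sI).
have cR := u_rhs_cont tT'.
have cg : continuous (fun x => (s - t) * rhs om (u t) x) by move=> x; apply: cvgM; [exact: cvg_cst|exact: cR].
have [hh _ _ _] := sol; have [_ cs] := hh s sT; have [_ ct] := hh t tT'.
have cst : continuous (fun x => u s x - u t x) by move=> x; apply: cvgB; [exact: cs|exact: ct].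
rewrite -(hatZ _ _ (cont_itg cR)) -(hatB _ (u_itg sT) (u_itg tT')) -(hatB _ (cont_itg cst) (cont_itg cg)).
apply: le_trans (hat_bounded (G := e / 2 * `|s - t|) _ _ bnd) _.
  by move=> x; apply: cvgB; [exact: cst|exact: cg].
by rewrite mulrA [2 * _]mulrC divfK// pnatr_eq0.
Qed.

Lemma uh_C1 : coef_C1 T uh (fun t => hat (rhs om (u t))).
Proof.
have reD (z w : C) (r : R) : complex.Re (z - w - rc r * 0) = complex.Re z - complex.Re w by rewrite mulr0 subr0 cReD cReN.
move=> k; have [c1 c2] := uh_con k; have [r1 r2] := rhs_con k.
split; split => // t tT; apply: is_derive_eps => e e0; have [d d0 hd] := uh_deriv k tT e0;
  exists d => // s st; apply: le_trans (hd s st).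
- have -> : complex.Re (uh s k) - complex.Re (uh t k) - (s - t) * complex.Re (hat (rhs om (u t)) k) =
    complex.Re (uh s k - uh t k - rc (s - t) * hat (rhs om (u t)) k).
    by rewrite !cReD !cReN cReM /=; ring.
  exact: norm_Re.
- have -> : complex.Im (uh s k) - complex.Im (uh t k) - (s - t) * complex.Im (hat (rhs om (u t)) k) =
    complex.Im (uh s k - uh t k - rc (s - t) * hat (rhs om (u t)) k).
    by rewrite !cImD !cImN cImM /=; ring.
  exact: norm_Im.
Qed.

Lemma uh_rhs t k : t \in `[0, T] -> hat (rhs om (u t)) k =
  ii * rc (theta (om - 2 * complex.Re (uh t 0)) k) * uh t k + Nop 0 (uh t) (uh t) k.
Proof.
move=> tT; rewrite {1}(u_ser tT); apply: (hat_rhs _ _ (uh_wsum tT)); last 2 first.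
- exact: uh_herm.
- exact/herm0/uh_herm.
apply: (bd_le _ _ (uh_bd tT)) => //; exact: lexx.
Qed.

Lemma Nop0 a : Nop 0 a a 0 = 0.
Proof.
rewrite /Nop /gop (eq_csum (g := fun=> 0)); last first.
  by move=> l; rewrite /gterm /mN mulr0z mul0r [rc 0](_ : _ = 0)// !mul0r.
by rewrite [csum _](_ : _ = 0) ?mulr0//; apply: eq_c; rewrite /= ssum_eq0.
Qed.

(** Frequency and nonlinearity both vanish at k = 0. This makes the shifted frequency of [uh_rhs]
    independent of time. *)
Lemma mean_const t : t \in `[0, T] -> uh t 0 = uh 0 0.
Proof.
move=> tT; have h := cC1_ftc (uh_C1 0) tT.
apply/eqP; rewrite -subr_eq0 -h; apply/eqP.
have -> : cint 0 (fun s => hat (rhs om (u s)) 0) t = cint 0 (fun s => 0) t.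
  apply: eq_cint => s sT; have sT' : s \in `[0, T].
    by move: tT sT; rewrite !in_itv/= => /andP[_ tT] /andP[-> /le_trans]; exact.
  by rewrite (uh_rhs _ sT') Nop0 /theta mulr0z expr0n /= mulr0 !addr0 [rc 0](_ : _ = 0)// mulr0 mul0r.
by apply: eq_c; rewrite /= Rintegral_cst//= mul0r.
Qed.

Lemma uh_coef_sol : coef_sol T (om - 2 * complex.Re (uh 0 0)) uh.
Proof.
move=> k; apply: (eq_cC1 (uh_C1 k)) => // t tT.
by rewrite (uh_rhs _ tT) (mean_const tT).
Qed.

End solution.

End solution_coefficients.

(** * Existence and uniqueness *)

Section translation.
Variable R : realType.
Local Notation mu := (@lebesgue_measure R).

Lemma lebesgue_measure_shift (c : R) (A : set R) : measurable A ->
  pushforward mu ((fun x => x + c) : _ -> measurableTypeR R) A = mu A.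
Proof.
move=> mA; apply/esym; apply: lebesgue_measure_unique => //=.
  by apply: continuous_measurable_fun => x; apply: cvgD; [exact: cvg_id|exact: cvg_cst].
move=> _ _ [[a b] _ <-]; rewrite /pushforward.
have -> : (fun x => x + c) @^-1` `]a, b] = `]a - c, b - c]%classic.
  by apply/seteqP; split => x /=; rewrite !in_itv/= ltrBlDr lerBrDr.
rewrite !lebesgue_measure_itv/= !lte_fin ltrD2r.
by case: ifP => // _; rewrite -!EFinB; congr EFin; ring.
Qed.

(** The exceptional set is covered by the countably many translates of N and of the point 0, which
    the open period misses. *)
Lemma ae_periodic (P : R -> Prop) : {ae mu, forall x, 0 < x < 2 * pi -> P x} ->
  (forall x (k : int), P x -> P (x + k%:~R * (2 * pi))) -> {ae mu, forall x, P x}.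
Proof.
move=> [N [mN N0 hN]] Pp; have p0 := twopi_gt0 R.
pose B (k : int) : set R := (fun x => x + - (k%:~R * (2 * pi))) @^-1` (N `|` [set 0]).
have mN0 : measurable (N `|` [set (0 : R)]) by apply: measurableU.
have nB k : mu.-negligible (B k).
  exists (B k); split => //.
    have mf : measurable_fun [set: R] (fun x : R => x + - (k%:~R * (2 * pi))).
    by apply: continuous_measurable_fun => x; apply: cvgD; [exact: cvg_id|exact: cvg_cst].
  by rewrite -[X in measurable X]setTI; exact: mf.
  have := lebesgue_measure_shift (- (k%:~R * (2 * pi))) mN0; rewrite /pushforward => ->.
  by rewrite measureU0//; exact: lebesgue_measure_set1.
have nU : mu.-negligible (\bigcup_n (B (n%:Z) `|` B (- n%:Z))).
  by apply: negligible_bigcup => n; apply: negligibleU.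
apply: negligibleS nU => x /= nP.
have [k yb] := mod_2pi x; set y := x - k%:~R * (2 * pi) in yb.
have Bk : B k x.
  rewrite /B/= -/y; have /andP[] := yb; rewrite le_eqVlt => /predU1P[<- _|y0 y2]; first by right.
  left; apply: hN => /= h; apply: nP; rewrite -[x](subrK (k%:~R * (2 * pi))); apply: Pp; apply: h.
  by rewrite y0.
exists `|k|%N => //; have [k0|k0] := leP 0 k.
  by left; rewrite (gez0_abs k0).
by right; rewrite (ltz0_abs k0) opprK.
Qed.

End translation.

(** * Hermitian symmetry of solutions *)

Section reflection.
Variable R : realType.
Local Notation C := R[i].
Implicit Types (a b : int -> C) (k l : int) (z w : C) (t r : R).

Definition cj z : C := Complex (complex.Re z) (- complex.Im z).

Lemma cjM z w : cj (z * w) = cj z * cj w.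
Proof. by apply: eq_c; rewrite /= !cE /=; ring. Qed.

Lemma n1_cj z : n1 (cj z) = n1 z.
Proof. by rewrite /n1 /= normrN. Qed.

Lemma csum_cj a M : casum a M -> csum (fun k => cj (a k)) = cj (csum a).
Proof. by move=> aM; apply: eq_c => //=; rewrite (ssumN (casum_Im aM)). Qed.

Lemma csum_opp a : csum (fun k => a (- k)) = csum a.
Proof. by apply: eq_c => /=; [exact: (ssum_opp (fun k => complex.Re (a k)))|exact: (ssum_opp (fun k => complex.Im (a k)))]. Qed.

Definition refl a k : C := cj (a (- k)).

Lemma bd_refl s r a : bd s r a -> bd s r (refl a).
Proof. by move=> h k; rewrite n1_cj; apply: le_trans (h (- k)) _; rewrite JN. Qed.

Lemma herm_refl a : herm a <-> forall k, refl a k = a k.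
Proof.
split=> [h k|h k]; first by have [h1 h2] := h k; apply: eq_c => /=; rewrite ?h1 ?h2 ?opprK.
by rewrite -[in RHS]h -[in X in _ /\ _ = - X]h /refl /= !opprK.
Qed.

(** [mN] and [phi] are odd under (k, l) -> (-k, -l); the sign of [mN] makes up for the conjugate of
    i. *)
Lemma Nop_refl t a r k : bd 2 r a -> Nop t (refl a) (refl a) k = refl (Nop t a a) k.
Proof.
move=> ar; have S := casum_gterm t (- k) (@mN_mle R) ar ar.
have mN_opp l : mN R (- k) (- l) = - mN R k l.
  by rewrite /mN /nonres !oppr_eq0 eqr_opp mulrNz mulNr.
have phi_opp l : phi R (- k) (- l) = - phi R k l.
  rewrite /phi -opprD !mulrNz; set x := k%:~R; set y := l%:~R; set z := (k + - l)%:~R; ring.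
have E l : gterm (mN R) t (refl a) (refl a) k l = - cj (gterm (mN R) t a a (- k) (- l)).
  rewrite /gterm !cjM mN_opp phi_opp /refl.
  have -> : cj (rc (- mN R k l)) = - rc (mN R k l) by apply: eq_c => /=; rewrite ?oppr0.
  have -> : cj (cis (- - phi R k l * t)) = cis (- phi R k l * t).
    by apply: eq_c => /=; rewrite opprK mulNr ?cosN ?sinN.
  have -> : - k - - l = - (k - l) by ring.
  by rewrite !mulNr opprK.
rewrite /Nop /gop /refl cjM (eq_csum E).
have S' : casum (fun l => cj (gterm (mN R) t a a (- k) (- l))) (`|8 * J R (- k) * r * r| * 4).
  by apply: (asum_eq _ (asum_opp S)) => l; rewrite n1_cj.
have -> : csum (fun l => - cj (gterm (mN R) t a a (- k) (- l))) = - cj (csum (gterm (mN R) t a a (- k))).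
  rewrite -[LHS](eq_csum (f := fun l => -1 * cj (gterm (mN R) t a a (- k) (- l)))); last by move=> l; rewrite mulN1r.
  rewrite (csumMl _ S') mulN1r; congr (- _).
  by rewrite (csum_opp (fun l => cj (gterm (mN R) t a a (- k) l))) (csum_cj S).
have -> : cj (- ii) = ii :> C by apply: eq_c; rewrite /= ?oppr0 ?opprK.
by rewrite mulrNN.
Qed.

Lemma NFsol_refl (T : R) (v : R -> int -> C) r : 0 < T -> NFsol T v -> ubd T 6 r v ->
  NFsol T (fun t => refl (v t)).
Proof.
move=> T0 h vr k.
have [h1 h2] := h (- k).
have h3 : cC1 0 T (fun t => cj (v t (- k))) (fun t => cj (Nop t (v t) (v t) (- k))).
  by split => //; exact: C1N h2.
apply: (eq_cC1 h3) => // t tT; rewrite (@Nop_refl t (v t) r)//.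
by apply: (bd_le _ _ (vr t tT)).
Qed.

(** The reflected curve solves the same equation with the same data, so uniqueness identifies the
    two. *)
Lemma NFsol_herm (T : R) (v : R -> int -> C) r : 0 < T -> small T r -> NFsol T v -> ubd T 6 r v ->
  herm (v 0) -> forall t, t \in `[0, T] -> herm (v t).
Proof.
move=> T0 sm h vr /herm_refl h0 t tT; apply/herm_refl => k.
apply: (NFsol_unique T0 sm (NFsol_refl T0 h vr) h _ vr) => // s sT.
exact: bd_refl (vr s sT).
Qed.

End reflection.

(** * Solutions from coefficients *)

Section synthesis.
Variable R : realType.
Local Notation C := R[i].
Local Notation mu := (@lebesgue_measure R).
Implicit Types (k l : int) (x y s t e d : R).

Lemma hs_dom2 (s : nat) (al : R) (a b : int -> C) : hs s al a -> (forall k, n1 (b k) <= 2 * n1 (a k)) -> hs s (2 * al) b.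
Proof.
move=> h ab; have := asumZ 4 h; rewrite ger0_norm//.
have -> : 4 * al ^+ 2 = (2 * al) ^+ 2 by ring.
apply: asum_dom => k; rewrite ger0_norm ?sqr_ge0//.
have -> : 4 * (J R k ^+ s * n1 (a k)) ^+ 2 = (J R k ^+ s * (2 * n1 (a k))) ^+ 2 by ring.
apply: lerXn2r; rewrite ?nnegrE ?mulr_ge0 ?n1_ge0 ?(ltW (JX_gt0 _ _ _))//.
by apply: ler_wpM2l (ab k); exact/ltW/JX_gt0.
Qed.

Section from_coefficients.
Variables (om T m rho gam : R) (U : R -> int -> C) (D : int -> R).
Hypotheses (T0 : 0 < T) (Usol : coef_sol T (om - 2 * m) U) (Ub : ubd T 6 rho U).
Hypotheses (Um : forall t, t \in `[0, T] -> U t 0 = rc m).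
Hypotheses (Uh : forall t, t \in `[0, T] -> herm (U t)).
Hypotheses (D0 : forall k, 0 <= D k) (Dn : forall t k, t \in `[0, T] -> n1 (U t k) <= D k).
Hypotheses (g0 : 0 <= gam) (DS : asum (fun k => (J R k ^+ 6 * D k) ^+ 2) (gam ^+ 2)).

Let hU t : t \in `[0, T] -> hs 6 gam (U t).
Proof.
move=> tT; apply: asum_dom DS => k; rewrite ger0_norm ?sqr_ge0//.
apply: lerXn2r; rewrite ?nnegrE ?mulr_ge0 ?n1_ge0 ?D0 ?(ltW (JX_gt0 _ _ _))//.
by apply: ler_wpM2l; [exact/ltW/JX_gt0|exact: Dn].
Qed.

Let DW : asum (fun k => J R k ^+ 5 * D k) (2 * gam).
Proof.
have e k : n1 (rc (D k)) = D k by rewrite /n1 /= normr0 addr0 ger0_norm.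
have h : hs 6 gam (fun k => rc (D k)) by apply: (asum_eq _ DS) => k; rewrite e.
by apply: (asum_eq _ (hs_asum g0 h)) => k; rewrite e.
Qed.

Let wU t : t \in `[0, T] -> wsum (U t) (2 * gam).
Proof. by move=> /hU; exact: hs_asum. Qed.

Let Ucon : coef_con T U.
Proof. by move=> k; have [] := cC1_con (Usol k). Qed.

(** Dominates the squared H^6 distance. The majorant D makes it continuous in s, which turns
    continuity of the coefficients into continuity with values in H^6. *)
Let dstU t s : R := ssum (fun k => (J R k ^+ 6 * n1 (U s k - U t k)) ^+ 2).

Let dom6 t s k : t \in `[0, T] -> s \in `[0, T] ->
  (J R k ^+ 6 * n1 (U s k - U t k)) ^+ 2 <= 4 * (J R k ^+ 6 * D k) ^+ 2.
Proof.
move=> tT sT; have h : n1 (U s k - U t k) <= 2 * D k.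
  by apply: le_trans (n1B _ _) _; rewrite mulr2n mulrDl !mul1r lerD// Dn.
have -> : 4 * (J R k ^+ 6 * D k) ^+ 2 = (J R k ^+ 6 * (2 * D k)) ^+ 2 by ring.
apply: lerXn2r; rewrite ?nnegrE ?mulr_ge0 ?n1_ge0 ?D0 ?(ltW (JX_gt0 _ _ _))//.
by apply: ler_wpM2l; first exact/ltW/JX_gt0.
Qed.

Let asum6 t s : t \in `[0, T] -> s \in `[0, T] ->
  asum (fun k => (J R k ^+ 6 * n1 (U s k - U t k)) ^+ 2) (4 * gam ^+ 2).
Proof.
move=> tT sT; have := asumZ 4 DS; rewrite ger0_norm//; apply: asum_dom => k.
by rewrite ger0_norm ?sqr_ge0//; exact: dom6.
Qed.

Let dstU_con t : t \in `[0, T] -> con 0 T (dstU t).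
Proof.
move=> tT; have DS4 := asumZ 4 DS; apply: (con_ssum DS4) => [k|k s sT]; last first.
  by rewrite ger0_norm ?sqr_ge0//; exact: dom6.
have [c1 c2] := cconB (Ucon k) (ccon_cst 0 T (U t k)).
have cn := conM (@con_cst R 0 T (J R k ^+ 6)) (conD (con_norm c1) (con_norm c2)).
exact: (conM cn cn).
Qed.

Let dist_le t s : t \in `[0, T] -> s \in `[0, T] ->
  sobolev_norm 6 (fun x => ser (U s) x - ser (U t) x) ^+ 2 <= dstU t s.
Proof.
move=> tT sT; apply: hs_norm_sq.
have cs := wsum0 (wU sT); have ct := wsum0 (wU tT).
have E k : hat (fun x => ser (U s) x - ser (U t) x) k = U s k - U t k.
  rewrite (hatB _ (cont_itg (ser_cont cs)) (cont_itg (ser_cont ct))).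
  by rewrite (hat_ser k cs (Uh sT)) (hat_ser k ct (Uh tT)).
have A := asum6 tT sT.
have h : asum (fun k => (J R k ^+ 6 * n1 (U s k - U t k)) ^+ 2) (dstU t s).
  apply: asum_nneg => [k|n]; first exact: sqr_ge0.
  by apply: psum_le_ssum A _ => k; exact: sqr_ge0.
by apply: (asum_eq _ h) => k; rewrite E.
Qed.

Let cont_H6 t : t \in `[0, T] ->
  sobolev_norm 6 (fun x => ser (U t') x - ser (U t) x)
     @[t' --> within `[0, T] (nbhs t)] --> (0 : R).
Proof.
move=> tT; apply/cvgrPdist_le => e e0.
have d0 : dstU t t = 0.
  rewrite -[RHS](@ssum_eq0 R); apply: eq_ssum => k.
  by rewrite subrr n1_0 mulr0 expr0n.
have := (conP _ _ _).1 (dstU_con tT) t tT; rewrite d0 => /cvgrPdist_le /(_ (e ^+ 2) (exprn_gt0 2 e0)).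
rewrite !near_withinE; apply: filterS => s h sT; have {h} := h sT.
rewrite !sub0r !normrN => h.
rewrite ger0_norm ?norm_ge0// -ler_sqr ?nnegrE ?norm_ge0// ?(ltW e0)//.
by apply: le_trans (dist_le tT sT) _; apply: le_trans h; exact: ler_norm.
Qed.

Definition Ud t k : C := ii * rc (theta (om - 2 * m) k) * U t k + Nop 0 (U t) (U t) k.

(** A summable majorant for the coefficients and their time derivatives at once: [theta] costs five
    weights, which [DW] allows, and the weight 5 of [Nop] is lowered to 2. *)
Let dd k : R := D k + ((1 + `|om - 2 * m|) * (J R k ^+ 5 * D k) + Kop R * (rho * rho) / J R k ^+ 2).

Let dd_sum : exists M, asum dd M.
Proof.
have h1 : asum D (2 * gam).
  apply: asum_dom DW => k; rewrite ger0_norm// ler_peMl// JX_ge1//.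
by eexists; apply: asumD h1 (asumD (asumZ _ DW) (asumZ _ (asum_J2 R))).
Qed.

Let theta_le k : `|theta (om - 2 * m) k| <= (1 + `|om - 2 * m|) * J R k ^+ 5.
Proof.
rewrite /theta; apply: le_trans (ler_normD _ _) _; rewrite [leRHS]mulrDl mul1r; apply: lerD.
  by rewrite normrX; apply: lerXn2r; rewrite ?nnegrE ?(ltW (J_gt0 R k))// JE lerDr.
rewrite normrM; apply: ler_wpM2l => //; rewrite exprS.
apply: (@le_trans _ _ (J R k)); first by rewrite JE lerDr.
by rewrite ler_peMr ?(ltW (J_gt0 R k))// JX_ge1.
Qed.

Let Ud_le t k : t \in `[0, T] -> n1 (U t k) <= dd k /\ n1 (Ud t k) <= dd k.
Proof.
move=> tT; have j0 := JX_gt0 R k 2; have r0 := bd_ge0 (Ub tT).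
have p1 : 0 <= (1 + `|om - 2 * m|) * (J R k ^+ 5 * D k).
  by rewrite !mulr_ge0 ?addr_ge0 ?D0 ?(ltW (JX_gt0 _ _ _)).
have p2 : 0 <= Kop R * (rho * rho) / J R k ^+ 2.
  by rewrite divr_ge0 ?mulr_ge0 ?Kop_ge0// ltW.
split; first by apply: le_trans (Dn k tT) _; rewrite lerDl addr_ge0.
apply: le_trans (n1D _ _) _; rewrite -[leLHS]add0r; apply: lerD => //; apply: lerD.
  rewrite -mulrA n1_i n1_rc mulrA; by apply: (ler_pM _ _ (theta_le k) (Dn k tT)); rewrite ?n1_ge0.
apply: le_trans (Nop_bd 0 (Ub tT) (Ub tT) k) _.
by apply: ler_wpM2l (JV_le R k _); rewrite ?mulr_ge0// Kop_ge0.
Qed.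

Let Ud_casum t : t \in `[0, T] -> exists M, casum (Ud t) M.
Proof. by move=> tT; have [M h] := dd_sum; exists M; apply: casum_dom h => k; have [] := Ud_le k tT. Qed.

(** The coefficients of the right-hand side are summable, so inversion turns the equation for
    coefficients into a pointwise one. *)
Let Ud_rhs t x : t \in `[0, T] -> rhs om (ser (U t)) x = ser (Ud t) x.
Proof.
move=> tT; have [M hM] := Ud_casum tT; have w := wU tT.
have E k : hat (rhs om (ser (U t))) k = Ud t k.
  apply: (hat_rhs _ _ w); [|exact: Uh|exact: Um].
  by apply: (bd_le _ _ (Ub tT)).
have per y : rhs om (ser (U t)) (y + 2 * pi) = rhs om (ser (U t)) y by rewrite !(rhs_ser _ _ w) !ser_per.
have hM' : casum (hat (rhs om (ser (U t)))) M by apply: (asum_eq _ hM) => k; rewrite E.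
by rewrite (fourier_inversion (@rhs_cont _ om _ _ w) per hM'); exact: eq_ser.
Qed.

Let deriv x : C1 0 T (fun t => ser (U t) x) (fun t => ser (Ud t) x).
Proof.
have [M hM] := dd_sum; have hM2 := asumZ 2 hM.
apply: (C1_ssum T0 hM2) => [k|k t tT|k t tT].
- have [h _] := cC1Z (cis (k%:~R * x)) (Usol k).
  by apply: (eq_C1 h) => t tT; rewrite mulrC.
- apply: le_trans (norm_Re _) _; apply: le_trans (n1_acis _ _ _) _.
  by rewrite ler_wpM2l//; have [] := Ud_le k tT.
- apply: le_trans (norm_Re _) _; apply: le_trans (n1_acis _ _ _) _.
  by rewrite ler_wpM2l//; have [] := Ud_le k tT.
Qed.

Lemma coef_is_solution u0 : {ae mu, forall x, ser (U 0) x = u0 x} ->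
  is_solution om T u0 (fun t => ser (U t)).
Proof.
move=> ini; split => //.
- move=> t tT; have c := wsum0 (wU tT).
  by split; [have [] := ser_sobolev c (Uh tT) g0 (hU tT)|exact: ser_cont c].
- move=> t x tT; have tT' := subset_itv_oo_cc tT.
  rewrite -[X in is_derive _ _ _ X]/(rhs om (ser (U t)) x) (Ud_rhs x tT').
  by have [_ _ h] := deriv x; exact: h.
Qed.

End from_coefficients.

Lemma small_le (T r r' : R) : 0 <= r' -> r' <= r -> small T r -> 0 < T -> small T r'.
Proof.
move=> r0 rr [_ h1 h2] T0; split => //.
  by apply: le_trans h1; rewrite ler_wpM2l ?Kop_ge0.
by apply: le_trans h2; rewrite ler_wpM2l ?exprn_ge0 ?Kop_ge0// ler_wpM2l// ltW.
Qed.

Lemma small_exists (T : R) : 0 < T -> exists2 sg : R, 0 < sg & small T (2 * sg).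
Proof.
move=> T0; have K1 := Kop_ge1 R; set K := Kop R in K1 *.
have K0 : 0 < K by lra.
pose Q := K + K ^+ 2 * T.
have Q0 : 0 < Q by rewrite addr_gt0// mulr_gt0// exprn_gt0.
have q0 : 0 < Q^-1 by rewrite invr_gt0.
have qq : Q * Q^-1 = 1 by rewrite mulfV// gt_eqF.
(* K / Q and K^2 T / Q add up to 1, so at 2 sg both products in [small] are at most 1/128. *)
exists (Q^-1 / 256); first by apply: divr_gt0; rewrite ?ltr0n.
have h1 : 0 < K * Q^-1 by rewrite mulr_gt0.
have h2 : 0 < K ^+ 2 * T * Q^-1 by rewrite !mulr_gt0// exprn_gt0.
have h3 : K * Q^-1 + K ^+ 2 * T * Q^-1 = 1 by rewrite -mulrDl.
split; rewrite -/K; first by lra.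
- have -> : K * (2 * (Q^-1 / 256)) = K * Q^-1 / 128 by field; rewrite gt_eqF.
  by lra.
- have -> : K ^+ 2 * (T * (2 * (Q^-1 / 256))) = K ^+ 2 * T * Q^-1 / 128 by field; rewrite gt_eqF.
  by lra.
Qed.

Lemma coef_mean (T om : R) (U : R -> int -> C) t : coef_sol T om U -> t \in `[0, T] -> U t 0 = U 0 0.
Proof.
move=> h tT; have := cC1_ftc (h 0) tT => {}h.
apply/eqP; rewrite -subr_eq0 -h; apply/eqP.
rewrite (@eq_cint _ _ _ (fun=> 0)); last first.
  by move=> s _; rewrite Nop0 /theta mulr0z expr0n /= mulr0 !addr0 [rc 0](_ : _ = 0)// mulr0 mul0r.
by apply: eq_c; rewrite /= Rintegral_cst//= mul0r.
Qed.

Section existence_uniqueness.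
Variables (om T sg : R).
Hypotheses (T0 : 0 < T) (sg0 : 0 < sg) (sm : small T (2 * sg)).
Local Notation c7 := (2 ^+ 7 : R).

Let zT : 0 \in `[0, T].
Proof. by rewrite in_itv/= lexx ltW. Qed.

Let smr r : 0 <= r -> r <= 2 * sg -> small T r.
Proof. by move=> r0 rs; exact: small_le r0 rs sm T0. Qed.

Lemma exists_solution u0 : sobolev 6 u0 -> c7 * sobolev_norm 6 u0 <= sg / 32 ->
  exists u, is_solution om T u0 u.
Proof.
move=> su0 nb; have [up um ui uf] := su0.
pose a0 : int -> C := hat u0; pose al := c7 * sobolev_norm 6 u0.
have al0 : 0 <= al by rewrite mulr_ge0 ?exprn_ge0// norm_ge0.
have h0 : hs 6 al a0 := sobolev_hs uf.
have b0 : bd 6 al a0 := hs_bd al0 h0.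
have i0 := sobolev_itg su0; have ha0 := hat_herm i0.
(* [NFsol_exists] wants the data within r / 2; then 5 r = 10 al is below 2 sg, as al <= sg / 32. *)
pose r := 2 * al.
have rs : 5 * r <= 2 * sg by rewrite /r; have : al <= sg / 32 by []; lra.
have r0 : 0 <= 5 * r by rewrite /r; lra.
have b0' : bd 6 (r / 2) a0 by have -> : r / 2 = al by rewrite /r; field.
have [v [vs v0 vb]] := NFsol_exists T0 (smr r0 rs) b0'.
pose m := complex.Re (a0 0); pose om' := om - 2 * m.
pose U t k : C := cis (theta om' k * t) * v t k.
have vU : vof om' U = v.
  apply: funext => t; apply: funext => k.
  by rewrite /vof /U mulrA mulNr cisNK mul1r.
have Ub : ubd T 6 (2 * (5 * r)) U.
  by move=> t tT; apply: (@uof_bd _ om'); rewrite vU; exact: vb.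
have Us : coef_sol T om' U.
  apply: (@NF_coef_sol _ _ _ _ (2 * (5 * r))); first by rewrite vU.
  by move=> t tT; apply: (bd_le _ _ (Ub t tT)).
have v0a : v 0 = a0 by apply: funext.
have U0 k : U 0 k = a0 k by rewrite /U mulr0 cis0 mul1r v0.
have Um t : t \in `[0, T] -> U t 0 = rc m.
  by move=> tT; rewrite (coef_mean Us tT) U0; exact: herm0 ha0.
have hv t : t \in `[0, T] -> herm (v t).
  by apply: (NFsol_herm T0 (smr r0 rs) vs vb); rewrite v0a.
have Uh t : t \in `[0, T] -> herm (U t).
  move=> tT k; have [h1 h2] := hv t tT k.
  rewrite /U !cE /= h1 h2.
  have -> : theta om' (- k) = - theta om' k by rewrite /theta mulrNz; ring.
  by rewrite mulNr cosN sinN; split; ring.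
have vc : coef_con T v by move=> k; have [] := cC1_con (vs k).
(* Majorant for all times: the data, which are only in weighted l^2, plus the weight 8 remainder of
   [NFmap_bd], doubled for the rotation. *)
pose D k : R := 2 * (n1 (a0 k) + (5 * r / 8) / J R k ^+ 8).
have D0 k : 0 <= D k.
  apply: mulr_ge0 => //; apply: addr_ge0; first exact: n1_ge0.
  by apply: divr_ge0; [exact: divr_ge0|exact/ltW/JX_gt0].
have Dn t k : t \in `[0, T] -> n1 (U t k) <= D k.
  move=> tT; apply: le_trans (n1M _ _) _; apply: ler_pM; rewrite ?n1_ge0 ?n1_cis//.
  have := NFsol_eq T0 k vs vb tT; rewrite v0 => /eqP; rewrite subr_eq addrC => /eqP ->.
  by apply: le_trans (n1D _ _) _; rewrite lerD2l; exact: (NFmap_bd T0 (smr r0 rs) vc vb tT k).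
have e n : n1 (rc n : C) = `|n| by rewrite /n1 /= normr0 addr0.
have hD1 : hs 6 al (fun k => rc (n1 (a0 k))).
  by apply: (asum_eq _ h0) => k; rewrite e ger0_norm// n1_ge0.
have bD2 : bd 8 (5 * r / 8) (fun k => rc ((5 * r / 8) / J R k ^+ 8)).
  by move=> k; rewrite e ger0_norm// divr_ge0 ?divr_ge0// ltW// JX_gt0.
have r8 : 0 <= 2 * (5 * r / 8) by rewrite mulr_ge0// divr_ge0.
have hD := hsD al0 r8 hD1 (bd_hs bD2).
have bD : forall k, n1 (rc (D k) : C) <= 2 * n1 (rc (n1 (a0 k)) + rc ((5 * r / 8) / J R k ^+ 8)).
  move=> k; rewrite -rcD !e ger0_norm// ger0_norm// addr_ge0 ?n1_ge0//.
  by apply: divr_ge0; [exact: divr_ge0|exact/ltW/JX_gt0].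
have hDD := hs_dom2 hD bD.
set gam := 2 * (_ * _) in hDD.
have gam0 : 0 <= gam by rewrite !mulr_ge0// addr_ge0.
have DS : asum (fun k => (J R k ^+ 6 * D k) ^+ 2) (gam ^+ 2).
  by apply: (asum_eq _ hDD) => k; rewrite e ger0_norm.
exists (fun t => ser (U t)); apply: (coef_is_solution T0 Us Ub Um Uh D0 Dn gam0 DS).
have -> : U 0 = a0 by apply: funext => k; exact: U0.
have ca0 := wsum0 (hs_asum al0 h0).
have cs := ser_cont ca0; have is_ := cont_itg cs.
(* The series is the continuous representative of u0: equal coefficients give equality almost
   everywhere on a period, then on the line. *)
have nf : nullF (fun x => ser a0 x - u0 x).
  by apply: hat_nullF => k; rewrite (hatB _ is_ i0) (hat_ser k ca0 ha0) subrr.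
have ae1 : {ae mu, forall x, 0 < x < 2 * pi -> ser a0 x = u0 x}.
  have := nullF_ae (itgB is_ i0) nf; apply: filterS; first exact: (ae_filter_ringOfSetsType mu).
  by move=> x h xI; apply/eqP; rewrite -subr_eq0; apply/eqP; exact: h.
apply: (ae_periodic ae1) => x k h.
by rewrite (per_int (@ser_per _ a0)) (per_int up) h.
Qed.

Variables (u0 : R -> R) (u : R -> R -> R).
Hypotheses (su0 : sobolev 6 u0) (nb : c7 * sobolev_norm 6 u0 <= sg / 32).
Hypothesis sol : is_solution om T u0 u.

Lemma uh0 : uh u 0 = hat u0.
Proof.
have [h _ _ ini] := sol; have [_ c0] := h 0 zT.
apply: funext => k; exact: (hat_ae (cont_itg c0) (sobolev_itg su0) ini).
Qed.

(* On the mean m the nonlinearity acts as a transport term -2 m u_x. *)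
Definition omu : R := om - 2 * complex.Re (hat u0 0).

Lemma uh_sol : coef_sol T omu (uh u).
Proof. by rewrite /omu -uh0; exact: uh_coef_sol sol. Qed.

Lemma uh_NF : NFsol T (vof omu (uh u)).
Proof. by have [r ub] := uh_ubd T0 sol; apply: coef_sol_NF ub; exact: uh_sol. Qed.

(** [is_solution] carries no bound on the size at later times; [bootstrap] supplies the one that the
    contraction requires. *)
Lemma uh_small : ubd T 6 sg (uh u).
Proof.
apply: (bootstrap T0 sg0 sm uh_NF (uh_bd_cont sol)).
rewrite uh0; have [_ _ _ /sobolev_hs h] := su0.
have al0 : 0 <= c7 * sobolev_norm 6 u0 by rewrite mulr_ge0 ?exprn_ge0// norm_ge0.
exact: bd_le (leqnn _) nb (hs_bd al0 h).
Qed.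

End existence_uniqueness.

Lemma solution_unique om T sg u0 u v : 0 < T -> 0 < sg -> small T (2 * sg) ->
  sobolev 6 u0 -> 2 ^+ 7 * sobolev_norm 6 u0 <= sg / 32 ->
  is_solution om T u0 u -> is_solution om T u0 v ->
  forall t x, t \in `[0, T] -> v t x = u t x.
Proof.
move=> T0 sg0 sm su0 nb su sv t x tT.
have bu := uh_small T0 sg0 sm su0 nb su; have bv := uh_small T0 sg0 sm su0 nb sv.
have key k : vof (omu om u0) (uh v) t k = vof (omu om u0) (uh u) t k.
  apply: (NFsol_unique T0 sm (uh_NF T0 su0 sv) (uh_NF T0 su0 su)) => //.
  - by move=> s sT; exact/vof_bd/bv.
  - by move=> s sT; exact/vof_bd/bu.
  - by move=> l; rewrite /vof (uh0 T0 su0 sv) (uh0 T0 su0 su).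
rewrite (u_ser su tT) (u_ser sv tT); apply: eq_ser => k.
by rewrite -(uofK (omu om u0) (uh v)) key uofK.
Qed.

End synthesis.

(** * The Duhamel integral *)

Section duhamel.
Variable R : realType.
Local Notation C := R[i].
Local Notation mu := (@lebesgue_measure R).
Local Notation c7 := (2 ^+ 7 : R).
Implicit Types (k l : int) (x y s t : R) (a b : int -> C).

Lemma SL_ser om t f x : SL om t f x =
  ssum (fun k => complex.Re (hat f k * cis (k%:~R * x + theta om k * t))).
Proof.
by apply: eq_ssum => k; rewrite cReM /SL_term /theta /= mulNr opprK.
Qed.

Lemma herm_cis om t a : herm a -> herm (fun k => cis (theta om k * t) * a k).
Proof.
move=> ha k; have [h1 h2] := ha k.
have -> : theta om (- k) = - theta om k by rewrite /theta mulrNz; ring.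
by rewrite !cReM !cImM /= h1 h2 mulNr cosN sinN; split; ring.
Qed.

Lemma hermB a b : herm a -> herm b -> herm (fun k => a k - b k).
Proof.
move=> ha hb k; have [h1 h2] := ha k; have [h3 h4] := hb k.
by rewrite !cReD !cImD !cReN !cImN h1 h2 h3 h4 opprD.
Qed.

Section mean_zero.
Variables (om T rho : R) (u0 : R -> R) (u : R -> R -> R).
Hypotheses (T0 : 0 < T) (rho0 : 0 < rho).
(** Makes c7 rho exactly sg / 32, the threshold of [bootstrap]; all bounds on the solution are thus
    linear in rho. *)
Let sg := 32 * (c7 * rho).
Hypothesis sm : small T (2 * sg).
Hypotheses (su0 : sobolev0 6 u0) (N0 : sobolev_norm 6 u0 <= rho).
Hypothesis sol : is_solution om T u0 u.

Let s6 : sobolev 6 u0. Proof. by case: su0. Qed.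
Let zT : 0 \in `[0, T]. Proof. by rewrite in_itv/= lexx ltW. Qed.
Let c0 : 0 < c7. Proof. exact: exprn_gt0. Qed.
Let sg0 : 0 < sg. Proof. by rewrite /sg !mulr_gt0. Qed.
Let nb : c7 * sobolev_norm 6 u0 <= sg / 32.
Proof. by rewrite /sg [32 * _]mulrC mulfK ?pnatr_eq0// ler_wpM2l// ltW. Qed.

Let m0 : complex.Re (hat u0 0) = 0.
Proof.
have [_ h] := su0; rewrite /= /fcos -[RHS](mulr0 (2 * pi)^-1) -[in RHS]h; congr (_ * _).
by apply: eq_Rintegral => x _; rewrite mulr0z mul0r cos0 mulr1.
Qed.

(** For mean-zero data the frame rotates with the very phases of [SL]. *)
Let om_eq : omu om u0 = om.
Proof. by rewrite /omu m0 mulr0 subr0. Qed.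

Let a := uh u.
Let v := vof om a.

Let vsol : NFsol T v.
Proof. by have := @uh_NF _ _ _ T0 _ _ s6 sol; rewrite om_eq. Qed.

Let ab : ubd T 6 sg a.
Proof. exact: (@uh_small _ _ _ _ T0 sg0 sm _ _ s6 nb sol). Qed.

Let vb : ubd T 6 (2 * sg) v.
Proof. by move=> t tT; apply: vof_bd; exact: ab. Qed.

Let vc : coef_con T v.
Proof. by move=> k; have [] := cC1_con (vsol k). Qed.

Let v0 : v 0 = hat u0.
Proof. by apply: funext => k; rewrite /v /vof mulr0 cis0 mul1r /a (uh0 T0 s6 sol). Qed.

Let hat_N t k : t \in `[0, T] ->
  hat (fun y => - 2 * u t y * derive1 (u t) y) k = cis (theta om k * t) * Nop t (v t) (v t) k.
Proof.
move=> tT; have w := uh_wsum sol tT.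
have b2 : bd 2 sg (a t) by apply: (bd_le _ _ (ab tT)).
rewrite (@Nop_vof _ om a t _ k b2) mulrA -[theta om k * t]opprK -mulNr cisNK mul1r.
have a00 : a t 0 = rc 0.
  by rewrite /a (coef_mean (uh_sol T0 s6 sol) tT) (uh0 T0 s6 sol) (herm0 (hat_herm (sobolev_itg s6))) m0.
have := conv_Nop k b2 a00; rewrite mulr0 mul0r [rc 0](_ : _ = 0)// mulr0 mul0r subr0 => <-.
rewrite -(hat_nonlin k (wsum0 w) (wsum1 w) (uh_herm sol tT)).
have gen (f : R -> R) b M : f = ser b -> wsum b M ->
    forall y, - 2 * f y * derive1 f y = - 2 * ser b y * ser (Dser b) y.
  move=> -> bM y.
  by rewrite -[derive1 _]/(derive1n 1 (ser b)) (derive1n_ser (s := 5) (M := M)).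
by congr (hat _ k); apply: funext; exact: gen (u_ser sol tT) w.
Qed.

(** The phase of [SL] at t - s times that of the nonlinearity at s leaves the phase at t times [Nop]
    at s, whose integral is v(t) - v(0), that is [NFmap]. *)
Lemma SD_ser t x : 0 < t -> t <= T ->
  SD om u t x = ser (fun k => cis (theta om k * t) * NFmap v t k) x.
Proof.
move=> t0 tT; have tI : t \in `[0, T] by rewrite in_itv/= tT ltW.
have sub s : s \in `[0, t] -> s \in `[0, T].
  by rewrite !in_itv/= => /andP[-> /le_trans]; apply.
pose c k := cis (k%:~R * x) * cis (theta om k * t).
pose F k s := complex.Re (c k * Nop s (v s) (v s) k).
have E s : s \in `[0, t] ->
    SL om (t - s) (fun y => - 2 * u s y * derive1 (u s) y) x = ssum (F ^~ s).
  move=> sI; rewrite SL_ser; apply: eq_ssum => k; congr complex.Re.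
  rewrite (hat_N k (sub s sI)) /c -!cisD mulrAC -cisD; congr (cis _ * _); ring.
have -> : SD om u t x = \int[mu]_(s in `[0, t]) ssum (F ^~ s).
  by apply: eq_Rintegral => s; rewrite inE => sI; exact: E.
pose Dm k := 4 * (Kop R * (2 * sg * (2 * sg)) / J R k ^+ 5).
have nc k : n1 (c k) <= 4.
  apply: le_trans (n1M _ _) _; have -> : 4 = 2 * 2 :> R by rewrite -natrM.
  by apply: ler_pM; rewrite ?n1_ge0 ?n1_cis.
have Ds : exists M, asum Dm M.
  have := asumZ (4 * (Kop R * (2 * sg * (2 * sg)))) (asum_J2 R) => hM; eexists.
  apply: asum_domn hM => k; rewrite /Dm mulrA !normrM; apply: ler_wpM2l; first by rewrite ?mulr_ge0.
  by rewrite !ger0_norm ?JV_ge0//; exact: JV_le.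
have [M hM] := Ds.
have FD k s : s \in `[0, t] -> `|F k s| <= Dm k.
  move=> sI; apply: le_trans (norm_Re _) _; apply: le_trans (n1M _ _) _.
  apply: ler_pM; rewrite ?n1_ge0//; exact: Nop_bd (vb (sub s sI)) (vb (sub s sI)) k.
have C1F k : C1 0 t (fun s => complex.Re (c k * v s k)) (F k).
  by have [h _] := cC1Z (c k) (NFsol_sub tT vsol k).
have cF k : con 0 t (F k) by have [] := C1F k.
rewrite (int_ssum t0 hM cF FD); apply: eq_ssum => k.
have tt : t \in `[0, t] by rewrite in_itv/= lexx ltW.
rewrite (C1_ftc (C1F k) tt) -(NFsol_eq T0 k vsol vb tI) /c.
rewrite -cReN -cReD; congr complex.Re; ring.
Qed.

(** 2 for the rotation, the constant of [NFmap_hs], and the square of the bound 34 c7 rho on v,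
    where 34 = 2 (1 + 16) adds the data and the remainder through [hsD]. *)
Definition Csd : R := 2 * (8 * Kop R + 16 * T * Kop R ^+ 2) * (34 * c7) ^+ 2.

Lemma SD_bound t : 0 < t -> t <= T ->
  sobolev 8 (SD om u t) /\ sobolev_norm 8 (SD om u t) <= Csd * rho ^+ 2.
Proof.
move=> t0 tT; have tI : t \in `[0, T] by rewrite in_itv/= tT ltW.
have -> : SD om u t = ser (fun k => cis (theta om k * t) * NFmap v t k).
  by apply: funext => x; exact: SD_ser.
have sm1 : 2 * sg <= 1 by exact: small_le1 sm.
have hN s : s \in `[0, T] -> bd 8 (2 * sg / 8) (NFmap v s).
  exact: (NFmap_bd T0 sm vc vb).
have s0 : 0 <= 2 * (2 * sg / 8) by rewrite !mulr_ge0 ?invr_ge0// ltW.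
have cr : 0 <= c7 * rho by rewrite mulr_ge0// ltW.
have h0 : hs 6 (c7 * rho) (hat u0).
  have [[_ _ _ /sobolev_hs h] _] := su0.
  apply: hs_le h; first by rewrite mulr_ge0 ?norm_ge0// ltW.
  by rewrite ler_wpM2l// ltW.
have hv s : s \in `[0, T] -> hs 6 (34 * (c7 * rho)) (v s).
  move=> sI; have h := hsD cr s0 h0 (bd_hs (hN s sI)).
  have -> : 34 * (c7 * rho) = 2 * (c7 * rho + 2 * (2 * sg / 8)) by rewrite /sg; field.
  apply: (asum_eq _ h) => k; rewrite -(NFsol_eq T0 k vsol vb sI) v0.
  by rewrite addrC subrK.
have al0 : 0 <= 34 * (c7 * rho) by rewrite mulr_ge0.
have al1 : 34 * (c7 * rho) <= 1 by move: sm1 cr; rewrite /sg; set z := c7 * rho; lra.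
have h8 := NFmap_hs T0 al0 al1 vc vb hv tI.
have nc k : n1 (cis (theta om k * t) * NFmap v t k) <= 2 * n1 (NFmap v t k).
  by apply: le_trans (n1M _ _) _; rewrite ler_wpM2r ?n1_ge0 ?n1_cis.
have h8' := hs_dom2 h8 nc.
have K0 := Kop_ge0 R.
have C0 : 0 <= (8 * Kop R + 16 * T * Kop R ^+ 2) * (34 * (c7 * rho)) ^+ 2.
  by rewrite mulr_ge0 ?addr_ge0 ?mulr_ge0 ?sqr_ge0// ltW.
have C0' := mulr_ge0 (ler0n R 2) C0.
have -> : Csd * rho ^+ 2 = 2 * ((8 * Kop R + 16 * T * Kop R ^+ 2) * (34 * (c7 * rho)) ^+ 2).
  by rewrite /Csd; ring.
have hh : herm (fun k => cis (theta om k * t) * NFmap v t k).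
  have hv' s : s \in `[0, T] -> herm (v s).
    move=> sI k; have := herm_cis om (- s) (uh_herm sol sI) k.
    by rewrite /v /vof !mulrN -!mulNr.
  apply: herm_cis => k; rewrite -!(NFsol_eq T0 _ vsol vb tI).
  exact: hermB (hv' t tI) (hv' 0 zT) k.
have s8 : 0 <= 2 * sg / 8 by rewrite !mulr_ge0 ?invr_ge0// ltW.
have w := @bd_asum R 0 _ _ s8 (bd_le (isT : (2 <= 8)%N) (lexx _) (hN t tI)).
have cs : casum (fun k => cis (theta om k * t) * NFmap v t k) (`|2| * (4 * (2 * sg / 8))).
  by apply: (casum_dom nc); apply: asumZ; apply: (asum_eq _ w) => k; rewrite expr0 mul1r.
exact: ser_sobolev cs hh C0' h8'.
Qed.

End mean_zero.

End duhamel.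

Theorem theorem13 (R : realType) (omega T1 T2 : R)
  (hT1 : 0 < T1) (hT12 : T1 < T2) :
  exists gamma : R,
  [/\ 0 < gamma,
      forall u0 : R -> R,
        sobolev 6 u0 -> sobolev_norm 6 u0 < gamma ->
        exists u : R -> R -> R,
          is_solution omega T2 u0 u /\
          (forall v : R -> R -> R, is_solution omega T2 u0 v ->
             forall t x : R, t \in `[0, T2] -> v t x = u t x) &
      exists c gamma' : R,
      [/\ 0 < c,
          0 < gamma' < gamma &
          forall (T : R) (u0 : R -> R) (u : R -> R -> R),
            T \in `[T1, T2] ->
            sobolev0 6 u0 -> sobolev_norm 6 u0 < gamma' ->
            is_solution omega T2 u0 u ->
            sobolev 8 (SD omega u T) /\
            sobolev_norm 8 (SD omega u T) <= c * sobolev_norm 6 u0 ^+ 2]].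
Proof.
have T0 : 0 < T2 by exact: lt_trans hT12.
have [sg sg0 sm] := small_exists T0.
set c7 : R := 2 ^+ 7; have c0 : 0 < c7 by exact: exprn_gt0.
(* c7 converts the Sobolev norm into [hs 6], and sg / 32 is the threshold of [bootstrap]. *)
pose gamma := sg / 32 / c7.
have g0 : 0 < gamma by rewrite !divr_gt0.
have gE rho : rho <= gamma -> c7 * rho <= sg / 32 by rewrite /gamma ler_pdivlMr// mulrC.
exists gamma; split => //.
  move=> u0 su0 /ltW /gE nb; have [u su] := exists_solution omega T0 sm su0 nb.
  by exists u; split => // v sv t x; exact: (solution_unique T0 sg0 sm su0 nb su sv x).
have K0 := Kop_ge1 R.
have C0 : 0 < Csd T2.
  rewrite /Csd mulr_gt0 ?exprn_gt0 ?mulr_gt0// addr_gt0 ?mulr_gt0 ?exprn_gt0//; lra.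
exists (Csd T2), (gamma / 2); split => //; first by rewrite divr_gt0//=; lra.
move=> T u0 u; rewrite in_itv/= => /andP[T1T TT2] su0 N0 sol.
have Tp : 0 < T by exact: lt_le_trans T1T.
(* rho is kept apart from the norm of u0, which may vanish while [SD_bound] wants a positive
   radius. *)
have key rho : 0 < rho -> sobolev_norm 6 u0 <= rho -> rho <= gamma ->
    sobolev 8 (SD omega u T) /\ sobolev_norm 8 (SD omega u T) <= Csd T2 * rho ^+ 2.
  move=> r0 Nr /gE rg; apply: (SD_bound T0 r0 _ su0 Nr sol Tp TT2).
  apply: small_le sm T0; first by rewrite !mulr_ge0// ltW.
  by rewrite ler_wpM2l// mulrC -ler_pdivlMr.
have g2 : gamma / 2 <= gamma by lra.
have [N1|N1] := ltP 0 (sobolev_norm 6 u0).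
  by apply: key => //; apply: le_trans g2; exact: ltW.
have NE : sobolev_norm 6 u0 = 0 by apply/eqP; rewrite eq_le N1 norm_ge0.
have [sS _] := key gamma g0 (le_trans N1 (ltW g0)) (lexx _).
(* For u0 = 0 a.e. the bound follows from those with arbitrarily small rho. *)
split => //; rewrite NE expr0n/= mulr0 leNgt; apply/negP => sp.
set S := sobolev_norm _ _ in sp key.
pose rho := Num.min (Num.min 1 gamma) (S / (2 * Csd T2)).
have r0 : 0 < rho by rewrite !lt_min ltr01 g0 divr_gt0// mulr_gt0.
have r1 : rho <= 1 by rewrite !ge_min lexx.
have r2 : rho <= gamma by rewrite !ge_min lexx orbT.
have D0 : 0 < 2 * Csd T2 by rewrite mulr_gt0.
have r3 : rho * (2 * Csd T2) <= S.
  by rewrite -(ler_pdivlMr _ _ D0) ge_min lexx orbT.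
have [_] := key rho r0 (le_trans N1 (ltW r0)) r2.
move: (Csd T2) C0 r3 => C C0 r3 h.
have h1 : C * rho ^+ 2 <= C * rho by rewrite ler_wpM2l ?(ltW C0)// expr2 ler_piMl// ltW.
lra.
Qed.
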